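(* Let $H>0$. For every reduced fraction $\ell/n\in(1,2)$ (with $\ell,n$ coprime positive integers), the original Wente torus $W_{\ell/n}$ of constant mean curvature $H$ satisfies $\mathrm{Ind}(W_{\ell/n})\ge 8$. Here $\mathrm{Ind}(W_{\ell/n})$ is the maximal dimension of a linear subspace of $$\mathcal V=\Big\{u\in C^\infty(\mathbb C/\Gamma)\;:\;\int_{\mathbb C/\Gamma}u\,dA=0\Big\}$$ on which the quadratic form $$Q(u,u)=\int_{\mathbb C/\Gamma}u\,\big(-\Delta u-4H\cosh(F)\,u\big)\,dx\,dy$$ is negative definite, where $\Gamma=\Gamma_{\ell/n}$ is the lattice and $F$ the function associated with $W_{\ell/n}$.
   Context: Notation: $z=x+iy$ is the coordinate on $\mathbb C\cong\mathbb R^2$ and $\Delta=\partial_x^2+\partial_y^2$ is the Euclidean Laplacian. For $k\in(0,1)$, $cn_k$ is the Jacobi elliptic cosine with modulus $k$ (not parameter $k^2$), of period $4\int_0^{\pi/2}\frac{d\varphi}{\sqrt{1-k^2\sin^2\varphi}}$. The function $F$. For $\theta,\overline\theta\in(0,\pi/2)$ with $\theta+\overline\theta<\pi/2$ put $k=\sin\theta$, $\overline k=\sin\overline\theta$, $\gamma=\sqrt{\tan\theta}$, $\overline\gamma=\sqrt{\tan\overline\theta}$, $$\alpha=\sqrt{4H\frac{\sin2\overline\theta}{\sin2(\theta+\overline\theta)}},\qquad \overline\alpha=\sqrt{4H\frac{\sin2\theta}{\sin2(\theta+\overline\theta)}} .$$ Define $F:\mathbb R^2\to\mathbb R$ by $$\tanh\!\Big(\frac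 F4\Big)=\gamma\,\overline\gamma\;cn_k(\alpha x)\;cn_{\overline k}(\overline\alpha y).$$ It satisfies $\Delta F+4H\sinh F=0$, which is the integrability condition for the system $$X_{xx}=\tfrac12F_xX_x-\tfrac12F_yX_y-(e^F+1)\mathcal N,\quad X_{yy}=-\tfrac12F_xX_x+\tfrac12F_yX_y-(e^F-1)\mathcal N,$$ $$X_{xy}=\tfrac12F_yX_x+\tfrac12F_xX_y,\quad \mathcal N_x=H(1+e^{-F})X_x,\quad \mathcal N_y=H(1-e^{-F})X_y .$$ Its solution is, up to rigid motion, a conformal immersion $X:\mathbb R^2\to\mathbb R^3$ with unit normal $\mathcal N$, constant mean curvature $H$, induced metric $I=E(dx^2+dy^2)$ with $HE=e^F$, and curvature line coordinates $(x,y)$. Let $$x_{\ell n}=\frac4\alpha\int_0^{\pi/2}\frac{d\varphi}{\sqrt{1-k^2\sin^2\varphi}},\qquad y_{\ell n}=\frac4{\overline\alpha}\int_0^{\pi/2}\frac{d\varphi}{\sqrt{1-\overline k^2\sin^2\varphi}}$$ be the periods of $cn_k(\alpha x)$ and $cn_{\overline k}(\overline\alpha y)$. The choice of $\theta,\overline\theta$ for $W_{\ell/n}$ (known facts of Abresch and Walter). There is exactly one value $\overline\theta$, independent of $\ell/n$, which solves the period problem in the $y$-direction, i.e. for which the (planar) curvature lines $x=\text{const}$ close up with period $y_{\ell n}$: $X(x,y+y_{\ell n})=X(x,y)$. Numerically $\overline\theta\cong65.354955^\circ$. With this $\overline\theta$, for each reduced fraction $\ell/n\in(1,2)$ there is a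 unique $\theta\in(0,\frac\pi2-\overline\theta)$ with $$\int_0^{\pi/2}\frac{1+\tan\theta\tan\overline\theta\cos^2\varphi}{1-\tan\theta\tan\overline\theta\cos^2\varphi}\,\frac{d\varphi}{\sqrt{1-\sin^2\theta\sin^2\varphi}}=\frac{\ell}{n}\,\frac{\pi}{2}\sqrt{\frac{\sin2\overline\theta}{\sin2(\theta+\overline\theta)}}\,.$$ For these $\theta,\overline\theta$ (and the corresponding $F$), $X$ descends to a conformal immersion of the flat torus $\mathbb C/\Gamma$ into $\mathbb R^3$, where $$\Gamma=\mathrm{span}_{\mathbb Z}\{(nx_{\ell n},0),(0,y_{\ell n})\}\ \text{ if }\ell\text{ is odd},\qquad \Gamma=\mathrm{span}_{\mathbb Z}\Big\{\Big(\frac{nx_{\ell n}}2,\frac{y_{\ell n}}2\Big),(0,y_{\ell n})\Big\}\ \text{ if }\ell\text{ is even}.$$ The image of this immersed torus is the original Wente torus $W_{\ell/n}$. The function $F$ is $\Gamma$-periodic, and the area element of the induced metric is $dA=E\,dx\,dy=\frac{e^F}{H}\,dx\,dy$. The form $Q$ is the second variation of area, with respect to normal variations $u\mathcal N$, of the immersion, and the condition $\int u\,dA=0$ expresses volume preservation. The index does not depend on the choice of $H$. *)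

(* Defs.v *)
From Stdlib Require Import Reals Lra.
From Coquelicot Require Import Coquelicot.
Local Open Scope R_scope.

Definition Dx (u : R -> R -> R) : R -> R -> R :=
  fun x y => Derive (fun t => u t y) x.
Definition Dy (u : R -> R -> R) : R -> R -> R :=
  fun x y => Derive (fun t => u x t) y.

Definition smooth (u : R -> R -> R) : Prop :=
  forall (n : nat) (x y : R), ex_diff_n u n x y.

Definition Laplacian (u : R -> R -> R) : R -> R -> R :=
  fun x y => Dx (Dx u) x y + Dy (Dy u) x y.

Definition ellF (k phi : R) : R :=
  RInt (fun psi => / sqrt (1 - k ^ 2 * sin psi ^ 2)) 0 phi.

Definition ellK (k : R) : R := ellF k (PI / 2).

(** The first argument is the modulus k, not the parameter k^2.
    For [0 < k < 1], [ellF k] is an increasing bijection of [R]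
    ([jacobi_am_correct] below), and the Jacobi amplitude is its inverse;
    [iota P] is the unique real satisfying [P]. *)
Definition jacobi_am (k u : R) : R := iota (fun phi : R => ellF k phi = u).

Lemma ellF_rad_pos k psi : 0 < k < 1 -> 0 < 1 - k ^ 2 * sin psi ^ 2 <= 1.
Proof.
intros Hk. pose proof (SIN_bound psi) as Hs.
assert (0 <= sin psi ^ 2 <= 1) by nra. assert (0 < k^2 < 1) by nra. nra.
Qed.

Lemma ellF_integrand_continuous k psi : 0 < k < 1 ->
  continuous (fun psi => / sqrt (1 - k ^ 2 * sin psi ^ 2)) psi.
Proof.
intros Hk. apply (ex_derive_continuous (V := R_NormedModule)).
pose proof (ellF_rad_pos k psi Hk) as Hr.
auto_derive. split; [lra|split; auto].
apply Rgt_not_eq, sqrt_lt_R0. lra.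
Qed.

Lemma ellF_derive k phi : 0 < k < 1 ->
  is_derive (ellF k) phi (/ sqrt (1 - k ^ 2 * sin phi ^ 2)).
Proof.
intros Hk. unfold ellF.
apply (is_derive_RInt (V := R_NormedModule) (fun psi => / sqrt (1 - k ^ 2 * sin psi ^ 2)) _ 0).
- apply filter_forall. intros b. apply (RInt_correct (V := R_CompleteNormedModule)).
  apply (ex_RInt_continuous (V := R_CompleteNormedModule)).
  intros z _. now apply ellF_integrand_continuous.
- now apply ellF_integrand_continuous.
Qed.

Lemma ellF_integrand_ge1 k psi : 0 < k < 1 -> 1 <= / sqrt (1 - k ^ 2 * sin psi ^ 2).
Proof.
intros Hk. pose proof (ellF_rad_pos k psi Hk) as Hr.
rewrite <- Rinv_1 at 1. apply Rinv_le_contravar.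
- apply sqrt_lt_R0; lra.
- rewrite <- sqrt_1 at 2. apply sqrt_le_1; lra.
Qed.

Lemma ellF_expand k a b : 0 < k < 1 -> a <= b -> b - a <= ellF k b - ellF k a.
Proof.
intros Hk Hab.
destruct (MVT_gen (ellF k) a b (fun p => / sqrt (1 - k ^ 2 * sin p ^ 2))) as [c [_ Hc]].
- intros x _. now apply ellF_derive.
- intros x _. apply derivable_continuous_pt. exists (/ sqrt (1 - k ^ 2 * sin x ^ 2)).
  apply is_derive_Reals. now apply ellF_derive.
- rewrite Hc. pose proof (ellF_integrand_ge1 k c Hk). nra.
Qed.

Lemma ellF_0 k : ellF k 0 = 0.
Proof. unfold ellF. apply (RInt_point (V := R_CompleteNormedModule)). Qed.

Lemma jacobi_am_correct k u : 0 < k < 1 -> ellF k (jacobi_am k u) = u.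
Proof.
intros Hk. unfold jacobi_am.
apply (iota_correct (V := R_CompleteNormedModule) (fun phi : R => ellF k phi = u)).
assert (Hinj : forall a b, ellF k a = ellF k b -> a = b).
{ intros a b Hab. destruct (Rle_dec a b) as [h|h].
  - pose proof (ellF_expand k a b Hk h). lra.
  - pose proof (ellF_expand k b a Hk ltac:(lra)). lra. }
set (M := Rabs u + 1).
assert (HM : - M < u < M /\ 0 < M).
{ unfold M. pose proof (Rabs_pos u). pose proof (Rle_abs u).
  pose proof (Rle_abs (- u)) as h. rewrite Rabs_Ropp in h. lra. }
pose proof (ellF_expand k 0 M Hk ltac:(lra)) as h1.
pose proof (ellF_expand k (- M) 0 Hk ltac:(lra)) as h2.
rewrite ellF_0 in h1, h2.
destruct (IVT (fun p => ellF k p - u) (- M) M) as [z [_ Hz]].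
- intros x. apply continuity_pt_minus; [|apply continuity_pt_const; now intros ? ?].
  apply derivable_continuous_pt. exists (/ sqrt (1 - k ^ 2 * sin x ^ 2)).
  apply is_derive_Reals. now apply ellF_derive.
- lra.
- lra.
- lra.
- exists z. split; [lra|]. intros z' Hz'. apply Hinj. lra.
Qed.

Definition jacobi_cn (k u : R) : R := cos (jacobi_am k u).

Definition alpha (H theta thetab : R) : R :=
  sqrt (4 * H * (sin (2 * thetab) / sin (2 * (theta + thetab)))).
Definition alphab (H theta thetab : R) : R :=
  sqrt (4 * H * (sin (2 * theta) / sin (2 * (theta + thetab)))).

(** Since [tanh] is injective and the right-hand side lies in (-1, 1) when
    [0 < theta], [0 < thetab] and [theta + thetab < PI / 2], this determines
    [F] uniquely. *)
Definition is_wente_F (H theta thetab : R) (F : R -> R -> R) : Prop :=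
  forall x y : R,
    tanh (F x y / 4) =
      sqrt (tan theta) * sqrt (tan thetab)
      * jacobi_cn (sin theta) (alpha H theta thetab * x)
      * jacobi_cn (sin thetab) (alphab H theta thetab * y).

Definition x_period (H theta thetab : R) : R :=
  4 / alpha H theta thetab * ellK (sin theta).
Definition y_period (H theta thetab : R) : R :=
  4 / alphab H theta thetab * ellK (sin thetab).

Inductive coord : Set := c1 | c2 | c3.

Definition R3map : Type := coord -> R -> R -> R.

Definition DX (V : R3map) : R3map := fun j => Dx (V j).
Definition DY (V : R3map) : R3map := fun j => Dy (V j).
Definition dot (V W : R3map) (x y : R) : R :=
  V c1 x y * W c1 x y + V c2 x y * W c2 x y + V c3 x y * W c3 x y.

Record is_wente_immersion (H : R) (F : R -> R -> R) (X Nu : R3map) : Prop := {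
  X_smooth : forall j, smooth (X j);
  Nu_smooth : forall j, smooth (Nu j);
  X_xx : forall j x y,
    DX (DX X) j x y =
      / 2 * Dx F x y * DX X j x y - / 2 * Dy F x y * DY X j x y
      - (exp (F x y) + 1) * Nu j x y;
  X_yy : forall j x y,
    DY (DY X) j x y =
      - / 2 * Dx F x y * DX X j x y + / 2 * Dy F x y * DY X j x y
      - (exp (F x y) - 1) * Nu j x y;
  X_xy : forall j x y,
    DY (DX X) j x y =
      / 2 * Dy F x y * DX X j x y + / 2 * Dx F x y * DY X j x y;
  Nu_x : forall j x y,
    DX Nu j x y = H * (1 + exp (- F x y)) * DX X j x y;
  Nu_y : forall j x y,
    DY Nu j x y = H * (1 - exp (- F x y)) * DY X j x y;
  Nu_unit : forall x y, dot Nu Nu x y = 1;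
  Nu_perp_x : forall x y, dot Nu (DX X) x y = 0;
  Nu_perp_y : forall x y, dot Nu (DY X) x y = 0;
  (* induced metric E (dx^2 + dy^2) with H E = exp F *)
  metric_xx : forall x y, H * dot (DX X) (DX X) x y = exp (F x y);
  metric_yy : forall x y, H * dot (DY X) (DY X) x y = exp (F x y);
  metric_xy : forall x y, dot (DX X) (DY X) x y = 0
}.

Definition closes_in_y (H theta thetab : R) (X : R3map) : Prop :=
  forall j x y, X j x (y + y_period H theta thetab) = X j x y.

Definition x_period_equation (l n : nat) (theta thetab : R) : Prop :=
  RInt (fun phi =>
          (1 + tan theta * tan thetab * cos phi ^ 2)
          / (1 - tan theta * tan thetab * cos phi ^ 2)
          * / sqrt (1 - sin theta ^ 2 * sin phi ^ 2)) 0 (PI / 2)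
  = INR l / INR n * (PI / 2)
    * sqrt (sin (2 * thetab) / sin (2 * (theta + thetab))).

(** A lattice, given by a Z-basis. *)
Definition lattice : Type := ((R * R) * (R * R))%type.

Definition in_lattice (G : lattice) (p : R * R) : Prop :=
  exists a b : Z,
    fst p = IZR a * fst (fst G) + IZR b * fst (snd G) /\
    snd p = IZR a * snd (fst G) + IZR b * snd (snd G).

Definition periodic (G : lattice) (u : R -> R -> R) : Prop :=
  forall p : R * R, in_lattice G p ->
  forall x y : R, u (x + fst p) (y + snd p) = u x y.

(** Integral of a [G]-periodic function over the torus C/G with respect to
    dx dy, computed on the fundamental parallelogram by the change of
    variables (s,t) |-> s v + t w, where (v, w) is the basis of [G]. *)
Definition torus_int (G : lattice) (f : R -> R -> R) : R :=
  let v := fst G in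
  let w := snd G in
  Rabs (fst v * snd w - snd v * fst w)
  * RInt (fun s =>
      RInt (fun t => f (s * fst v + t * fst w) (s * snd v + t * snd w)) 0 1)
    0 1.

Definition wente_lattice (l n : nat) (H theta thetab : R) : lattice :=
  let xp := x_period H theta thetab in
  let yp := y_period H theta thetab in
  (if Nat.odd l then (INR n * xp, 0) else (INR n * xp / 2, yp / 2), (0, yp)).

Definition area_density (H : R) (F : R -> R -> R) (x y : R) : R :=
  exp (F x y) / H.

Definition in_V (G : lattice) (H : R) (F u : R -> R -> R) : Prop :=
  smooth u /\ periodic G u /\
  torus_int G (fun x y => u x y * area_density H F x y) = 0.

Definition Q (G : lattice) (H : R) (F u : R -> R -> R) : R :=
  torus_int G (fun x y =>
    u x y * (- Laplacian u x y - 4 * H * cosh (F x y) * u x y)).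

Definition is_subspace (W : (R -> R -> R) -> Prop) : Prop :=
  W (fun _ _ => 0) /\
  forall (a b : R) (u v : R -> R -> R),
    W u -> W v -> W (fun x y => a * u x y + b * v x y).

Definition lincomb (m : nat) (c : nat -> R) (b : nat -> R -> R -> R)
  : R -> R -> R :=
  fun x y => sum_n_m (fun i => c i * b i x y) 1 m.

(** [W] has a basis [b 1, ..., b m]. *)
Definition has_dim (W : (R -> R -> R) -> Prop) (m : nat) : Prop :=
  exists b : nat -> R -> R -> R,
    (forall i : nat, (1 <= i <= m)%nat -> W (b i)) /\
    (forall c : nat -> R,
       (forall x y : R, lincomb m c b x y = 0) ->
       forall i : nat, (1 <= i <= m)%nat -> c i = 0) /\
    (forall u : R -> R -> R, W u ->
       exists c : nat -> R, forall x y : R, u x y = lincomb m c b x y).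

Definition negative_definite_on (W : (R -> R -> R) -> Prop)
  (q : (R -> R -> R) -> R) : Prop :=
  forall u : R -> R -> R,
    W u -> (exists x y : R, u x y <> 0) -> q u < 0.

(** Supremum in the extended reals of the dimensions of the finite-dimensional
    subspaces of V on which Q is negative definite. *)
Definition Ind (G : lattice) (H : R) (F : R -> R -> R) : Rbar :=
  Lub_Rbar (fun r : R =>
    exists (m : nat) (W : (R -> R -> R) -> Prop),
      r = INR m /\
      is_subspace W /\
      (forall u, W u -> in_V G H F u) /\
      has_dim W m /\
      negative_definite_on W (Q G H F)).

(* Main.v *)
From Stdlib Require Import Reals ZArith List Lra Lia Psatz FunctionalExtensionality.
From Coquelicot Require Import Coquelicot.
Require Import Defs.
Import ListNotations.
Local Open Scope R_scope.

(** Q is tested on products of [cos] or [sin] of [j p x / n] ([p] is the fundamental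
    frequency in x) with one of 1, cn, sn, sn cn in y. The potential [4 H cosh F]
    has period [x_ln / 2] in x, and is even and [y_ln / 2]-periodic in y, so
    different products are Q-orthogonal: by parity or half-period antisymmetry in y,
    or because the x-frequency of their product is not a multiple of the potential's.
    Nine of them, the constant 1 among them, satisfy [Q < 0]; as 1 has nonzero
    volume, the volume constraint costs one dimension and eight remain.

    With [w = t cn_k^2 cn_kb^2] and [t = tan theta tan thetab] one has
    [cosh F = 1 + 8 w / (1 - w)^2], so each inequality reduces to the moments of
    [cn_kb^2] over a period. Along the line where [F = 0] the tangent vector [X_y]
    rotates in a fixed plane, and closing in y is a linear relation between the first
    two moments; the moment recurrence and the positivity of means of squares then
    confine [v = cot^2 thetab] to [(0.2, 0.2145)]. The x-period equation is needed only
    for [l/n = 3/2] and [4/3], as an upper bound on [t]. *)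

(** Explicit products avoid spectral theory: Q is diagonal on their span, so each mode costs one
    scalar inequality. In [t] and [v] everything except the complete integrals is rational:
    [kb^2 = 1/(1+v)], [k^2 = v t^2/(1+v t^2)], and [alpha^2], [alphab^2] are [4 H (1+v t^2)/D],
    [4 H t (1+v)/D] with [D = (1+v t)(1-t)]. The closing relation makes every normalised moment a
    polynomial in [v], and no numerical value of [thetab] is assumed. The obstacle is [t] near 1:
    the criteria for general [l/n] are proved for every [t] in (0, 1), and there a truncated series
    for the potential is too weak. So the potential is integrated in closed form against 1, and a
    correlation inequality passes the bound on to cn, for x-frequencies up to two thirds of the top
    one. The fractions 3/2 and 4/3 have too few such frequencies: cn must go up to the top one, and
    sn and sn cn must help out. These use five terms of the series, and hence a bound keeping [t]
    away from 1. *)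

(** * Continuity, and integrals of periodic functions *)

Definition cont (f : R -> R) : Prop := forall x, continuous f x.
Definition cont2 (f : R -> R -> R) : Prop := forall x y, continuity_2d_pt f x y.

Lemma cont_ex_RInt (f : R -> R) a b : cont f -> ex_RInt f a b.
Proof.
intros Hf. apply (ex_RInt_continuous (V := R_CompleteNormedModule)).
intros z _. apply Hf.
Qed.

Lemma cont_derive f df : (forall x, is_derive f x (df x)) -> cont f.
Proof.
intros Hd x. apply (ex_derive_continuous (V := R_NormedModule)). eexists; apply Hd.
Qed.

Lemma cont_const c : cont (fun _ => c).
Proof. intros x. apply continuous_const. Qed.

Lemma cont_id : cont (fun x => x).
Proof. intros x. apply continuous_id. Qed.

Lemma cont_plus f g : cont f -> cont g -> cont (fun x => f x + g x).
Proof. intros Hf Hg x. apply (continuous_plus f g); auto. Qed.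

Lemma cont_opp f : cont f -> cont (fun x => - f x).
Proof. intros Hf x. apply (continuous_opp f); auto. Qed.

Lemma cont_minus f g : cont f -> cont g -> cont (fun x => f x - g x).
Proof. intros Hf Hg. apply cont_plus; [|apply cont_opp]; auto. Qed.

Lemma cont_mult f g : cont f -> cont g -> cont (fun x => f x * g x).
Proof. intros Hf Hg x. apply (continuous_mult f g); auto. Qed.

Lemma cont_pow f n : cont f -> cont (fun x => f x ^ n).
Proof.
intros Hf. induction n as [|n IH]; simpl; [apply cont_const|now apply cont_mult].
Qed.

Lemma cont_comp f g : cont f -> cont g -> cont (fun x => f (g x)).
Proof. intros Hf Hg x. apply continuous_comp; auto. Qed.

Lemma cont_cos : cont cos.
Proof. intros x. apply continuous_cos. Qed.

Lemma cont_sin : cont sin.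
Proof. intros x. apply continuous_sin. Qed.

Lemma cont_inv f : cont f -> (forall x, f x <> 0) -> cont (fun x => / f x).
Proof. intros Hf H0 x. apply continuous_comp; [apply Hf|]. now apply continuous_Rinv. Qed.

Lemma cont2_comp f g h : cont2 f -> cont2 g -> cont2 h ->
  cont2 (fun x y => f (g x y) (h x y)).
Proof.
intros Hf Hg Hh x y eps.
destruct (Hf (g x y) (h x y) eps) as [d Hd].
destruct (Hg x y d) as [d1 H1]. destruct (Hh x y d) as [d2 H2].
assert (Hm : 0 < Rmin d1 d2) by (apply Rmin_pos; [apply d1|apply d2]).
exists (mkposreal _ Hm). simpl. intros u v Hu Hv.
apply Hd; [apply H1|apply H2];
  eapply Rlt_le_trans; eauto; (apply Rmin_l || apply Rmin_r).
Qed.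

Lemma cont2_const c : cont2 (fun _ _ => c).
Proof. intros x y. apply continuity_2d_pt_const. Qed.

Lemma cont2_id1 : cont2 (fun x _ => x).
Proof. intros x y. apply continuity_2d_pt_id1. Qed.

Lemma cont2_id2 : cont2 (fun _ y => y).
Proof. intros x y. apply continuity_2d_pt_id2. Qed.

Lemma cont2_plus f g : cont2 f -> cont2 g -> cont2 (fun x y => f x y + g x y).
Proof. intros Hf Hg x y. now apply continuity_2d_pt_plus. Qed.

Lemma cont2_opp f : cont2 f -> cont2 (fun x y => - f x y).
Proof. intros Hf x y. now apply continuity_2d_pt_opp. Qed.

Lemma cont2_minus f g : cont2 f -> cont2 g -> cont2 (fun x y => f x y - g x y).
Proof. intros Hf Hg x y. now apply continuity_2d_pt_minus. Qed.

Lemma cont2_mult f g : cont2 f -> cont2 g -> cont2 (fun x y => f x y * g x y).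
Proof. intros Hf Hg x y. now apply continuity_2d_pt_mult. Qed.

Lemma cont2_1d f g : cont f -> cont2 g -> cont2 (fun x y => f (g x y)).
Proof.
intros Hf Hg x y. apply continuity_1d_2d_pt_comp; [|apply Hg].
apply continuity_pt_filterlim. apply Hf.
Qed.

Lemma cont2_slice f x : cont2 f -> cont (f x).
Proof.
intros Hf y. apply continuity_pt_filterlim. apply continuity_pt_locally.
intros eps. destruct (Hf x y eps) as [d Hd]. exists d. intros v Hv.
apply Hd; [|exact Hv]. rewrite Rminus_eq_0, Rabs_R0. apply d.
Qed.

(** Rewriting with integral lemmas can leave an equality typed at a Coquelicot structure that is
    only convertible to [R]; [ring] works once the type is [R] itself. *)
Ltac to_R := match goal with |- @eq _ ?a ?b => change (@eq R a b) end.
Ltac rring := to_R; ring.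

Ltac cts := match goal with
  | h : cont ?f |- cont ?f => exact h
  | h : cont ?f |- cont (fun x => ?f x) => exact h
  | h : cont2 ?f |- cont (fun y => ?f ?x y) => exact (cont2_slice f x h)
  | |- cont (fun _ => ?c) => exact (cont_const c)
  | |- cont (fun x => x) => exact cont_id
  | |- cont (fun x => - @?f x) => apply (cont_opp f); cts
  | |- cont (fun x => @?f x - @?g x) => apply (cont_minus f g); cts
  | |- cont (fun x => @?f x + @?g x) => apply (cont_plus f g); cts
  | |- cont (fun x => @?f x * @?g x) => apply (cont_mult f g); cts
  | |- cont (fun x => @?f x ^ ?n) => apply (cont_pow f n); cts
  | |- cont (fun x => cos (@?f x)) => apply (cont_comp cos f cont_cos); cts
  | |- cont (fun x => sin (@?f x)) => apply (cont_comp sin f cont_sin); cts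
  | h : cont ?k |- cont (fun x => ?k (@?f x)) => apply (cont_comp k f h); cts
  | |- _ => idtac
  end.

Ltac cts2 := match goal with
  | h : cont2 ?f |- cont2 ?f => exact h
  | h : cont2 ?f |- cont2 (fun x y => ?f x y) => exact h
  | |- cont2 (fun _ _ => ?c) => exact (cont2_const c)
  | |- cont2 (fun x y => x) => exact cont2_id1
  | |- cont2 (fun x y => y) => exact cont2_id2
  | |- cont2 (fun x y => - @?f x y) => apply (cont2_opp f); cts2
  | |- cont2 (fun x y => @?f x y - @?g x y) => apply (cont2_minus f g); cts2
  | |- cont2 (fun x y => @?f x y + @?g x y) => apply (cont2_plus f g); cts2
  | |- cont2 (fun x y => @?f x y * @?g x y) => apply (cont2_mult f g); cts2
  | |- cont2 (fun x y => @?f x y ^ ?n) => apply (cont2_1d (fun z => z ^ n) f); [cts|cts2]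
  | h : cont2 (fun _ y => ?k y) |- cont2 (fun _ y => ?k y) => exact h
  | h : cont ?k |- cont2 (fun x y => ?k (@?f x y)) => apply (cont2_1d k f h); cts2
  | |- _ => idtac
  end.

Lemma RInt_FTC (F f : R -> R) a b : (forall x, is_derive F x (f x)) -> cont f ->
  RInt f a b = F b - F a.
Proof.
intros Hd Hc. apply is_RInt_unique.
apply (is_RInt_derive (V := R_CompleteNormedModule) F f); intros; auto.
Qed.

Lemma RInt_cplus (f g : R -> R) a b : cont f -> cont g ->
  RInt (fun x => f x + g x) a b = RInt f a b + RInt g a b.
Proof.
intros Hf Hg.
apply (RInt_plus (V := R_CompleteNormedModule)); now apply cont_ex_RInt.
Qed.

Lemma RInt_cminus (f g : R -> R) a b : cont f -> cont g ->
  RInt (fun x => f x - g x) a b = RInt f a b - RInt g a b.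
Proof.
intros Hf Hg.
apply (RInt_minus (V := R_CompleteNormedModule)); now apply cont_ex_RInt.
Qed.

Lemma RInt_cscal c (f : R -> R) a b : cont f -> RInt (fun x => c * f x) a b = c * RInt f a b.
Proof.
intros Hf. apply (RInt_scal (V := R_CompleteNormedModule)); now apply cont_ex_RInt.
Qed.

Lemma RInt_cconst (c : R) a b : RInt (fun _ => c) a b = (b - a) * c.
Proof. apply (RInt_const (V := R_CompleteNormedModule)). Qed.

Lemma RInt_cext (f g : R -> R) a b : (forall x, f x = g x) -> RInt f a b = RInt g a b.
Proof. intros E. apply RInt_ext. auto. Qed.

Lemma RInt_cle (f g : R -> R) a b : a <= b -> cont f -> cont g -> (forall x, f x <= g x) ->
  RInt f a b <= RInt g a b.
Proof. intros Hab Hf Hg Hle. apply RInt_le; auto using cont_ex_RInt. Qed.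

Lemma RInt_cge0 (f : R -> R) a b : a <= b -> cont f -> (forall x, 0 <= f x) -> 0 <= RInt f a b.
Proof. intros Hab Hf H0. apply RInt_ge_0; auto using cont_ex_RInt. Qed.

Lemma RInt_Chasles_c (f : R -> R) a b c : cont f -> RInt f a b + RInt f b c = RInt f a c.
Proof.
intros Hf. apply (RInt_Chasles (V := R_CompleteNormedModule)); now apply cont_ex_RInt.
Qed.

Lemma RInt_shift (f : R -> R) T a b : cont f ->
  RInt (fun x => f (x + T)) a b = RInt f (a + T) (b + T).
Proof.
intros Hf.
pose proof (RInt_comp_lin (V := R_CompleteNormedModule) f 1 T a b) as E.
rewrite !Rmult_1_l in E. rewrite <- E by now apply cont_ex_RInt.
apply RInt_cext. intros x. unfold scal; simpl; unfold mult; simpl.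
now rewrite !Rmult_1_l.
Qed.

Lemma RInt_reflect (f : R -> R) a b : cont f ->
  RInt (fun x => f (- x)) a b = RInt f (- b) (- a).
Proof.
intros Hf.
pose proof (RInt_comp_lin (V := R_CompleteNormedModule) f (-1) 0 a b) as E.
pose proof (opp_RInt_swap (V := R_CompleteNormedModule) f (- a) (- b)
  (cont_ex_RInt f _ _ Hf)) as E2.
replace (-1 * a + 0) with (- a) in E by ring.
replace (-1 * b + 0) with (- b) in E by ring.
rewrite <- E2, <- E by now apply cont_ex_RInt.
rewrite (RInt_ext (fun y => scal (-1) (f (-1 * y + 0))) (fun x => -1 * f (- x))).
- rewrite RInt_cscal by cts.
  enough (X : forall z : R, z = - (-1 * z)) by exact (X _). intros; ring.
- intros x _. unfold scal; simpl; unfold mult; simpl. f_equal. f_equal. ring.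
Qed.

Lemma RInt_period (f : R -> R) T a : cont f -> (forall x, f (x + T) = f x) ->
  RInt f a (a + T) = RInt f 0 T.
Proof.
intros Hf HT.
pose proof (RInt_Chasles_c f a T (a + T) Hf) as E1.
pose proof (RInt_Chasles_c f 0 a T Hf) as E2.
pose proof (RInt_shift f T 0 a Hf) as E3.
rewrite (RInt_cext _ f) in E3 by auto.
rewrite Rplus_0_l in E3. lra.
Qed.

Lemma period_INR (f : R -> R) T n : (forall x, f (x + T) = f x) ->
  forall x, f (x + INR n * T) = f x.
Proof.
intros HT. induction n as [|n IH]; intros x.
- f_equal. simpl. ring.
- rewrite S_INR. replace (x + (INR n + 1) * T) with (x + INR n * T + T) by ring.
  now rewrite HT.
Qed.

Lemma RInt_period_INR (f : R -> R) T n : cont f -> (forall x, f (x + T) = f x) ->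
  RInt f 0 (INR n * T) = INR n * RInt f 0 T.
Proof.
intros Hf HT. induction n as [|n IH].
- simpl. rewrite !Rmult_0_l. apply (RInt_point (V := R_CompleteNormedModule)).
- rewrite S_INR, <- (RInt_Chasles_c f 0 (INR n * T)) by assumption.
  replace ((INR n + 1) * T) with (INR n * T + T) by ring.
  rewrite IH, RInt_period by assumption. rring.
Qed.

Lemma RInt_odd_period (f : R -> R) T : cont f -> (forall x, f (x + T) = f x) ->
  (forall x, f (- x) = - f x) -> RInt f 0 T = 0.
Proof.
intros Hf HT Ho.
pose proof (RInt_reflect f 0 T Hf) as E.
rewrite (RInt_cext _ (fun x => -1 * f x)) in E by (intros; rewrite Ho; ring).
rewrite RInt_cscal in E by assumption.
pose proof (RInt_period f T (- T) Hf HT) as E1.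
rewrite Ropp_0 in E. replace (- T + T) with 0 in E1 by ring. lra.
Qed.

Lemma RInt_antiperiod (f : R -> R) T : cont f -> (forall x, f (x + T) = - f x) ->
  RInt f 0 (2 * T) = 0.
Proof.
intros Hf HT.
pose proof (RInt_Chasles_c f 0 T (2 * T) Hf) as E1.
pose proof (RInt_shift f T 0 T Hf) as E2.
rewrite (RInt_cext _ (fun x => -1 * f x)) in E2 by (intros; rewrite HT; ring).
rewrite RInt_cscal in E2 by assumption.
replace (0 + T) with T in E2 by ring. replace (T + T) with (2 * T) in E2 by ring. lra.
Qed.

(* A shift by [T] rotates the pair (cos, sin) integral by the angle [om * T]
   but leaves the integrals over the full period unchanged. *)
Lemma RInt_trig_period (v : R -> R) T n om : cont v -> (forall x, v (x + T) = v x) ->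
  (forall x, cos (om * (x + INR n * T)) = cos (om * x)) ->
  (forall x, sin (om * (x + INR n * T)) = sin (om * x)) ->
  cos (om * T) <> 1 ->
  RInt (fun x => cos (om * x) * v x) 0 (INR n * T) = 0 /\
  RInt (fun x => sin (om * x) * v x) 0 (INR n * T) = 0.
Proof.
intros Hv HT Hc Hs H1.
set (C := RInt _ 0 _). set (S := RInt (fun x => sin (om * x) * v x) 0 _).
assert (Cc : cont (fun x => cos (om * x) * v x)) by cts.
assert (Cs : cont (fun x => sin (om * x) * v x)) by cts.
assert (HTn := period_INR v T n HT).
assert (EC : C = cos (om * T) * C - sin (om * T) * S).
{ unfold C at 1. rewrite <- (RInt_period _ (INR n * T) T) by
    (auto; intros; rewrite Hc, HTn; reflexivity).
  replace (T + INR n * T) with (INR n * T + T) by ring.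
  replace T with (0 + T) at 1 by ring.
  rewrite <- RInt_shift by assumption.
  unfold C, S. rewrite <- !RInt_cscal, <- RInt_cminus by cts.
  apply RInt_cext. intros x. rewrite HT, Rmult_plus_distr_l, cos_plus. ring. }
assert (ES : S = sin (om * T) * C + cos (om * T) * S).
{ unfold S at 1. rewrite <- (RInt_period _ (INR n * T) T) by
    (auto; intros; rewrite Hs, HTn; reflexivity).
  replace (T + INR n * T) with (INR n * T + T) by ring.
  replace T with (0 + T) at 1 by ring.
  rewrite <- RInt_shift by assumption.
  unfold C, S. rewrite <- !RInt_cscal, <- RInt_cplus by cts.
  apply RInt_cext. intros x. rewrite HT, Rmult_plus_distr_l, sin_plus. ring. }
clearbody C S. pose proof (sin2_cos2 (om * T)) as E. unfold Rsqr in E.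
set (c := cos _) in *. set (s := sin _) in *. clearbody c s.
assert (EC' : (1 - c) * C = - s * S) by lra.
assert (ES' : (1 - c) * S = s * C) by lra.
assert (Z : (1 - c) * (C * C + S * S) = 0).
{ replace ((1 - c) * (C * C + S * S)) with ((1 - c) * C * C + (1 - c) * S * S) by ring.
  rewrite EC', ES'. ring. }
apply Rmult_integral in Z. destruct Z as [Z|Z]; [lra|]. split; nra.
Qed.

Lemma cont_RInt_param (f : R -> R -> R) a b : cont2 f -> cont (fun x => RInt (f x) a b).
Proof.
intros Hf x.
destruct (Req_dec a b) as [->|Hab].
{ apply (continuous_ext (fun _ => 0)).
  - intros y. symmetry. apply (RInt_point (V := R_CompleteNormedModule)).
  - apply continuous_const. }
apply continuity_pt_filterlim. apply continuity_pt_locally.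
intros eps.
set (l := Rmin a b). set (r := Rmax a b).
assert (Hlr : l <= r) by (apply Rle_trans with a; [apply Rmin_l|apply Rmax_l]).
(* The added 1 keeps the quotient meaningful and makes the final estimate strict. *)
assert (Hn : 0 < r - l + 1) by lra.
assert (He : 0 < eps / (r - l + 1)) by (apply Rdiv_lt_0_compat; [apply eps|lra]).
destruct (uniform_continuity_2d_1d' f l r x) with (eps := mkposreal _ He) as [d Hd].
{ intros. apply Hf. }
exists d. intros u Hu.
assert (B : forall t, l <= t <= r -> Rabs (f u t - f x t) <= eps / (r - l + 1)).
{ intros t Ht. left. pose proof (cond_pos d).
  assert (Hux : Rabs (u - x) < d) by exact Hu.
  apply Rabs_def2 in Hux.
  apply (Hd t x t u); try lra.
  rewrite Rminus_eq_0, Rabs_R0. lra. }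
assert (E : RInt (f u) a b - RInt (f x) a b = RInt (fun t => f u t - f x t) a b).
{ rewrite RInt_cminus; auto using cont2_slice. }
rewrite E.
assert (C : cont (fun t => f u t - f x t)) by (apply cont_minus; now apply cont2_slice).
assert (B2 : Rabs (RInt (fun t => f u t - f x t) a b) = Rabs (RInt (fun t => f u t - f x t) l r)).
{ unfold l, r. destruct (Rle_dec a b) as [h|h].
  - rewrite Rmin_left, Rmax_right by lra. reflexivity.
  - rewrite Rmin_right, Rmax_left by lra.
    rewrite <- (opp_RInt_swap (V := R_CompleteNormedModule)) by now apply cont_ex_RInt.
    apply Rabs_Ropp. }
rewrite B2.
eapply Rle_lt_trans.
{ apply (abs_RInt_le_const _ l r (eps / (r - l + 1))); auto. now apply cont_ex_RInt. }
apply Rlt_le_trans with ((r - l + 1) * (eps / (r - l + 1))).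
- apply Rmult_lt_compat_r; lra.
- right. field. lra.
Qed.

(** * Jacobi elliptic functions *)

Definition jacobi_sn (k u : R) : R := sin (jacobi_am k u).
Definition jacobi_dn (k u : R) : R := sqrt (1 - k ^ 2 * jacobi_sn k u ^ 2).

Lemma sin_sqr_bound x : 0 <= sin x ^ 2 <= 1.
Proof. pose proof (SIN_bound x). nra. Qed.

Lemma ellF_inj k a b : 0 < k < 1 -> ellF k a = ellF k b -> a = b.
Proof.
intros Hk E. destruct (Rle_dec a b) as [h|h].
- pose proof (ellF_expand k a b Hk h). lra.
- pose proof (ellF_expand k b a Hk ltac:(lra)). lra.
Qed.

Lemma jacobi_am_unique k phi u : 0 < k < 1 -> ellF k phi = u -> jacobi_am k u = phi.
Proof. intros Hk E. apply (ellF_inj k); auto. now rewrite jacobi_am_correct. Qed.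

(** The integrand depends on [sin ^ 2] only, so along a reflection or translation [g] that preserves
    [sin ^ 2] the difference has derivative zero. Oddness and the quasi-period of [ellF] are the two
    instances. *)
Lemma ellF_plus k (g : R -> R) s c : 0 < k < 1 ->
  (forall x, is_derive g x s) -> s ^ 2 = 1 -> (forall x, sin (g x) ^ 2 = sin x ^ 2) ->
  forall x, ellF k (g x) - s * ellF k x = ellF k (g c) - s * ellF k c.
Proof.
intros Hk Hg Hs Hsin x.
assert (D : forall x, is_derive (fun x => ellF k (g x) - s * ellF k x) x 0).
{ intros y.
  replace 0 with (s * / sqrt (1 - k ^ 2 * sin (g y) ^ 2) -
    s * / sqrt (1 - k ^ 2 * sin y ^ 2)) by (rewrite Hsin; ring).
  apply (is_derive_minus (fun x => ellF k (g x)) (fun x => s * ellF k x)).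
  - apply (is_derive_comp (ellF k) g); [now apply ellF_derive|apply Hg].
  - apply is_derive_scal. now apply ellF_derive. }
assert (E := RInt_FTC _ _ c x D (cont_const 0)).
rewrite RInt_cconst in E. lra.
Qed.

Lemma ellF_opp k phi : 0 < k < 1 -> ellF k (- phi) = - ellF k phi.
Proof.
intros Hk.
assert (E := ellF_plus k (fun x => - x) (-1) 0 Hk).
simpl in E. rewrite Ropp_0, ellF_0 in E.
enough (ellF k (- phi) - -1 * ellF k phi = 0 - -1 * 0) by lra.
apply E; [|ring|intros; rewrite sin_neg; ring].
intros x. auto_derive; auto.
Qed.

Lemma ellF_PI k phi : 0 < k < 1 -> ellF k (phi + PI) = ellF k phi + 2 * ellK k.
Proof.
intros Hk.
(* At the base point [- (PI / 2)] the shift lands on [PI / 2], so oddness evaluates the constant as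
   [2 * ellK k]. *)
assert (E := ellF_plus k (fun x => x + PI) 1 (- (PI / 2)) Hk).
cbv beta in E. replace (- (PI / 2) + PI) with (PI / 2) in E by field.
rewrite ellF_opp in E by assumption. fold (ellK k) in E.
enough (ellF k (phi + PI) - 1 * ellF k phi = ellK k - 1 * - ellK k) by lra.
apply E; [|ring|intros; rewrite neg_sin; ring].
intros x. auto_derive; auto; ring.
Qed.

(** The integrand lies between 1 and [/ sqrt (1 - k ^ 2)]. These crude bounds are the only numerical
    information about [ellK (sin theta)] used later. *)
Lemma ellK_bounds k : 0 < k < 1 -> PI / 2 <= ellK k /\ ellK k * sqrt (1 - k ^ 2) <= PI / 2.
Proof.
intros Hk. pose proof PI_RGT_0 as Hpi. split.
- pose proof (ellF_expand k 0 (PI / 2) Hk ltac:(lra)) as E.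
  rewrite ellF_0 in E. unfold ellK. lra.
- destruct (MVT_gen (ellF k) 0 (PI / 2) (fun p => / sqrt (1 - k ^ 2 * sin p ^ 2)))
    as [c [_ Hc]].
  + intros x _. now apply ellF_derive.
  + intros x _. apply derivable_continuous_pt. exists (/ sqrt (1 - k ^ 2 * sin x ^ 2)).
    apply is_derive_Reals. now apply ellF_derive.
  + rewrite ellF_0 in Hc. unfold ellK.
    replace (ellF k (PI / 2)) with (/ sqrt (1 - k ^ 2 * sin c ^ 2) * (PI / 2 - 0)) by lra.
    pose proof (ellF_rad_pos k c Hk) as Hr.
    assert (0 < sqrt (1 - k ^ 2 * sin c ^ 2)) by (apply sqrt_lt_R0; lra).
    assert (sqrt (1 - k ^ 2) <= sqrt (1 - k ^ 2 * sin c ^ 2)).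
    { apply sqrt_le_1_alt. pose proof (sin_sqr_bound c). pose proof (pow2_ge_0 k). nra. }
    set (S := sqrt (1 - k ^ 2 * sin c ^ 2)) in *. set (l := sqrt (1 - k ^ 2)) in *.
    apply (Rmult_le_reg_l S); auto.
    replace (S * (/ S * (PI / 2 - 0) * l)) with (S * / S * (PI / 2 * l)) by ring.
    rewrite Rinv_r by lra.
    nra.
Qed.

Lemma jacobi_am_opp k u : 0 < k < 1 -> jacobi_am k (- u) = - jacobi_am k u.
Proof.
intros Hk. apply jacobi_am_unique; auto.
now rewrite ellF_opp, jacobi_am_correct.
Qed.

Lemma jacobi_am_PI k u : 0 < k < 1 -> jacobi_am k (u + 2 * ellK k) = jacobi_am k u + PI.
Proof.
intros Hk. apply jacobi_am_unique; auto.
now rewrite ellF_PI, jacobi_am_correct.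
Qed.

Lemma jacobi_am_0 k : 0 < k < 1 -> jacobi_am k 0 = 0.
Proof. intros Hk. apply jacobi_am_unique; auto. apply ellF_0. Qed.

Lemma jacobi_am_K k : 0 < k < 1 -> jacobi_am k (ellK k) = PI / 2.
Proof. intros Hk. now apply jacobi_am_unique. Qed.

Lemma jacobi_am_le k u v : 0 < k < 1 -> u <= v ->
  0 <= jacobi_am k v - jacobi_am k u <= v - u.
Proof.
intros Hk Huv.
pose proof (jacobi_am_correct k u Hk) as Eu. pose proof (jacobi_am_correct k v Hk) as Ev.
destruct (Rle_dec (jacobi_am k u) (jacobi_am k v)) as [h|h].
- pose proof (ellF_expand k _ _ Hk h). lra.
- pose proof (ellF_expand k (jacobi_am k v) (jacobi_am k u) Hk ltac:(lra)). lra.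
Qed.

(** The mean value theorem for [ellF] turns the difference quotient of its inverse into
    [sqrt (1 - k ^ 2 * sin c ^ 2)] with [c] between the two amplitudes; since the amplitude is
    1-Lipschitz, [c] tends to [jacobi_am k u]. *)
Lemma jacobi_am_derive k u : 0 < k < 1 -> is_derive (jacobi_am k) u (jacobi_dn k u).
Proof.
intros Hk. apply is_derive_Reals. intros eps Heps.
assert (Hc : continuous (fun p => sqrt (1 - k ^ 2 * sin p ^ 2)) (jacobi_am k u)).
{ apply (ex_derive_continuous (V := R_NormedModule)).
  pose proof (ellF_rad_pos k (jacobi_am k u) Hk). auto_derive. lra. }
apply continuity_pt_filterlim in Hc.
destruct (proj1 (continuity_pt_locally _ _) Hc (mkposreal _ Heps)) as [d Hd]. simpl in Hd.
exists d. intros h Hh Hhd.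
destruct (MVT_gen (ellF k) (jacobi_am k u) (jacobi_am k (u + h))
  (fun p => / sqrt (1 - k ^ 2 * sin p ^ 2))) as [c [Hc1 Hc2]].
- intros x _. now apply ellF_derive.
- intros x _. apply derivable_continuous_pt. exists (/ sqrt (1 - k ^ 2 * sin x ^ 2)).
  apply is_derive_Reals. now apply ellF_derive.
- rewrite !jacobi_am_correct in Hc2 by assumption.
  pose proof (ellF_rad_pos k c Hk) as Hr.
  assert (Hs : 0 < sqrt (1 - k ^ 2 * sin c ^ 2)) by (apply sqrt_lt_R0; lra).
  assert (E : (jacobi_am k (u + h) - jacobi_am k u) / h = sqrt (1 - k ^ 2 * sin c ^ 2)).
  { replace (jacobi_am k (u + h) - jacobi_am k u) with
      (sqrt (1 - k ^ 2 * sin c ^ 2) * h); [field; auto|].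
    replace h with (u + h - u) at 1 by ring. rewrite Hc2. field. lra. }
  rewrite E. unfold jacobi_dn, jacobi_sn. apply Hd.
  change (Rabs (c - jacobi_am k u) < d).
  apply Rle_lt_trans with (2 := Hhd).
  destruct (Rle_dec 0 h).
  + pose proof (jacobi_am_le k u (u + h) Hk ltac:(lra)).
    rewrite Rmin_left, Rmax_right in Hc1 by lra.
    rewrite !Rabs_pos_eq; lra.
  + pose proof (jacobi_am_le k (u + h) u Hk ltac:(lra)).
    rewrite Rmin_right, Rmax_left in Hc1 by lra.
    rewrite !Rabs_left1; lra.
Qed.

Lemma jacobi_dn_sqr k u : 0 < k < 1 -> jacobi_dn k u ^ 2 = 1 - k ^ 2 * jacobi_sn k u ^ 2.
Proof.
intros Hk. unfold jacobi_dn. apply pow2_sqrt. apply Rlt_le.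
apply (ellF_rad_pos k (jacobi_am k u) Hk).
Qed.

Lemma jacobi_dn_bounds k u : 0 < k < 1 -> sqrt (1 - k ^ 2) <= jacobi_dn k u <= 1 /\ 0 < jacobi_dn k u.
Proof.
intros Hk. unfold jacobi_dn, jacobi_sn.
pose proof (ellF_rad_pos k (jacobi_am k u) Hk) as Hr. repeat split.
- apply sqrt_le_1_alt. pose proof (sin_sqr_bound (jacobi_am k u)). pose proof (pow2_ge_0 k). nra.
- apply Rle_trans with (sqrt 1); [apply sqrt_le_1_alt; lra|rewrite sqrt_1; lra].
- apply sqrt_lt_R0. lra.
Qed.

Lemma jacobi_sn_cn_sqr k u : jacobi_sn k u ^ 2 = 1 - jacobi_cn k u ^ 2.
Proof.
unfold jacobi_sn, jacobi_cn. pose proof (sin2_cos2 (jacobi_am k u)) as E.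
unfold Rsqr in E. simpl. lra.
Qed.

Lemma jacobi_sn_derive k u : 0 < k < 1 ->
  is_derive (jacobi_sn k) u (jacobi_cn k u * jacobi_dn k u).
Proof.
intros Hk.
replace (jacobi_cn k u * jacobi_dn k u) with (jacobi_dn k u * jacobi_cn k u) by ring.
apply (is_derive_comp sin (jacobi_am k)); [apply is_derive_sin|now apply jacobi_am_derive].
Qed.

Lemma jacobi_cn_derive k u : 0 < k < 1 ->
  is_derive (jacobi_cn k) u (- (jacobi_sn k u * jacobi_dn k u)).
Proof.
intros Hk.
replace (- (jacobi_sn k u * jacobi_dn k u)) with (jacobi_dn k u * - jacobi_sn k u) by ring.
apply (is_derive_comp cos (jacobi_am k)); [apply is_derive_cos|now apply jacobi_am_derive].
Qed.

Lemma jacobi_dn_derive k u : 0 < k < 1 ->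
  is_derive (jacobi_dn k) u (- (k ^ 2 * jacobi_sn k u * jacobi_cn k u)).
Proof.
intros Hk.
pose proof (jacobi_dn_bounds k u Hk) as [_ Hd].
pose proof (ellF_rad_pos k (jacobi_am k u) Hk) as Hr.
pose proof (jacobi_sn_derive k u Hk) as Hs.
unfold jacobi_dn. auto_derive.
- split; [eexists; apply Hs|]. unfold jacobi_sn. split; [simpl in *; lra|auto].
- replace (Derive _ u) with (jacobi_cn k u * jacobi_dn k u) by (symmetry; apply (is_derive_unique _ _ _ Hs)). change (jacobi_sn k u * (jacobi_sn k u * 1)) with (jacobi_sn k u ^ 2).
  change (k * (k * 1)) with (k ^ 2).
  change (1 + - (k ^ 2 * jacobi_sn k u ^ 2)) with (1 - k ^ 2 * jacobi_sn k u ^ 2).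
  change (sqrt (1 - k ^ 2 * jacobi_sn k u ^ 2)) with (jacobi_dn k u). field. lra.
Qed.

Lemma cont_am k : 0 < k < 1 -> cont (jacobi_am k).
Proof. intros Hk. eapply cont_derive. intros. now apply jacobi_am_derive. Qed.
Lemma jacobi_cn_opp k u : 0 < k < 1 -> jacobi_cn k (- u) = jacobi_cn k u.
Proof. intros Hk. unfold jacobi_cn. now rewrite jacobi_am_opp, cos_neg. Qed.
Lemma jacobi_sn_opp k u : 0 < k < 1 -> jacobi_sn k (- u) = - jacobi_sn k u.
Proof. intros Hk. unfold jacobi_sn. now rewrite jacobi_am_opp, sin_neg. Qed.
Lemma jacobi_cn_2K k u : 0 < k < 1 -> jacobi_cn k (u + 2 * ellK k) = - jacobi_cn k u.
Proof. intros Hk. unfold jacobi_cn. now rewrite jacobi_am_PI, neg_cos. Qed.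
Lemma jacobi_sn_2K k u : 0 < k < 1 -> jacobi_sn k (u + 2 * ellK k) = - jacobi_sn k u.
Proof. intros Hk. unfold jacobi_sn. now rewrite jacobi_am_PI, neg_sin. Qed.

(* Classes of smooth functions closed under derivation, large enough for all test functions. *)
Inductive el1 : (R -> R) -> Prop :=
| el1_const c : el1 (fun _ => c)
| el1_cos om : el1 (fun x => cos (om * x))
| el1_sin om : el1 (fun x => sin (om * x))
| el1_sn k b : 0 < k < 1 -> el1 (fun x => jacobi_sn k (b * x))
| el1_cn k b : 0 < k < 1 -> el1 (fun x => jacobi_cn k (b * x))
| el1_dn k b : 0 < k < 1 -> el1 (fun x => jacobi_dn k (b * x))
| el1_plus f g : el1 f -> el1 g -> el1 (fun x => f x + g x)
| el1_mult f g : el1 f -> el1 g -> el1 (fun x => f x * g x).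

Lemma is_derive_lin_arg (f : R -> R) b x l : is_derive f (b * x) l ->
  is_derive (fun x => f (b * x)) x (b * l).
Proof.
intros Hf. apply (is_derive_comp f (fun x => b * x)); auto.
auto_derive; auto; ring.
Qed.

Lemma el1_derive f : el1 f -> exists g, el1 g /\ forall x, is_derive f x (g x).
Proof.
intros Hf. induction Hf as [c|om|om|k b Hk|k b Hk|k b Hk|f g _ [f' [Ef Df]] _ [g' [Eg Dg]]
  |f g Hf [f' [Ef Df]] Hg [g' [Eg Dg]]].
- exists (fun _ => 0). split; [constructor|]. intros. apply is_derive_Reals, derivable_pt_lim_const.
- exists (fun x => (- om) * sin (om * x)). split; [repeat constructor|].
  intros. auto_derive; auto; ring.
- exists (fun x => om * cos (om * x)). split; [repeat constructor|].
  intros. auto_derive; auto; ring.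
- exists (fun x => b * (jacobi_cn k (b * x) * jacobi_dn k (b * x))).
  split; [repeat (constructor; auto)|].
  intros. apply (is_derive_lin_arg (jacobi_sn k)). now apply jacobi_sn_derive.
- exists (fun x => b * ((-1) * (jacobi_sn k (b * x) * jacobi_dn k (b * x)))).
  split; [repeat (constructor; auto)|].
  intros. apply (is_derive_lin_arg (jacobi_cn k)).
  replace (-1 * (jacobi_sn k (b * x) * jacobi_dn k (b * x))) with
    (- (jacobi_sn k (b * x) * jacobi_dn k (b * x))) by ring. now apply jacobi_cn_derive.
- exists (fun x => b * ((- k ^ 2) * (jacobi_sn k (b * x) * jacobi_cn k (b * x)))).
  split; [repeat (constructor; auto)|].
  intros. apply (is_derive_lin_arg (jacobi_dn k)).
  replace ((- k ^ 2) * (jacobi_sn k (b * x) * jacobi_cn k (b * x))) with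
    (- (k ^ 2 * jacobi_sn k (b * x) * jacobi_cn k (b * x))) by ring. now apply jacobi_dn_derive.
- exists (fun x => f' x + g' x). split; [now constructor|].
  intros x. now apply (is_derive_plus f g).
- exists (fun x => f' x * g x + f x * g' x). split; [now repeat constructor|].
  intros x. apply (is_derive_mult f g); auto. intros; apply Rmult_comm.
Qed.

Lemma el1_cont f : el1 f -> cont f.
Proof. intros Hf. destruct (el1_derive f Hf) as [g [_ Hg]]. now apply cont_derive with g. Qed.

Inductive el2 : (R -> R -> R) -> Prop :=
| el2_x f : el1 f -> el2 (fun x _ => f x)
| el2_y f : el1 f -> el2 (fun _ y => f y)
| el2_plus f g : el2 f -> el2 g -> el2 (fun x y => f x y + g x y)
| el2_mult f g : el2 f -> el2 g -> el2 (fun x y => f x y * g x y).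

Lemma el2_derive u : el2 u -> exists ux uy, el2 ux /\ el2 uy /\
  (forall x y, is_derive (fun t => u t y) x (ux x y)) /\
  (forall x y, is_derive (fun t => u x t) y (uy x y)).
Proof.
assert (El0 : el2 (fun _ _ => 0)) by (apply (el2_x (fun _ => 0)), el1_const).
intros Hu. induction Hu as [f Hf|f Hf|f g Hf [fx [fy [F1 [F2 [F3 F4]]]]] Hg [gx [gy [G1 [G2 [G3 G4]]]]]
  |f g Hf [fx [fy [F1 [F2 [F3 F4]]]]] Hg [gx [gy [G1 [G2 [G3 G4]]]]]].
- destruct (el1_derive f Hf) as [g [Hg Dg]].
  exists (fun x _ => g x), (fun _ _ => 0). split; [|split; [|split]]; auto using el2_x.
  intros. apply is_derive_Reals, derivable_pt_lim_const.
- destruct (el1_derive f Hf) as [g [Hg Dg]].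
  exists (fun _ _ => 0), (fun _ y => g y). split; [|split; [|split]]; auto using el2_y.
  intros. apply is_derive_Reals, derivable_pt_lim_const.
- exists (fun x y => fx x y + gx x y), (fun x y => fy x y + gy x y).
  split; [now apply el2_plus|]. split; [now apply el2_plus|]. split.
  + intros x y. now apply (is_derive_plus (fun t => f t y) (fun t => g t y)).
  + intros x y. now apply (is_derive_plus (fun t => f x t) (fun t => g x t)).
- exists (fun x y => fx x y * g x y + f x y * gx x y), (fun x y => fy x y * g x y + f x y * gy x y).
  split; [apply el2_plus; now apply el2_mult|]. split; [apply el2_plus; now apply el2_mult|]. split.
  + intros x y. apply (is_derive_mult (fun t => f t y) (fun t => g t y)); auto.
    intros; apply Rmult_comm.
  + intros x y. apply (is_derive_mult (fun t => f x t) (fun t => g x t)); auto.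
    intros; apply Rmult_comm.
Qed.

Lemma el2_cont u : el2 u -> cont2 u.
Proof.
intros Hu. induction Hu as [f Hf|f Hf|f g _ IHf _ IHg|f g _ IHf _ IHg].
- apply (cont2_1d f (fun x _ => x)); [now apply el1_cont|apply cont2_id1].
- apply (cont2_1d f (fun _ y => y)); [now apply el1_cont|apply cont2_id2].
- now apply cont2_plus.
- now apply cont2_mult.
Qed.

Lemma el2_Dx u : el2 u -> el2 (Dx u).
Proof.
intros Hu. destruct (el2_derive u Hu) as [ux [uy [E1 [_ [D1 _]]]]].
replace (Dx u) with ux; auto.
apply functional_extensionality; intros x; apply functional_extensionality; intros y.
symmetry. apply is_derive_unique. apply D1.
Qed.

Lemma el2_Dy u : el2 u -> el2 (Dy u).
Proof.
intros Hu. destruct (el2_derive u Hu) as [ux [uy [_ [E1 [_ D1]]]]].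
replace (Dy u) with uy; auto.
apply functional_extensionality; intros x; apply functional_extensionality; intros y.
symmetry. apply is_derive_unique. apply D1.
Qed.

Lemma el2_ex_derive u x y : el2 u -> ex_derive (fun t => u t y) x /\ ex_derive (fun t => u x t) y.
Proof.
intros Hu. destruct (el2_derive u Hu) as [ux [uy [_ [_ [D1 D2]]]]].
split; eexists; [apply D1|apply D2].
Qed.

Lemma el2_smooth u : el2 u -> smooth u.
Proof.
intros Hu n. revert u Hu. induction n as [|n IH]; intros u Hu x y.
- split; auto. now apply el2_cont.
- destruct (el2_ex_derive u x y Hu) as [E1 E2].
  split; [now apply el2_cont|]. split; [exact E1|]. split; [exact E2|]. split.
  + apply IH. now apply (el2_Dx u).
  + apply IH. now apply (el2_Dy u).
Qed.

Lemma el2_scal c u : el2 u -> el2 (fun x y => c * u x y).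
Proof. intros Hu. apply (el2_mult (fun _ _ => c)); auto. apply (el2_x (fun _ => c)), el1_const. Qed.

Lemma fun2_ext (u v : R -> R -> R) : (forall x y, u x y = v x y) -> u = v.
Proof.
intros E. apply functional_extensionality; intros x.
apply functional_extensionality; intros y. apply E.
Qed.

Lemma Dx_plus u v : el2 u -> el2 v ->
  Dx (fun x y => u x y + v x y) = fun x y => Dx u x y + Dx v x y.
Proof.
intros Hu Hv. apply fun2_ext. intros a b. unfold Dx.
apply (Derive_plus (fun t => u t b) (fun t => v t b)).
- exact (proj1 (el2_ex_derive u a b Hu)).
- exact (proj1 (el2_ex_derive v a b Hv)).
Qed.

Lemma Dy_plus u v : el2 u -> el2 v ->
  Dy (fun x y => u x y + v x y) = fun x y => Dy u x y + Dy v x y.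
Proof.
intros Hu Hv. apply fun2_ext. intros a b. unfold Dy.
apply (Derive_plus (fun t => u a t) (fun t => v a t)).
- exact (proj2 (el2_ex_derive u a b Hu)).
- exact (proj2 (el2_ex_derive v a b Hv)).
Qed.

Lemma Dx_scal c u : Dx (fun x y => c * u x y) = fun x y => c * Dx u x y.
Proof. apply fun2_ext. intros a b. apply (Derive_scal (fun t => u t b)). Qed.

Lemma Dy_scal c u : Dy (fun x y => c * u x y) = fun x y => c * Dy u x y.
Proof. apply fun2_ext. intros a b. apply (Derive_scal (fun t => u a t)). Qed.

Lemma Laplacian_plus u v x y : el2 u -> el2 v ->
  Laplacian (fun x y => u x y + v x y) x y = Laplacian u x y + Laplacian v x y.
Proof.
intros Hu Hv. unfold Laplacian.
rewrite (Dx_plus u v), (Dy_plus u v) by assumption.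
rewrite (Dx_plus (Dx u) (Dx v)) by now apply el2_Dx.
rewrite (Dy_plus (Dy u) (Dy v)) by now apply el2_Dy.
ring.
Qed.

Lemma Laplacian_scal c u x y : Laplacian (fun x y => c * u x y) x y = c * Laplacian u x y.
Proof.
unfold Laplacian. rewrite Dx_scal, Dy_scal, (Dx_scal c (Dx u)), (Dy_scal c (Dy u)). ring.
Qed.

Lemma el2_Laplacian u : el2 u -> el2 (Laplacian u).
Proof. intros Hu. apply el2_plus; [now apply el2_Dx, el2_Dx|now apply el2_Dy, el2_Dy]. Qed.

Lemma Laplacian_prod A g A' A'' g' g'' x y :
  (forall x, is_derive A x (A' x)) -> (forall x, is_derive A' x (A'' x)) ->
  (forall x, is_derive g x (g' x)) -> (forall x, is_derive g' x (g'' x)) ->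
  Laplacian (fun x y => A x * g y) x y = A'' x * g y + A x * g'' y.
Proof.
intros H1 H2 H3 H4. unfold Laplacian.
assert (Ex : Dx (fun x y => A x * g y) = fun x y => A' x * g y).
{ apply fun2_ext. intros a b. unfold Dx.
  rewrite (Derive_scal_l A (g b) a). f_equal. now apply is_derive_unique. }
assert (Ey : Dy (fun x y => A x * g y) = fun x y => A x * g' y).
{ apply fun2_ext. intros a b. unfold Dy.
  rewrite (Derive_scal g (A a) b). f_equal. now apply is_derive_unique. }
rewrite Ex, Ey. unfold Dx, Dy.
rewrite (Derive_scal_l A' (g y) x), (Derive_scal g' (A x) y).
f_equal; f_equal; now apply is_derive_unique.
Qed.

(** * The index form *)

Lemma torus_int_cont (G : lattice) f : cont2 f ->
  cont2 (fun s t => f (s * fst (fst G) + t * fst (snd G)) (s * snd (fst G) + t * snd (snd G))).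
Proof. intros Hf. apply cont2_comp; auto; cts2. Qed.

Lemma torus_int_plus G f g : cont2 f -> cont2 g ->
  torus_int G (fun x y => f x y + g x y) = torus_int G f + torus_int G g.
Proof.
intros Hf Hg. unfold torus_int.
pose proof (torus_int_cont G f Hf) as Cf. pose proof (torus_int_cont G g Hg) as Cg.
rewrite <- Rmult_plus_distr_l. f_equal.
rewrite <- RInt_cplus by now apply cont_RInt_param.
apply RInt_cext. intros s.
rewrite <- RInt_cplus; [reflexivity|apply (cont2_slice _ s Cf)|apply (cont2_slice _ s Cg)].
Qed.

Lemma torus_int_scal G c f : cont2 f ->
  torus_int G (fun x y => c * f x y) = c * torus_int G f.
Proof.
intros Hf. unfold torus_int.
pose proof (torus_int_cont G f Hf) as Cf.
rewrite <- Rmult_assoc, (Rmult_comm c), Rmult_assoc. f_equal.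
rewrite <- RInt_cscal by now apply cont_RInt_param.
apply RInt_cext. intros s.
rewrite <- RInt_cscal; [reflexivity|apply (cont2_slice _ s Cf)].
Qed.

Lemma torus_int_ext G f g : (forall x y, f x y = g x y) -> torus_int G f = torus_int G g.
Proof. intros E. f_equal. now apply fun2_ext. Qed.

(** Unlike [lincomb], the sum starts at index 0, the place of the function with nonzero volume. *)
Definition combo (n : nat) (d : nat -> R) (b : nat -> R -> R -> R) (x y : R) : R :=
  sum_f_R0 (fun i => d i * b i x y) n.

Lemma combo_S n d b : combo (S n) d b = fun x y => combo n d b x y + d (S n) * b (S n) x y.
Proof. reflexivity. Qed.

Lemma combo_el2 n d b : (forall i, (i <= n)%nat -> el2 (b i)) -> el2 (combo n d b).
Proof.
induction n as [|n IH]; intros Hb.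
- apply el2_scal. apply Hb. lia.
- rewrite combo_S. apply el2_plus; [apply IH; intros; apply Hb; lia|].
  apply el2_scal. apply Hb. lia.
Qed.

Lemma combo_periodic G n d b : (forall i, (i <= n)%nat -> periodic G (b i)) ->
  periodic G (combo n d b).
Proof.
intros Hb p Hp x y. unfold combo. apply sum_eq. intros i Hi. f_equal. now apply Hb.
Qed.

(** Linearity is asked for on [el2] only, where the derivatives and integrals involved exist; this
    serves [vol] and both arguments of [bil]. *)
Lemma linear_combo (T : (R -> R -> R) -> R) n d b :
  (forall u v, el2 u -> el2 v -> T (fun x y => u x y + v x y) = T u + T v) ->
  (forall c u, el2 u -> T (fun x y => c * u x y) = c * T u) ->
  (forall i, (i <= n)%nat -> el2 (b i)) ->
  T (combo n d b) = sum_f_R0 (fun i => d i * T (b i)) n.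
Proof.
intros Hp Hs. induction n as [|n IH]; intros Hb.
- apply (Hs (d O)). apply Hb. lia.
- rewrite combo_S, Hp, Hs, IH; auto.
  + apply combo_el2; auto.
  + apply el2_scal; auto.
Qed.

Definition jacobi_op (H : R) (F u : R -> R -> R) (x y : R) : R :=
  - Laplacian u x y - 4 * H * cosh (F x y) * u x y.

Definition bil (G : lattice) (H : R) (F u v : R -> R -> R) : R :=
  torus_int G (fun x y => u x y * jacobi_op H F v x y).

Lemma cont_cosh : cont cosh.
Proof.
intros x. apply continuity_pt_filterlim. apply derivable_continuous_pt.
exists (sinh x). apply derivable_pt_lim_cosh.
Qed.

Lemma jacobi_op_cont H F u : cont2 F -> el2 u -> cont2 (jacobi_op H F u).
Proof.
intros HF Hu. unfold jacobi_op.
pose proof (el2_cont _ Hu). pose proof (el2_cont _ (el2_Laplacian _ Hu)).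
pose proof (cont2_1d cosh F cont_cosh HF). cts2.
Qed.

Lemma bil_combo_l G H F n d b v : cont2 F -> el2 v -> (forall i, (i <= n)%nat -> el2 (b i)) ->
  bil G H F (combo n d b) v = sum_f_R0 (fun i => d i * bil G H F (b i) v) n.
Proof.
intros HF Hv. pose proof (jacobi_op_cont H F v HF Hv) as C.
apply (linear_combo (fun u => bil G H F u v)).
- intros u w Hu Hw. unfold bil.
  rewrite <- torus_int_plus; [|apply cont2_mult; auto; now apply el2_cont..].
  apply torus_int_ext. intros; ring.
- intros c u Hu. unfold bil.
  rewrite <- torus_int_scal; [|apply cont2_mult; auto; now apply el2_cont].
  apply torus_int_ext. intros; ring.
Qed.

Lemma bil_combo_r G H F n d b v : cont2 F -> el2 v -> (forall i, (i <= n)%nat -> el2 (b i)) ->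
  bil G H F v (combo n d b) = sum_f_R0 (fun i => d i * bil G H F v (b i)) n.
Proof.
intros HF Hv.
apply (linear_combo (fun u => bil G H F v u)).
- intros u w Hu Hw. unfold bil.
  rewrite <- torus_int_plus;
    [|apply cont2_mult; [now apply el2_cont|now apply jacobi_op_cont]..].
  apply torus_int_ext. intros. unfold jacobi_op. rewrite Laplacian_plus by assumption. ring.
- intros c u Hu. unfold bil.
  rewrite <- torus_int_scal;
    [|apply cont2_mult; [now apply el2_cont|now apply jacobi_op_cont]].
  apply torus_int_ext. intros. unfold jacobi_op. rewrite Laplacian_scal. ring.
Qed.

Lemma sum_single (a : nat -> R) n i : (i <= n)%nat ->
  (forall j, (j <= n)%nat -> j <> i -> a j = 0) -> sum_f_R0 a n = a i.
Proof.
induction n as [|n IH]; intros Hi Ha.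
- now replace i with O by lia.
- simpl. destruct (Nat.eq_dec i (S n)) as [->|h].
  + rewrite sum_eq_R0; [ring|]. intros j Hj. apply Ha; lia.
  + rewrite (Ha (S n)) by lia. rewrite IH; [ring|lia|]. intros; apply Ha; lia.
Qed.

Lemma sum_npos (a : nat -> R) n : (forall i, (i <= n)%nat -> a i <= 0) ->
  sum_f_R0 a n <= 0 /\ (sum_f_R0 a n = 0 -> forall i, (i <= n)%nat -> a i = 0).
Proof.
induction n as [|n IH]; intros Ha; simpl.
- split; [apply Ha; lia|]. intros E i Hi. now replace i with O by lia.
- destruct IH as [I1 I2]; [intros; apply Ha; lia|].
  pose proof (Ha (S n) ltac:(lia)) as A. split; [lra|]. intros E i Hi.
  destruct (Nat.eq_dec i (S n)) as [->|h]; [lra|]. apply I2; [lra|lia].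
Qed.

Section Index.

Variables (N : nat) (G : lattice) (H : R) (F : R -> R -> R) (b : nat -> R -> R -> R).
Hypothesis HF : cont2 F.
Hypothesis Hb : forall i, (i <= N)%nat -> el2 (b i).
Hypothesis Hper : forall i, (i <= N)%nat -> periodic G (b i).
Hypothesis Horth : forall i j, (i <= N)%nat -> (j <= N)%nat -> i <> j ->
  bil G H F (b i) (b j) = 0.
Hypothesis Hneg : forall i, (i <= N)%nat -> bil G H F (b i) (b i) < 0.
Hypothesis Hvol : torus_int G (fun x y => b 0%nat x y * area_density H F x y) <> 0.

Lemma Q_combo d :
  Q G H F (combo N d b) = sum_f_R0 (fun i => d i ^ 2 * bil G H F (b i) (b i)) N.
Proof.
change (Q G H F (combo N d b)) with (bil G H F (combo N d b) (combo N d b)).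
rewrite bil_combo_l by auto using combo_el2.
apply sum_eq. intros i Hi. rewrite bil_combo_r by auto.
rewrite (sum_single _ N i); [ring|assumption|].
intros j Hj Hji. rewrite Horth by auto. ring.
Qed.

Lemma Q_combo_neg d : Q G H F (combo N d b) <= 0 /\
  (Q G H F (combo N d b) = 0 -> forall i, (i <= N)%nat -> d i = 0).
Proof.
rewrite Q_combo.
destruct (sum_npos (fun i => d i ^ 2 * bil G H F (b i) (b i)) N) as [I1 I2].
- intros i Hi. pose proof (Hneg i Hi). pose proof (pow2_ge_0 (d i)). nra.
- split; auto. intros E i Hi. pose proof (Hneg i Hi). specialize (I2 E i Hi). simpl in I2.
  apply Rmult_integral in I2. destruct I2 as [I2|I2]; [|lra]. nra.
Qed.

Let vol (u : R -> R -> R) : R := torus_int G (fun x y => u x y * area_density H F x y).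

Lemma area_density_cont : cont2 (area_density H F).
Proof.
unfold area_density. apply (cont2_mult (fun x y => exp (F x y)) (fun _ _ => / H)).
- apply cont2_1d; auto. apply cont_derive with exp. intros. apply is_derive_exp.
- apply cont2_const.
Qed.

Lemma vol_combo d : vol (combo N d b) = sum_f_R0 (fun i => d i * vol (b i)) N.
Proof.
pose proof area_density_cont as C.
apply (linear_combo vol).
- intros u w Hu Hw. unfold vol.
  rewrite <- torus_int_plus; [|apply cont2_mult; auto; now apply el2_cont..].
  apply torus_int_ext. intros; ring.
- intros c u Hu. unfold vol.
  rewrite <- torus_int_scal; [|apply cont2_mult; auto; now apply el2_cont].
  apply torus_int_ext. intros; ring.
- auto.
Qed.

Let r (i : nat) : R := vol (b i) / vol (b 0%nat).
Let e (i : nat) : R -> R -> R := fun x y => b i x y - r i * b 0%nat x y.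
(** Coefficients of [lincomb N c e] with respect to [b]: all corrections by [b 0] are collected at
    index 0. *)
Let ext (c : nat -> R) (i : nat) : R :=
  match i with O => - sum_n_m (fun i => c i * r i) 1 N | _ => c i end.

Lemma sum_f_R0_head (a : nat -> R) n : sum_f_R0 a n = a 0%nat + sum_n_m a 1 n.
Proof.
rewrite <- sum_n_Reals. unfold sum_n. rewrite sum_Sn_m by lia. reflexivity.
Qed.

Lemma sum_n_m_Rext (a c : nat -> R) n m : (forall k, (n <= k <= m)%nat -> a k = c k) ->
  sum_n_m a n m = sum_n_m c n m.
Proof. intros E. now apply sum_n_m_ext_loc. Qed.

Lemma sum_n_m_Rplus (a c : nat -> R) n m :
  sum_n_m (fun k => a k + c k) n m = sum_n_m a n m + sum_n_m c n m.
Proof. apply (sum_n_m_plus (G := R_AbelianMonoid)). Qed.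

Lemma sum_n_m_Rmult (p : R) (a : nat -> R) n m :
  sum_n_m (fun k => p * a k) n m = p * sum_n_m a n m.
Proof. apply (sum_n_m_mult_l (K := R_Ring)). Qed.

Lemma lincomb_combo c : lincomb N c e = combo N (ext c) b.
Proof.
apply fun2_ext. intros x y. unfold lincomb, combo, e.
rewrite sum_f_R0_head.
rewrite (sum_n_m_Rext (fun k => ext c k * b k x y) (fun k => c k * b k x y)).
2: { intros k Hk. destruct k; [lia|reflexivity]. }
unfold ext.
rewrite (sum_n_m_Rext _ (fun i => c i * b i x y + (- b 0%nat x y) * (c i * r i))).
2: { intros; ring. }
rewrite sum_n_m_Rplus, sum_n_m_Rmult. rring.
Qed.

Lemma ext_zero c : (forall i, (i <= N)%nat -> ext c i = 0) ->
  forall i, (1 <= i <= N)%nat -> c i = 0.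
Proof.
intros E i Hi. specialize (E i ltac:(lia)). destruct i; [lia|exact E].
Qed.

Lemma lincomb_in_V c : in_V G H F (lincomb N c e).
Proof.
rewrite lincomb_combo. split; [|split].
- apply el2_smooth. now apply combo_el2.
- now apply combo_periodic.
- change (vol (combo N (ext c) b) = 0). rewrite vol_combo, sum_f_R0_head.
  rewrite (sum_n_m_Rext _ (fun i => vol (b 0%nat) * (c i * r i))).
  2: { intros k Hk. destruct k; [lia|].
       assert (X : forall v0 v1 c1 : R, v0 <> 0 -> c1 * v1 = v0 * (c1 * (v1 / v0)))
         by (intros; field; auto).
       apply X, Hvol. }
  rewrite sum_n_m_Rmult. unfold ext. rring.
Qed.

(* [b 0] has nonzero volume, so subtracting multiples of it turns [b 1 .. b N] into
   volume-preserving functions; Q stays negative on the whole span of [b 0 .. b N]. *)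
Lemma Ind_ge : Rbar_le (Finite (INR N)) (Ind G H F).
Proof.
unfold Ind. apply (proj1 (Lub_Rbar_correct _)).
exists N, (fun u => exists c, u = lincomb N c e).
split; [reflexivity|]. split; [|split; [|split]].
- split.
  + exists (fun _ => 0). apply fun2_ext. intros x y. unfold lincomb.
    rewrite (sum_n_m_Rext _ (fun _ => 0)) by (intros; ring).
    symmetry. apply (sum_n_m_const_zero (G := R_AbelianMonoid)).
  + intros p q u v [c ->] [d ->]. exists (fun i => p * c i + q * d i).
    apply fun2_ext. intros x y. unfold lincomb.
    rewrite (sum_n_m_Rext (fun i => (p * c i + q * d i) * e i x y)
      (fun i => p * (c i * e i x y) + q * (d i * e i x y))) by (intros; ring).
    now rewrite sum_n_m_Rplus, !sum_n_m_Rmult.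
- intros u [c ->]. apply lincomb_in_V.
- exists e. split; [|split].
  + intros i Hi. exists (fun j => if Nat.eq_dec j i then 1 else 0).
    apply fun2_ext. intros x y. unfold lincomb.
    assert (X : sum_f_R0 (fun j => if Nat.eq_dec j i then e i x y else 0) N = e i x y).
    { rewrite (sum_single _ N i) by (try lia; intros j _ Hj; now destruct (Nat.eq_dec j i)).
      now destruct (Nat.eq_dec i i). }
    rewrite sum_f_R0_head in X. destruct (Nat.eq_dec 0 i) as [h|_]; [lia|].
    rewrite Rplus_0_l in X. rewrite <- X at 1.
    apply sum_n_m_Rext. intros k _. destruct (Nat.eq_dec k i) as [->|]; ring.
  + intros c Hc. apply ext_zero.
    (* Independence comes from definiteness: Q is zero on the zero function, which forces every
       coefficient to vanish. *)
    apply Q_combo_neg. rewrite <- lincomb_combo.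
    unfold Q. rewrite (torus_int_ext _ _ (fun _ _ => 0 * 0)).
    * rewrite torus_int_scal by apply cont2_const. ring.
    * intros x y. rewrite Hc. ring.
  + intros u [c ->]. now exists c.
- intros u [c ->] [x [y Hxy]]. rewrite lincomb_combo in *.
  destruct (Q_combo_neg (ext c)) as [[Hlt|Heq] Hz]; auto.
  exfalso. apply Hxy. unfold combo. apply sum_eq_R0. intros i Hi.
  rewrite (Hz Heq i Hi). ring.
Qed.

End Index.

(** The skew [e] only moves the starting point of the inner integral, which runs over a full
    y-period, so skew and rectangular lattices give the same iterated integral. *)
Lemma torus_int_rect Lx e yp f : 0 < Lx -> 0 < yp -> cont2 f ->
  (forall x y, f x (y + yp) = f x y) ->
  torus_int ((Lx, e), (0, yp)) f = RInt (fun x => RInt (f x) 0 yp) 0 Lx.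
Proof.
intros HL Hy Hf Hp. unfold torus_int. simpl.
rewrite Rmult_0_r, Rminus_0_r, (Rabs_pos_eq (Lx * yp)) by nra.
assert (E : forall s, RInt (fun t => f (s * Lx + t * 0) (s * e + t * yp)) 0 1
  = / yp * RInt (f (Lx * s + 0)) 0 yp).
{ intros s.
  rewrite <- (RInt_period (f (Lx * s + 0)) yp (s * e)) by (auto using cont2_slice).
  pose proof (RInt_comp_lin (V := R_CompleteNormedModule) (f (Lx * s + 0)) yp (s * e) 0 1) as E.
  replace (yp * 0 + s * e) with (s * e) in E by ring.
  replace (yp * 1 + s * e) with (s * e + yp) in E by ring.
  rewrite <- E by (apply cont_ex_RInt; now apply cont2_slice).
  rewrite (RInt_ext (fun y => scal yp _) (fun t => yp * f (s * Lx + t * 0) (s * e + t * yp))).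
  2: { intros t _. unfold scal; simpl; unfold mult; simpl. f_equal. f_equal; ring. }
  rewrite RInt_cscal.
  - assert (X : forall z : R, z = / yp * (yp * z)) by (intros; field; lra). apply X.
  - apply (cont2_slice (fun u t => f (u * Lx + t * 0) (u * e + t * yp)) s).
    apply cont2_comp; auto; cts2. }
rewrite (RInt_cext _ (fun s => / yp * RInt (f (Lx * s + 0)) 0 yp)) by exact E.
pose proof (cont_RInt_param f 0 yp Hf) as C.
rewrite RInt_cscal by (apply (cont_comp _ (fun s => Lx * s + 0) C); cts).
pose proof (RInt_comp_lin (V := R_CompleteNormedModule) (fun x => RInt (f x) 0 yp) Lx 0 0 1) as E2.
replace (Lx * 0 + 0) with 0 in E2 by ring. replace (Lx * 1 + 0) with Lx in E2 by ring.
rewrite <- E2 by now apply cont_ex_RInt.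
rewrite (RInt_ext (fun y => scal Lx _) (fun s => Lx * RInt (f (Lx * s + 0)) 0 yp)).
2: { intros; reflexivity. }
rewrite RInt_cscal by (apply (cont_comp _ (fun s => Lx * s + 0) C); cts).
assert (X : forall z : R, Lx * yp * (/ yp * z) = Lx * z) by (intros; field; lra). apply X.
Qed.

Lemma cos_period_Z x q : cos (x + 2 * IZR q * PI) = cos x.
Proof.
destruct q as [|p|p].
- f_equal. simpl. ring.
- replace (IZR (Z.pos p)) with (INR (Pos.to_nat p)) by now rewrite INR_IZR_INZ, positive_nat_Z.
  apply cos_period.
- rewrite <- (cos_period _ (Pos.to_nat p)). f_equal.
  rewrite INR_IZR_INZ, positive_nat_Z, <- Pos2Z.opp_pos, opp_IZR. ring.
Qed.

Lemma sin_period_Z x q : sin (x + 2 * IZR q * PI) = sin x.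
Proof.
destruct q as [|p|p].
- f_equal. simpl. ring.
- replace (IZR (Z.pos p)) with (INR (Pos.to_nat p)) by now rewrite INR_IZR_INZ, positive_nat_Z.
  apply sin_period.
- rewrite <- (sin_period _ (Pos.to_nat p)). f_equal.
  rewrite INR_IZR_INZ, positive_nat_Z, <- Pos2Z.opp_pos, opp_IZR. ring.
Qed.

Lemma cos_neq_1 x : 0 < Rabs x < 2 * PI -> cos x <> 1.
Proof.
intros Hx. assert (E : cos x = cos (Rabs x)).
{ unfold Rabs. destruct (Rcase_abs x); [now rewrite cos_neg|reflexivity]. }
rewrite E. replace (Rabs x) with (2 * (Rabs x / 2)) by field.
rewrite cos_2a_sin. pose proof (sin_gt_0 (Rabs x / 2) ltac:(lra) ltac:(lra)). nra.
Qed.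

(* [g2 = g''], and [sg], [tu] are the signs of [g] under reflection and half-period shift. *)
Record yfun (b : R) (g g2 : R -> R) (sg tu : R) : Prop := {
  yf_el : el1 g;
  yf_d : exists g1, (forall y, is_derive g y (g1 y)) /\ (forall y, is_derive g1 y (g2 y));
  yf_cont2 : cont g2;
  yf_opp : forall y, g (- y) = sg * g y;
  yf_opp2 : forall y, g2 (- y) = sg * g2 y;
  yf_shift : forall y, g (y + b) = tu * g y;
  yf_shift2 : forall y, g2 (y + b) = tu * g2 y;
  yf_sg : sg ^ 2 = 1;
  yf_tu : tu ^ 2 = 1
}.

Definition trig (s : bool) (om x : R) : R := if s then cos (om * x) else sin (om * x).

Lemma trig_el1 s om : el1 (trig s om).
Proof. destruct s; constructor. Qed.

Lemma trig_cont s om : cont (trig s om).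
Proof. apply el1_cont, trig_el1. Qed.

Lemma trig_derive2 s om : exists A1, (forall x, is_derive (trig s om) x (A1 x)) /\
  (forall x, is_derive A1 x (- om ^ 2 * trig s om x)).
Proof.
destruct s; unfold trig.
- exists (fun x => - om * sin (om * x)). split; intros; auto_derive; auto; ring.
- exists (fun x => om * cos (om * x)). split; intros; auto_derive; auto; ring.
Qed.

(** * Orthogonality and negativity of separated modes *)

Section Torus.

Variables (H a b e : R) (n N : nat) (F : R -> R -> R).
Hypothesis Ha : 0 < a.
Hypothesis Hb : 0 < b.
Hypothesis Hn : (0 < n)%nat.
Hypothesis HF : cont2 F.

Definition pot (x y : R) : R := 4 * H * cosh (F x y).

Hypothesis Wx : forall x y, pot (x + a) y = pot x y.
Hypothesis Wy : forall x y, pot x (y + b) = pot x y.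
Hypothesis Wyo : forall x y, pot x (- y) = pot x y.
(** [N = 2 n] is the rectangular lattice of odd [l], and [N = n] the skew one of even [l], whose
    x-translation [n a] is only half the fundamental trigonometric period. *)
Hypothesis HN : N = (2 * n)%nat \/ N = n.

Let G : lattice := ((INR N * a, e), (0, 2 * b)).
(* [a] is half the x-period, so [cos (freq j * x)] has period [2 n a / j]. *)
Definition freq (j : nat) : R := INR j * PI / (INR n * a).

Lemma pot_cont : cont2 pot.
Proof.
unfold pot. pose proof (cont2_1d cosh F cont_cosh HF). cts2.
Qed.

(** The Jacobi operator on [trig s om x * g y] with the x-factor divided out. *)
Definition opy (om : R) (g g2 : R -> R) (x y : R) : R :=
  om ^ 2 * g y - g2 y - pot x y * g y.

Definition wint (om : R) (g g2 : R -> R) (x : R) : R :=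
  RInt (fun y => g y * opy om g g2 x y) 0 (2 * b).

Lemma jacobi_op_prod s om g g2 sg tu x y : yfun b g g2 sg tu ->
  jacobi_op H F (fun x y => trig s om x * g y) x y = trig s om x * opy om g g2 x y.
Proof.
intros Hg. destruct (yf_d _ _ _ _ _ Hg) as [g1 [D1 D2]].
destruct (trig_derive2 s om) as [A1 [E1 E2]].
unfold jacobi_op. rewrite (Laplacian_prod _ g A1 (fun x => - om ^ 2 * trig s om x) g1 g2) by auto.
unfold opy, pot. ring.
Qed.

Lemma lift_y g : cont g -> cont2 (fun _ y => g y).
Proof. intros Hg. apply (cont2_1d g (fun _ y => y)); [assumption|apply cont2_id2]. Qed.

Lemma lift_x g : cont g -> cont2 (fun x _ => g x).
Proof. intros Hg. apply (cont2_1d g (fun x _ => x)); [assumption|apply cont2_id1]. Qed.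

Lemma opy_cont om g g2 sg tu : yfun b g g2 sg tu -> cont2 (opy om g g2).
Proof.
intros Hg. unfold opy.
pose proof (lift_y g (el1_cont _ (yf_el _ _ _ _ _ Hg))).
pose proof (lift_y g2 (yf_cont2 _ _ _ _ _ Hg)). pose proof pot_cont.
cts2.
Qed.

Lemma bil_iterated s s' om om' g g2 sg tu h h2 sg' tu' :
  yfun b g g2 sg tu -> yfun b h h2 sg' tu' ->
  bil G H F (fun x y => trig s om x * g y) (fun x y => trig s' om' x * h y) =
  RInt (fun x => (trig s om x * trig s' om' x) *
    RInt (fun y => g y * opy om' h h2 x y) 0 (2 * b)) 0 (INR N * a).
Proof.
intros Hg Hh. unfold bil, G.
assert (HN0 : 0 < INR N * a).
{ apply Rmult_lt_0_compat; auto. apply lt_0_INR. lia. }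
assert (Cg := lift_y g (el1_cont _ (yf_el _ _ _ _ _ Hg))).
assert (Co := opy_cont om' h h2 sg' tu' Hh).
assert (Ct := lift_x _ (trig_cont s om)). assert (Ct' := lift_x _ (trig_cont s' om')).
rewrite (torus_int_ext _ _ (fun x y => (trig s om x * trig s' om' x) * (g y * opy om' h h2 x y))).
2: { intros x y. rewrite (jacobi_op_prod _ _ _ _ _ _ _ _ Hh). ring. }
rewrite torus_int_rect; [|auto|lra|cts2|].
- apply RInt_cext. intros x. apply RInt_cscal.
  apply (cont2_slice (fun x y => g y * opy om' h h2 x y)). cts2.
- intros x y. unfold opy.
  replace (y + 2 * b) with (y + b + b) by ring.
  rewrite !(yf_shift _ _ _ _ _ Hg), !(yf_shift _ _ _ _ _ Hh), !(yf_shift2 _ _ _ _ _ Hh), !Wy.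
  pose proof (yf_tu _ _ _ _ _ Hg) as T. pose proof (yf_tu _ _ _ _ _ Hh) as T'.
  simpl in T, T'. rewrite Rmult_1_r in T, T'.
  replace (tu * (tu * g y)) with (g y) by (rewrite <- Rmult_assoc, T; ring).
  replace (tu' * (tu' * h y)) with (h y) by (rewrite <- Rmult_assoc, T'; ring).
  replace (tu' * (tu' * h2 y)) with (h2 y) by (rewrite <- Rmult_assoc, T'; ring).
  reflexivity.
Qed.

Lemma bil_orth_y s s' om om' g g2 sg tu h h2 sg' tu' :
  yfun b g g2 sg tu -> yfun b h h2 sg' tu' -> sg * sg' = -1 \/ tu * tu' = -1 ->
  bil G H F (fun x y => trig s om x * g y) (fun x y => trig s' om' x * h y) = 0.
Proof.
intros Hg Hh Hst. rewrite (bil_iterated _ _ _ _ _ _ _ _ _ _ _ _ Hg Hh).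
assert (Cg := lift_y g (el1_cont _ (yf_el _ _ _ _ _ Hg))).
assert (Co := opy_cont om' h h2 sg' tu' Hh).
rewrite (RInt_cext _ (fun _ => 0)).
{ rewrite RInt_cconst. rring. }
intros x.
enough (E : RInt (fun y => g y * opy om' h h2 x y) 0 (2 * b) = 0) by (rewrite E; ring).
assert (C : cont (fun y => g y * opy om' h h2 x y)).
{ apply (cont2_slice (fun x y => g y * opy om' h h2 x y)). cts2. }
assert (S : forall y, g (y + b) * opy om' h h2 x (y + b) = (tu * tu') * (g y * opy om' h h2 x y)).
{ intros y. unfold opy.
  rewrite (yf_shift _ _ _ _ _ Hg), (yf_shift _ _ _ _ _ Hh), (yf_shift2 _ _ _ _ _ Hh), Wy. ring. }
destruct Hst as [E|E].
- apply RInt_odd_period; auto.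
  + intros y. replace (y + 2 * b) with (y + b + b) by ring. rewrite !S.
    pose proof (yf_tu _ _ _ _ _ Hg) as T. pose proof (yf_tu _ _ _ _ _ Hh) as T'.
    rewrite <- Rmult_assoc. replace (tu * tu' * (tu * tu')) with (tu ^ 2 * tu' ^ 2) by ring.
    rewrite T, T'. ring.
  + intros y. unfold opy.
    rewrite (yf_opp _ _ _ _ _ Hg), (yf_opp _ _ _ _ _ Hh), (yf_opp2 _ _ _ _ _ Hh), Wyo.
    replace (- (g y * (om' ^ 2 * h y - h2 y - pot x y * h y))) with
      ((sg * sg') * (g y * (om' ^ 2 * h y - h2 y - pot x y * h y))) by (rewrite E; ring).
    ring.
- apply RInt_antiperiod; auto. intros y. rewrite S, E. ring.
Qed.

Lemma wint_cont om g g2 sg tu : yfun b g g2 sg tu -> cont (wint om g g2).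
Proof.
intros Hg. unfold wint. apply cont_RInt_param.
assert (Cg := lift_y g (el1_cont _ (yf_el _ _ _ _ _ Hg))).
assert (Co := opy_cont om g g2 sg tu Hg). cts2.
Qed.

Lemma wint_period om g g2 x : wint om g g2 (x + a) = wint om g g2 x.
Proof. unfold wint, opy. apply RInt_cext. intros y. now rewrite Wx. Qed.

(** Signed indices, because product-to-sum formulas produce differences of frequencies. *)
Definition zfreq (f : Z) : R := IZR f * PI / (INR n * a).

(** The phase advances by [f * PI / n] over one period [a] of [w], and [0 < |f| < 2 n] keeps this
    off the multiples of [2 * PI]. For [N = n] an even [f] is what makes the wave close up over
    [N * a]. *)
Lemma trig_int_zero w f : cont w -> (forall x, w (x + a) = w x) ->
  (0 < Z.abs f < 2 * Z.of_nat n)%Z -> (N = n -> Z.Even f) ->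
  RInt (fun x => cos (zfreq f * x) * w x) 0 (INR N * a) = 0 /\
  RInt (fun x => sin (zfreq f * x) * w x) 0 (INR N * a) = 0.
Proof.
intros Hw Hp Hf He.
assert (Hn' : 0 < INR n) by now apply lt_0_INR.
assert (Hq : exists q, zfreq f * (INR N * a) = 2 * IZR q * PI).
{ destruct HN as [E|E].
  - exists f. unfold zfreq. rewrite E, mult_INR. simpl. field. lra.
  - destruct (He E) as [q ->]. exists q. unfold zfreq. rewrite E, mult_IZR. field. lra. }
destruct Hq as [q Hq].
apply RInt_trig_period; auto.
- intros x. now rewrite Rmult_plus_distr_l, Hq, cos_period_Z.
- intros x. now rewrite Rmult_plus_distr_l, Hq, sin_period_Z.
- replace (zfreq f * a) with (IZR f * (PI / INR n)) by (unfold zfreq; field; lra).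
  apply cos_neq_1. pose proof PI_RGT_0 as Hpi.
  assert (Hd : 0 < PI / INR n) by now apply Rdiv_lt_0_compat.
  rewrite Rabs_mult, (Rabs_pos_eq (PI / INR n)) by lra.
  rewrite <- abs_IZR. destruct Hf as [F1 F2].
  apply IZR_lt in F1, F2. rewrite mult_IZR, <- INR_IZR_INZ in F2.
  split; [now apply Rmult_lt_0_compat|].
  apply Rlt_le_trans with (2 * INR n * (PI / INR n)).
  + now apply Rmult_lt_compat_r.
  + right. field. lra.
Qed.

Lemma freq_zfreq j : freq j = zfreq (Z.of_nat j).
Proof. unfold freq, zfreq. now rewrite INR_IZR_INZ. Qed.

Lemma zfreq_plus f g : zfreq (f + g) = zfreq f + zfreq g.
Proof.
unfold zfreq. rewrite plus_IZR. field.
assert (0 < INR n) by now apply lt_0_INR. lra.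
Qed.

Lemma zfreq_minus f g : zfreq (f - g) = zfreq f - zfreq g.
Proof.
unfold zfreq. rewrite minus_IZR. field.
assert (0 < INR n) by now apply lt_0_INR. lra.
Qed.

(** Product-to-sum formulas leave the indices [i + j] and [i - j]. A cosine times a sine produces
    sines only, so [i = j] does no harm there; [i + j < 2 n] stays below the resonance with the
    [a]-periodic weight. *)
Lemma trig_prod_int_zero w s s' i j : cont w -> (forall x, w (x + a) = w x) ->
  (i <= n)%nat -> (j <= n)%nat -> (i + j < 2 * n)%nat ->
  (s = true \/ i <> 0)%nat -> (s' = true \/ j <> 0)%nat ->
  (N = n -> Nat.Even (i + j)) -> s <> s' \/ i <> j ->
  RInt (fun x => (trig s (freq i) x * trig s' (freq j) x) * w x) 0 (INR N * a) = 0.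
Proof.
intros Hw Hp Hi Hj Hij Hs Hs' He Hne.
set (f := (Z.of_nat i + Z.of_nat j)%Z). set (d := (Z.of_nat i - Z.of_nat j)%Z).
assert (Ev : N = n -> Z.Even f /\ Z.Even d).
{ intros E. destruct (He E) as [q Hq]. split; [exists (Z.of_nat q)|exists (Z.of_nat q - Z.of_nat j)%Z];
  unfold f, d; lia. }
assert (T : forall (z : Z) (s : bool), (z = 0%Z -> s = false) -> (Z.abs z < 2 * Z.of_nat n)%Z ->
  (N = n -> Z.Even z) -> RInt (fun x => trig s (zfreq z) x * w x) 0 (INR N * a) = 0).
{ intros z q Hz Hz2 Hev. destruct (Z.eq_dec z 0) as [E|E].
  - rewrite (Hz E), E. rewrite (RInt_cext _ (fun _ => 0)).
    + rewrite RInt_cconst. rring.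
    + intros x. unfold trig, zfreq. replace (0 * PI / (INR n * a) * x) with 0.
      * rewrite sin_0. ring.
      * field. assert (0 < INR n) by now apply lt_0_INR. lra.
  - destruct (trig_int_zero w z Hw Hp) as [E1 E2]; [lia|auto|].
    destruct q; unfold trig; assumption. }
assert (Cw : forall q z, cont (fun x => trig q (zfreq z) x * w x)).
{ intros q z. apply cont_mult; auto. apply trig_cont. }
assert (Cw2 : forall c q z, cont (fun x => c * (trig q (zfreq z) x * w x))).
{ intros c q z. apply cont_mult; [apply cont_const|apply Cw]. }
assert (Ff : zfreq f = freq i + freq j) by (unfold f; now rewrite zfreq_plus, !freq_zfreq).
assert (Fd : zfreq d = freq i - freq j) by (unfold d; now rewrite zfreq_minus, !freq_zfreq).
assert (Sf : RInt (fun x => trig false (zfreq f) x * w x) 0 (INR N * a) = 0).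
{ apply T; auto; [unfold f; lia|intros; now apply Ev]. }
assert (Sd : RInt (fun x => trig false (zfreq d) x * w x) 0 (INR N * a) = 0).
{ apply T; auto; [unfold d; lia|intros; now apply Ev]. }
assert (Cf : (i + j <> 0)%nat -> RInt (fun x => trig true (zfreq f) x * w x) 0 (INR N * a) = 0).
{ intros. apply T; [unfold f; lia|unfold f; lia|intros; now apply Ev]. }
assert (Cd : (i <> j)%nat -> RInt (fun x => trig true (zfreq d) x * w x) 0 (INR N * a) = 0).
{ intros. apply T; [unfold d; lia|unfold d; lia|intros; now apply Ev]. }
destruct s, s'.
- assert (Hij2 : (i <> j)%nat) by (destruct Hne; [congruence|assumption]).
  rewrite (RInt_cext _ (fun x => / 2 * (trig true (zfreq d) x * w x) + / 2 * (trig true (zfreq f) x * w x))).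
  + rewrite RInt_cplus, !RInt_cscal, Cf, Cd by (apply Cw || apply Cw2 || lia). rring.
  + intros x. unfold trig. rewrite Ff, Fd, Rmult_plus_distr_r, Rmult_minus_distr_r, cos_plus, cos_minus. field.
- rewrite (RInt_cext _ (fun x => / 2 * (trig false (zfreq f) x * w x) - / 2 * (trig false (zfreq d) x * w x))).
  + rewrite RInt_cminus, !RInt_cscal, Sf, Sd by (apply Cw || apply Cw2). rring.
  + intros x. unfold trig. rewrite Ff, Fd, Rmult_plus_distr_r, Rmult_minus_distr_r, sin_plus, sin_minus. field.
- rewrite (RInt_cext _ (fun x => / 2 * (trig false (zfreq f) x * w x) + / 2 * (trig false (zfreq d) x * w x))).
  + rewrite RInt_cplus, !RInt_cscal, Sf, Sd by (apply Cw || apply Cw2). rring.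
  + intros x. unfold trig. rewrite Ff, Fd, Rmult_plus_distr_r, Rmult_minus_distr_r, sin_plus, sin_minus. field.
- assert (Hij2 : (i <> j)%nat) by (destruct Hne; [congruence|assumption]).
  rewrite (RInt_cext _ (fun x => / 2 * (trig true (zfreq d) x * w x) - / 2 * (trig true (zfreq f) x * w x))).
  + rewrite RInt_cminus, !RInt_cscal, Cf, Cd by (apply Cw || apply Cw2 || lia). rring.
  + intros x. unfold trig. rewrite Ff, Fd, Rmult_plus_distr_r, Rmult_minus_distr_r, cos_plus, cos_minus. field.
Qed.

Lemma bil_orth_x s s' i j g g2 sg tu : yfun b g g2 sg tu ->
  (i <= n)%nat -> (j <= n)%nat -> (i + j < 2 * n)%nat ->
  (s = true \/ i <> 0)%nat -> (s' = true \/ j <> 0)%nat ->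
  (N = n -> Nat.Even (i + j)) -> s <> s' \/ i <> j ->
  bil G H F (fun x y => trig s (freq i) x * g y) (fun x y => trig s' (freq j) x * g y) = 0.
Proof.
intros Hg. intros. rewrite (bil_iterated _ _ _ _ _ _ _ _ _ _ _ _ Hg Hg).
apply (trig_prod_int_zero (wint (freq j) g g2)); auto.
- now apply wint_cont with sg tu.
- intros. apply wint_period.
Qed.

Hypothesis Wcorr : forall x y, 0 <= cos (2 * PI / a * x) * (pot x y - pot (a / 4) y).

Definition vint (g : R -> R) (x : R) : R := RInt (fun y => pot x y * g y ^ 2) 0 (2 * b).

Lemma vint_cont g : cont g -> cont (vint g).
Proof.
intros Hg. unfold vint. apply cont_RInt_param.
pose proof pot_cont. pose proof (lift_y g Hg). cts2.
Qed.

Lemma RInt_cos_full : RInt (fun x => cos (2 * PI / a * x)) 0 a = 0.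
Proof.
pose proof PI_RGT_0.
rewrite (RInt_FTC (fun x => a / (2 * PI) * sin (2 * PI / a * x))).
- replace (2 * PI / a * a) with (2 * PI) by (field; lra).
  rewrite sin_2PI, !Rmult_0_r, sin_0. rring.
- intros x. auto_derive; auto. field. lra.
- cts.
Qed.

(** The cosine vanishes at [a / 4] and has mean zero over [a], so subtracting [vint g (a / 4)] is
    free; afterwards the integrand is nonnegative by [Wcorr]. *)
Lemma vint_corr g : cont g -> 0 <= RInt (fun x => cos (2 * PI / a * x) * vint g x) 0 a.
Proof.
intros Hg. pose proof (vint_cont g Hg) as Cv. pose proof pot_cont as Cp.
assert (Cc : cont (fun x => cos (2 * PI / a * x))) by cts.
assert (C2 : forall x, cont (fun y => pot x y * g y ^ 2)).
{ intros x. apply cont_mult; [now apply cont2_slice|now apply cont_pow]. }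
assert (E : RInt (fun x => vint g (a / 4) * cos (2 * PI / a * x)) 0 a = 0).
{ rewrite RInt_cscal, RInt_cos_full by assumption. rring. }
eapply Rle_trans; [apply Req_le; symmetry; apply E|].
apply RInt_cle; [lra|cts|cts|].
intros x.
enough (0 <= cos (2 * PI / a * x) * (vint g x - vint g (a / 4))) by lra.
assert (E1 : cos (2 * PI / a * x) * (vint g x - vint g (a / 4)) =
  RInt (fun y => cos (2 * PI / a * x) * (pot x y * g y ^ 2 - pot (a / 4) y * g y ^ 2)) 0 (2 * b)).
{ symmetry.
  rewrite (RInt_cscal (cos (2 * PI / a * x)) (fun y => pot x y * g y ^ 2 - pot (a / 4) y * g y ^ 2))
    by (apply cont_minus; apply C2).
  rewrite (RInt_cminus (fun y => pot x y * g y ^ 2) (fun y => pot (a / 4) y * g y ^ 2))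
    by apply C2.
  reflexivity. }
rewrite E1. apply RInt_cge0; [lra|apply cont_mult; [apply cont_const|apply cont_minus; apply C2]|].
intros y. pose proof (Wcorr x y). pose proof (pow2_ge_0 (g y)).
replace (cos (2 * PI / a * x) * (pot x y * g y ^ 2 - pot (a / 4) y * g y ^ 2)) with
  (cos (2 * PI / a * x) * (pot x y - pot (a / 4) y) * g y ^ 2) by ring.
now apply Rmult_le_pos.
Qed.

Lemma wint_vint om g g2 sg tu x : yfun b g g2 sg tu ->
  wint om g g2 x = om ^ 2 * RInt (fun y => g y ^ 2) 0 (2 * b)
    + RInt (fun y => - (g y * g2 y)) 0 (2 * b) - vint g x.
Proof.
intros Hg. unfold wint, vint, opy.
pose proof (el1_cont _ (yf_el _ _ _ _ _ Hg)) as Cg. pose proof (yf_cont2 _ _ _ _ _ Hg) as Cg2.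
pose proof (cont2_slice _ x pot_cont) as Cp.
rewrite <- RInt_cscal, <- RInt_cplus, <- RInt_cminus by cts.
apply RInt_cext. intros y. ring.
Qed.

(* [cos^2] and [sin^2] average to 1/2 against an [a]-periodic weight, except
   for [cos^2] at the top frequency [j = n], where the correlation of the
   potential with [cos (2 pi x / a)] only helps. *)
Lemma bil_neg s j g g2 sg tu : yfun b g g2 sg tu ->
  (j <= n)%nat -> (s = true \/ (0 < j < n)%nat) ->
  a * (freq j ^ 2 * RInt (fun y => g y ^ 2) 0 (2 * b)
    + RInt (fun y => - (g y * g2 y)) 0 (2 * b)) < RInt (vint g) 0 a ->
  bil G H F (fun x y => trig s (freq j) x * g y) (fun x y => trig s (freq j) x * g y) < 0.
Proof.
intros Hg Hj Hs Hlt. rewrite (bil_iterated _ _ _ _ _ _ _ _ _ _ _ _ Hg Hg).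
pose proof (wint_cont (freq j) g g2 sg tu Hg) as Cw.
pose proof (el1_cont _ (yf_el _ _ _ _ _ Hg)) as Cg.
pose proof (vint_cont g Cg) as Cv.
set (w := wint (freq j) g g2) in *.
change (RInt (fun x => trig s (freq j) x * trig s (freq j) x * w x) 0 (INR N * a) < 0).
assert (HN0 : 0 < INR N) by (apply lt_0_INR; lia).
assert (Hn' : 0 < INR n) by now apply lt_0_INR.
set (K := freq j ^ 2 * RInt (fun y => g y ^ 2) 0 (2 * b)
    + RInt (fun y => - (g y * g2 y)) 0 (2 * b)) in *.
assert (Ew : forall x, w x = K - vint g x).
{ intros x. unfold w. rewrite (wint_vint _ _ _ _ _ _ Hg). reflexivity. }
assert (Hw : RInt w 0 (INR N * a) < 0).
{ rewrite RInt_period_INR by (auto; intros; apply wint_period).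
  rewrite (RInt_cext w (fun x => K - vint g x)) by assumption.
  rewrite RInt_cminus, RInt_cconst by cts. nra. }
destruct (Nat.eq_dec j 0) as [->|Hj0].
{ destruct Hs as [->|Hs]; [|lia].
  rewrite (RInt_cext _ w); auto. intros x. unfold trig, freq.
  simpl INR. rewrite !Rmult_0_l, Rdiv_0_l, Rmult_0_l, cos_0. ring. }
set (c := fun x => cos (zfreq (2 * Z.of_nat j) * x) * w x).
assert (Cc : cont c).
{ unfold c. apply cont_mult; auto. cts. }
assert (F2 : zfreq (2 * Z.of_nat j) = 2 * freq j).
{ unfold zfreq, freq. rewrite mult_IZR, <- INR_IZR_INZ. field. lra. }
assert (Hc : s = true -> j = n -> RInt c 0 (INR N * a) <= 0).
{ intros _ E. unfold c. rewrite F2.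
  replace (2 * freq j) with (2 * PI / a) by (unfold freq; rewrite E; field; lra).
  assert (Cc2 : cont (fun x => cos (2 * PI / a * x))) by cts.
  rewrite RInt_period_INR.
  2: { cts. }
  2: { intros x. unfold w. rewrite wint_period. f_equal.
       replace (2 * PI / a * (x + a)) with (2 * PI / a * x + 2 * PI) by (field; lra).
       rewrite <- (cos_period_Z (2 * PI / a * x) 1). f_equal. ring. }
  rewrite (RInt_cext _ (fun x => K * cos (2 * PI / a * x) - cos (2 * PI / a * x) * vint g x)).
  2: { intros x. rewrite Ew. ring. }
  rewrite RInt_cminus, RInt_cscal, RInt_cos_full by cts.
  pose proof (vint_corr g Cg). nra. }
assert (Hc2 : (j < n)%nat -> RInt c 0 (INR N * a) = 0).
{ intros Hjn. destruct (trig_int_zero w (2 * Z.of_nat j) Cw) as [E _].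
  - intros; apply wint_period.
  - lia.
  - intros _. exists (Z.of_nat j). ring.
  - exact E. }
destruct s.
- rewrite (RInt_cext _ (fun x => / 2 * w x + / 2 * c x)).
  + rewrite RInt_cplus, !RInt_cscal by cts.
    destruct (Nat.eq_dec j n) as [E|E]; [specialize (Hc eq_refl E); lra|].
    rewrite Hc2 by lia. lra.
  + intros x. unfold c, trig. rewrite F2. replace (2 * freq j * x) with (2 * (freq j * x)) by ring. rewrite cos_2a_cos. field.
- rewrite (RInt_cext _ (fun x => / 2 * w x - / 2 * c x)).
  + rewrite RInt_cminus, !RInt_cscal by cts.
    rewrite Hc2 by (destruct Hs; [discriminate|lia]). lra.
  + intros x. unfold c, trig. rewrite F2. replace (2 * freq j * x) with (2 * (freq j * x)) by ring. rewrite cos_2a_sin. field.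
Qed.

End Torus.

(** * The potential *)

Lemma tanh_exp z : tanh z = (exp (2 * z) - 1) / (exp (2 * z) + 1).
Proof.
unfold tanh, sinh, cosh. replace (2 * z) with (z + z) by ring.
rewrite exp_plus, exp_Ropp. pose proof (exp_pos z).
field. split; nra.
Qed.

Lemma exp_of_tanh z s : tanh (z / 4) = s -> s ^ 2 < 1 /\ exp (z / 2) = (1 + s) / (1 - s).
Proof.
intros E. rewrite tanh_exp in E. replace (2 * (z / 4)) with (z / 2) in E by field.
pose proof (exp_pos (z / 2)) as Hq. set (q := exp (z / 2)) in *.
assert (Es : s * (q + 1) = q - 1) by (rewrite <- E; field; lra).
assert (Hs : -1 < s < 1) by (split; nra).
split; [nra|]. apply (Rmult_eq_reg_r (1 - s)); [|lra]. unfold Rdiv.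
rewrite Rmult_assoc, Rinv_l by lra. lra.
Qed.

Lemma ln_of_tanh z s : tanh (z / 4) = s -> z = 2 * (ln (1 + s) - ln (1 - s)).
Proof.
intros H. destruct (exp_of_tanh _ _ H) as [Hs E].
assert (-1 < s < 1) by (split; nra).
rewrite <- ln_div by lra. rewrite <- E, ln_exp. field.
Qed.

Lemma cosh_of_tanh z s : tanh (z / 4) = s ->
  cosh z = 1 + 8 * s ^ 2 / (1 - s ^ 2) ^ 2.
Proof.
intros E. destruct (exp_of_tanh z s E) as [Hs Eq].
assert (-1 < s < 1) by (split; nra).
unfold cosh. rewrite exp_Ropp. replace z with (z / 2 + z / 2) by field.
rewrite exp_plus, Eq. field. repeat split; nra.
Qed.

Lemma cont2_ln f : cont2 f -> (forall x y, 0 < f x y) -> cont2 (fun x y => ln (f x y)).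
Proof.
intros Hf Hp x y. apply continuity_1d_2d_pt_comp; [|apply Hf].
apply derivable_continuous_pt. exists (/ f x y). now apply derivable_pt_lim_ln.
Qed.

Definition wpot (w : R) : R := 1 + 8 * w / (1 - w) ^ 2.

Lemma wpot_incr u v : 0 <= u <= v -> v < 1 -> wpot u <= wpot v.
Proof.
intros Hu Hv. unfold wpot, Rdiv.
assert (A : / (1 - u) ^ 2 <= / (1 - v) ^ 2).
{ apply Rinv_le_contravar; [apply pow2_gt_0; lra|]. nra. }
assert (0 < / (1 - u) ^ 2) by (apply Rinv_0_lt_compat, pow2_gt_0; lra).
nra.
Qed.

(** Five terms of [w / (1 - w) ^ 2 = sum of j w ^ j]; the remainder is exactly
    [w ^ 6 (6 - 5 w) / (1 - w) ^ 2]. *)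
Lemma wpot_poly w : 0 <= w < 1 ->
  1 + 8 * (w + 2 * w ^ 2 + 3 * w ^ 3 + 4 * w ^ 4 + 5 * w ^ 5) <= wpot w.
Proof.
intros Hw. unfold wpot.
assert (H0 : 0 < (1 - w) ^ 2) by (apply pow2_gt_0; lra).
assert (E : 8 * w / (1 - w) ^ 2 - 8 * (w + 2 * w ^ 2 + 3 * w ^ 3 + 4 * w ^ 4 + 5 * w ^ 5)
  = 8 * w * (w ^ 5 * (6 - 5 * w)) / (1 - w) ^ 2) by (field; lra).
enough (0 <= 8 * w * (w ^ 5 * (6 - 5 * w)) / (1 - w) ^ 2) by lra.
apply Rmult_le_pos; [|left; now apply Rinv_0_lt_compat].
repeat apply Rmult_le_pos; lra || (apply pow_le; lra).
Qed.

(** * Derivatives, moments and averages of Jacobi functions *)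

Section Jacobi.

Variables (k be : R).
Hypothesis Hk : 0 < k < 1.
Hypothesis Hbe : 0 < be.
Let m : R := k ^ 2.
Let b : R := 2 * ellK k / be.
Let sn (y : R) : R := jacobi_sn k (be * y).
Let cn (y : R) : R := jacobi_cn k (be * y).
Let dn (y : R) : R := jacobi_dn k (be * y).

Lemma half_period_pos : 0 < 2 * ellK k / be.
Proof.
pose proof (ellK_bounds k Hk) as [E _]. pose proof PI_RGT_0.
apply Rdiv_lt_0_compat; lra.
Qed.

Lemma half_period_mult : be * b = 2 * ellK k.
Proof. unfold b. field. lra. Qed.

Lemma cn_shift y : cn (y + b) = - cn y.
Proof. unfold cn. now rewrite Rmult_plus_distr_l, half_period_mult, jacobi_cn_2K. Qed.
Lemma sn_shift y : sn (y + b) = - sn y.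
Proof. unfold sn. now rewrite Rmult_plus_distr_l, half_period_mult, jacobi_sn_2K. Qed.
Lemma cn_even y : cn (- y) = cn y.
Proof. unfold cn. now rewrite Ropp_mult_distr_r_reverse, jacobi_cn_opp. Qed.
Lemma sn_odd y : sn (- y) = - sn y.
Proof. unfold sn. now rewrite Ropp_mult_distr_r_reverse, jacobi_sn_opp. Qed.
Lemma sn_d y : is_derive sn y (be * (cn y * dn y)).
Proof. apply (is_derive_lin_arg (jacobi_sn k)). now apply jacobi_sn_derive. Qed.
Lemma cn_d y : is_derive cn y (- (be * (sn y * dn y))).
Proof.
replace (- (be * (sn y * dn y))) with (be * (- (sn y * dn y))) by ring.
apply (is_derive_lin_arg (jacobi_cn k)). now apply jacobi_cn_derive.
Qed.
Lemma dn_d y : is_derive dn y (- (be * (m * sn y * cn y))).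
Proof.
replace (- (be * (m * sn y * cn y))) with (be * (- (m * sn y * cn y))) by ring.
apply (is_derive_lin_arg (jacobi_dn k)). now apply jacobi_dn_derive.
Qed.
Lemma sn2 y : sn y * sn y = 1 - cn y * cn y.
Proof. pose proof (jacobi_sn_cn_sqr k (be * y)) as E. unfold sn, cn. lra. Qed.
Lemma dn2 y : dn y * dn y = 1 - m + m * (cn y * cn y).
Proof.
pose proof (jacobi_dn_sqr k (be * y) Hk) as E. rewrite jacobi_sn_cn_sqr in E.
unfold dn, cn, m. lra.
Qed.
Lemma sn_el : el1 sn. Proof. exact (el1_sn k be Hk). Qed.
Lemma cn_el : el1 cn. Proof. exact (el1_cn k be Hk). Qed.
Lemma dn_el : el1 dn. Proof. exact (el1_dn k be Hk). Qed.
Lemma sn_cont : cont sn. Proof. apply el1_cont, sn_el. Qed.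
Lemma cn_cont : cont cn. Proof. apply el1_cont, cn_el. Qed.
Lemma dn_cont : cont dn. Proof. apply el1_cont, dn_el. Qed.

Lemma is_derive_Rmult (f g : R -> R) x df dg : is_derive f x df -> is_derive g x dg ->
  is_derive (fun y => f y * g y) x (df * g x + f x * dg).
Proof. intros Hf Hg. apply (is_derive_mult f g); auto. intros; apply Rmult_comm. Qed.

Lemma yfun_one : yfun b (fun _ => 1) (fun _ => 0) 1 1.
Proof.
assert (D : forall c y, is_derive (fun _ : R => c) y 0).
{ intros. apply is_derive_Reals, derivable_pt_lim_const. }
constructor; intros; try ring.
- constructor.
- exists (fun _ => 0). split; intros; apply D.
- apply cont_const.
Qed.

Lemma yfun_cn : yfun b cn (fun y => - be ^ 2 * (cn y * (1 - 2 * m + 2 * m * cn y ^ 2))) 1 (-1).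
Proof.
pose proof cn_cont.
constructor; intros; try ring.
- apply cn_el.
- exists (fun y => (- be) * (sn y * dn y)). split; intros y.
  + replace ((- be) * (sn y * dn y)) with (- (be * (sn y * dn y))) by ring. apply cn_d.
  + replace (- be ^ 2 * (cn y * (1 - 2 * m + 2 * m * cn y ^ 2))) with
      ((- be) * (be * (cn y * dn y) * dn y + sn y * - (be * (m * sn y * cn y)))).
    * apply is_derive_scal. apply is_derive_Rmult; [apply sn_d|apply dn_d].
    * replace ((- be) * (be * (cn y * dn y) * dn y + sn y * - (be * (m * sn y * cn y))))
        with (- be ^ 2 * (cn y * (dn y * dn y - m * (sn y * sn y)))) by ring.
      rewrite sn2, dn2. ring.
- cts.
- now rewrite cn_even, Rmult_1_l.
- rewrite cn_even. ring.
- rewrite cn_shift. ring.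
- rewrite cn_shift. ring.
Qed.

Lemma yfun_sn : yfun b sn (fun y => - be ^ 2 * (sn y * (1 - m + 2 * m * cn y ^ 2))) (-1) (-1).
Proof.
pose proof cn_cont. pose proof sn_cont.
constructor; intros; try ring.
- apply sn_el.
- exists (fun y => be * (cn y * dn y)). split; intros y.
  + apply sn_d.
  + replace (- be ^ 2 * (sn y * (1 - m + 2 * m * cn y ^ 2))) with
      (be * (- (be * (sn y * dn y)) * dn y + cn y * - (be * (m * sn y * cn y)))).
    * apply is_derive_scal. apply is_derive_Rmult; [apply cn_d|apply dn_d].
    * replace (be * (- (be * (sn y * dn y)) * dn y + cn y * - (be * (m * sn y * cn y))))
        with (- be ^ 2 * (sn y * (dn y * dn y + m * (cn y * cn y)))) by ring.
      rewrite dn2. ring.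
- cts.
- rewrite sn_odd. ring.
- rewrite cn_even, sn_odd. ring.
- rewrite sn_shift. ring.
- rewrite cn_shift, sn_shift. ring.
Qed.

Lemma yfun_sncn : yfun b (fun y => sn y * cn y)
  (fun y => - be ^ 2 * (sn y * cn y * (4 - 5 * m + 6 * m * cn y ^ 2))) (-1) 1.
Proof.
pose proof cn_cont. pose proof sn_cont.
constructor; intros; try ring.
- apply el1_mult; [apply sn_el|apply cn_el].
- exists (fun y => be * (dn y * (cn y * cn y - sn y * sn y))). split; intros y.
  + replace (be * (dn y * (cn y * cn y - sn y * sn y))) with
      (be * (cn y * dn y) * cn y + sn y * - (be * (sn y * dn y))) by ring.
    apply is_derive_Rmult; [apply sn_d|apply cn_d].
  + replace (- be ^ 2 * (sn y * cn y * (4 - 5 * m + 6 * m * cn y ^ 2))) with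
      (be * (- (be * (m * sn y * cn y)) * (cn y * cn y - sn y * sn y) +
        dn y * ((- (be * (sn y * dn y)) * cn y + cn y * - (be * (sn y * dn y)))
         - (be * (cn y * dn y) * sn y + sn y * (be * (cn y * dn y)))))).
    * apply is_derive_scal.
      apply (is_derive_Rmult dn (fun y => cn y * cn y - sn y * sn y)); [apply dn_d|].
      apply (is_derive_minus (fun y => cn y * cn y) (fun y => sn y * sn y)).
      -- apply (is_derive_Rmult cn cn); apply cn_d.
      -- apply (is_derive_Rmult sn sn); apply sn_d.
    * match goal with |- ?l = _ => replace l with
        (- be ^ 2 * (sn y * cn y * (m * (cn y * cn y - sn y * sn y) + 4 * (dn y * dn y)))) by ring end.
      rewrite dn2, sn2. ring.
- cts.
- rewrite cn_even, sn_odd. ring.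
- rewrite cn_even, sn_odd. ring.
- rewrite cn_shift, sn_shift. ring.
- rewrite cn_shift, sn_shift. ring.
Qed.

Definition moment (j : nat) : R := RInt (fun y => cn y ^ (2 * j)) 0 (2 * b).

Lemma moment_0 : moment 0 = 2 * b.
Proof.
unfold moment. rewrite (RInt_cext _ (fun _ => 1)) by reflexivity.
rewrite RInt_cconst. rring.
Qed.

Lemma cn_pow_cont n : cont (fun y => cn y ^ n).
Proof. apply cont_pow, cn_cont. Qed.

Lemma is_derive_Rpow (f : R -> R) n x df : is_derive f x df ->
  is_derive (fun y => f y ^ n) x (INR n * df * f x ^ pred n).
Proof. apply is_derive_pow. Qed.

(** Integrate the derivative of [sn * dn * cn ^ (2 j + 1)] over a period; the boundary terms vanish
    with [sn]. *)
Lemma moment_rec j : INR (2 * j + 3) * m * moment (S (S j)) =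
  INR (2 * j + 2) * (2 * m - 1) * moment (S j) + INR (2 * j + 1) * (1 - m) * moment j.
Proof.
set (f := fun y => be * (INR (2 * j + 3) * m * cn y ^ (2 * S (S j))
  - INR (2 * j + 2) * (2 * m - 1) * cn y ^ (2 * S j)
  - INR (2 * j + 1) * (1 - m) * cn y ^ (2 * j))).
assert (C : forall n, cont (fun y => cn y ^ n)) by apply cn_pow_cont.
assert (Cf : cont f).
{ unfold f. apply cont_mult; [apply cont_const|].
  apply cont_minus; [apply cont_minus|]; (apply cont_mult; [apply cont_const|apply C]). }
assert (D : forall y, is_derive (fun y => sn y * dn y * cn y ^ (2 * j + 1)) y (f y)).
{ intros y. replace (f y) with
   ((be * (cn y * dn y) * dn y + sn y * - (be * (m * sn y * cn y))) * cn y ^ (2 * j + 1)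
    + sn y * dn y * (INR (2 * j + 1) * - (be * (sn y * dn y)) * cn y ^ pred (2 * j + 1))).
  - apply (is_derive_Rmult (fun y => sn y * dn y)).
    + apply is_derive_Rmult; [apply sn_d|apply dn_d].
    + apply is_derive_Rpow, cn_d.
  - unfold f. replace (pred (2 * j + 1)) with (2 * j)%nat by lia.
    replace (2 * S (S j))%nat with (2 * j + 4)%nat by lia.
    replace (2 * S j)%nat with (2 * j + 2)%nat by lia.
    rewrite !plus_INR, !pow_add. simpl (INR 1). simpl (INR 2). simpl (INR 3).
    set (p := cn y ^ (2 * j)). set (n := INR (2 * j)).
    match goal with |- ?l = _ => replace l with
      (be * (((dn y * dn y) - m * (sn y * sn y)) * (cn y * cn y) * p
        - (n + 1) * (sn y * sn y) * (dn y * dn y) * p)) by (simpl; ring) end.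
    rewrite dn2, sn2. ring. }
assert (E := RInt_FTC _ f 0 (2 * b) D Cf). cbv beta in E.
assert (S0 : sn 0 = 0).
{ unfold sn, jacobi_sn. now rewrite Rmult_0_r, jacobi_am_0, sin_0. }
assert (S1 : sn (2 * b) = 0).
{ replace (2 * b) with (0 + b + b) by ring. now rewrite !sn_shift, S0, !Ropp_0. }
rewrite S0, S1, !Rmult_0_l, Rminus_0_r in E.
assert (C1 : forall c n, cont (fun y => c * cn y ^ n)) by (intros; apply cont_mult; [apply cont_const|apply C]).
unfold f in E. rewrite RInt_cscal in E by (apply cont_minus; [apply cont_minus|]; apply C1).
rewrite RInt_cminus in E by (try apply cont_minus; apply C1).
rewrite RInt_cminus in E by apply C1.
rewrite !RInt_cscal in E by apply C.
fold (moment j) in E. fold (moment (S j)) in E. fold (moment (S (S j))) in E.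
apply Rmult_integral in E. destruct E as [E|E]; lra.
Qed.

(* [dn] is the speed of the amplitude, so its mean over a period is explicit. *)
Lemma RInt_dn n : RInt (fun x => be * dn x) 0 (INR n * b) = INR n * PI.
Proof.
rewrite (RInt_FTC (fun x => jacobi_am k (be * x))).
- rewrite Rmult_0_r, jacobi_am_0 by assumption.
  replace (be * (INR n * b)) with (INR n * (2 * ellK k)) by (rewrite <- half_period_mult; ring).
  rewrite Rminus_0_r. induction n as [|n IH].
  + simpl. now rewrite !Rmult_0_l, jacobi_am_0.
  + rewrite S_INR. replace ((INR n + 1) * (2 * ellK k)) with (INR n * (2 * ellK k) + 2 * ellK k) by ring.
    rewrite jacobi_am_PI, IH by assumption. rring.
- intros x. apply (is_derive_lin_arg (jacobi_am k)). now apply jacobi_am_derive.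
- pose proof dn_cont. cts.
Qed.

Lemma dn_bounds x : sqrt (1 - m) <= dn x <= 1 /\ 0 < dn x.
Proof. now apply jacobi_dn_bounds. Qed.

(* Substitution [phi = am (be x)], using [dn <= 1] to discard the Jacobian. *)
Lemma RInt_am_lower (f G : R -> R) : cont f -> (forall p, 0 <= f p) ->
  (forall p, is_derive G p (f p)) ->
  G PI - G 0 <= be * RInt (fun x => f (jacobi_am k (be * x))) 0 b.
Proof.
intros Cf Hf HG. pose proof dn_cont as Cd. pose proof (cont_am k Hk) as Ca.
assert (E := RInt_FTC (fun x => G (jacobi_am k (be * x)))
  (fun x => be * (f (jacobi_am k (be * x)) * dn x)) 0 b).
assert (A0 : jacobi_am k (be * 0) = 0) by now rewrite Rmult_0_r, jacobi_am_0.
assert (A1 : jacobi_am k (be * b) = PI).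
{ rewrite half_period_mult, <- (Rplus_0_l (2 * ellK k)), jacobi_am_PI, jacobi_am_0 by assumption. ring. }
cbv beta in E. rewrite A0, A1 in E. rewrite <- E.
- rewrite RInt_cscal by cts. apply Rmult_le_compat_l; [lra|].
  apply RInt_cle; [left; apply half_period_pos|cts|cts|].
  intros x. pose proof (dn_bounds x). pose proof (Hf (jacobi_am k (be * x))). nra.
- intros x. replace (be * (f (jacobi_am k (be * x)) * dn x)) with
    (be * dn x * f (jacobi_am k (be * x))) by ring.
  apply (is_derive_comp G (fun x => jacobi_am k (be * x))); [apply HG|].
  apply (is_derive_lin_arg (jacobi_am k)). now apply jacobi_am_derive.
- cts.
Qed.

Lemma kappa_bounds : sqrt (1 - m) * (be * b) <= PI <= be * b.
Proof.
rewrite half_period_mult. pose proof (ellK_bounds k Hk). unfold m. lra.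
Qed.

Lemma cn_sqr_bounds y : 0 <= cn y ^ 2 <= 1.
Proof. pose proof (sn2 y). pose proof (pow2_ge_0 (cn y)). pose proof (pow2_ge_0 (sn y)). nra. Qed.

Definition wallis (j : nat) : R := RInt (fun p => cos p ^ (2 * j)) 0 PI.

Lemma wallis_rec j : INR (2 * j + 2) * wallis (S j) = INR (2 * j + 1) * wallis j.
Proof.
assert (C : forall c n, cont (fun p => c * cos p ^ n)) by (intros; pose proof cont_cos; cts).
assert (D : forall p, is_derive (fun p => sin p * cos p ^ (2 * j + 1)) p
  (INR (2 * j + 2) * cos p ^ (2 * S j) - INR (2 * j + 1) * cos p ^ (2 * j))).
{ intros p. replace (INR (2 * j + 2) * cos p ^ (2 * S j) - INR (2 * j + 1) * cos p ^ (2 * j))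
   with (cos p * cos p ^ (2 * j + 1) + sin p * (INR (2 * j + 1) * - sin p * cos p ^ pred (2 * j + 1))).
  - apply is_derive_Rmult; [apply is_derive_sin|]. apply is_derive_Rpow, is_derive_cos.
  - replace (pred (2 * j + 1)) with (2 * j)%nat by lia.
    replace (2 * S j)%nat with (2 * j + 2)%nat by lia.
    rewrite !plus_INR, !pow_add. simpl (INR 1). simpl (INR 2).
    set (q := cos p ^ (2 * j)). set (n := INR (2 * j)).
    match goal with |- ?l = _ => replace l with
      (cos p * cos p * q - (n + 1) * (sin p * sin p) * q) by (simpl; ring) end.
    pose proof (sin2_cos2 p) as S. unfold Rsqr in S.
    replace (sin p * sin p) with (1 - cos p * cos p) by lra. ring. }
assert (E := RInt_FTC _ _ 0 PI D (cont_minus _ _ (C _ _) (C _ _))). cbv beta in E.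
rewrite sin_0, sin_PI, RInt_cminus, !RInt_cscal in E by
  (apply C || (pose proof cont_cos; cts)).
fold (wallis j) in E. fold (wallis (S j)) in E. lra.
Qed.

Lemma wallis_0 : wallis 0 = PI.
Proof.
unfold wallis. rewrite (RInt_cext _ (fun _ => 1)) by reflexivity.
rewrite RInt_cconst. rring.
Qed.

Lemma cn_moment_lower j : wallis j <= be * RInt (fun x => cn x ^ (2 * j)) 0 b.
Proof.
assert (C : cont (fun p => cos p ^ (2 * j))) by (pose proof cont_cos; cts).
assert (E := RInt_am_lower (fun p => cos p ^ (2 * j))
  (fun p => RInt (fun q => cos q ^ (2 * j)) 0 p) C).
cbv beta in E. fold (wallis j) in E.
assert (Z : RInt (fun q => cos q ^ (2 * j)) 0 0 = 0) by apply (RInt_point (V := R_CompleteNormedModule)).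
rewrite Z, Rminus_0_r in E. apply E.
- intros p. rewrite pow_mult. apply pow_le, pow2_ge_0.
- intros p. apply (is_derive_RInt (V := R_NormedModule) (fun q => cos q ^ (2 * j)) _ 0).
  + apply filter_forall. intros q. apply (RInt_correct (V := R_CompleteNormedModule)).
    now apply cont_ex_RInt.
  + apply C.
Qed.

(* The positivity of [cos (2 pi x / b)] on a quarter period matches the range
   where [cn^2] exceeds its value at the eighth of the period. *)
Lemma cn_sqr_corr x : (0 <= cos (2 * PI / b * x) /\ cn (b / 4) ^ 2 <= cn x ^ 2) \/
  (cos (2 * PI / b * x) <= 0 /\ cn x ^ 2 <= cn (b / 4) ^ 2).
Proof.
pose proof half_period_pos as Hb. fold b in Hb. pose proof PI_RGT_0 as Hpi.
assert (R : forall z, 0 <= z <= b / 2 ->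
  (0 <= cos (2 * PI / b * z) /\ cn (b / 4) ^ 2 <= cn z ^ 2) \/
  (cos (2 * PI / b * z) <= 0 /\ cn z ^ 2 <= cn (b / 4) ^ 2)).
{ assert (Mono : forall u v, 0 <= u <= v -> v <= b / 2 -> cn v ^ 2 <= cn u ^ 2).
  { intros u v Hu Hv.
    assert (Eb : be * (b / 2) = ellK k).
    { replace (be * (b / 2)) with (be * b / 2) by field. rewrite half_period_mult. field. }
    pose proof (jacobi_am_le k 0 (be * u) Hk ltac:(nra)) as M1.
    pose proof (jacobi_am_le k (be * u) (be * v) Hk ltac:(nra)) as M2.
    pose proof (jacobi_am_le k (be * v) (be * (b / 2)) Hk ltac:(nra)) as M3.
    rewrite Eb, jacobi_am_K in M3 by assumption. rewrite jacobi_am_0 in M1 by assumption.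
    unfold cn, jacobi_cn.
    assert (0 <= cos (jacobi_am k (be * v))) by (apply cos_ge_0; lra).
    assert (cos (jacobi_am k (be * v)) <= cos (jacobi_am k (be * u))) by (apply cos_decr_1; lra).
    nra. }
  intros z Hz. destruct (Rle_dec z (b / 4)) as [h|h].
  - left. split; [|apply Mono; lra].
    assert (0 <= 2 * PI / b * z <= PI / 2).
    { split; [apply Rmult_le_pos; [left; apply Rdiv_lt_0_compat|]; lra|].
      apply Rle_trans with (2 * PI / b * (b / 4)); [|right; field; lra].
      apply Rmult_le_compat_l; [left; apply Rdiv_lt_0_compat|]; lra. }
    apply cos_ge_0; lra.
  - right. split; [|apply Mono; lra].
    assert (PI / 2 <= 2 * PI / b * z <= PI).
    { split.
      - apply Rle_trans with (2 * PI / b * (b / 4)); [right; field; lra|].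
        apply Rmult_le_compat_l; [left; apply Rdiv_lt_0_compat|]; lra.
      - apply Rle_trans with (2 * PI / b * (b / 2)); [|right; field; lra].
        apply Rmult_le_compat_l; [left; apply Rdiv_lt_0_compat|]; lra. }
    apply cos_le_0; lra. }
assert (P : forall n z, cn (z + INR n * b) ^ 2 = cn z ^ 2).
{ intros n z. apply (period_INR (fun z => cn z ^ 2)).
  intros. rewrite cn_shift. ring. }
assert (PZ : forall i z, cn (z + IZR i * b) ^ 2 = cn z ^ 2).
{ intros i z. destruct (Z_le_gt_dec 0 i) as [h|h].
  - rewrite <- (Z2Nat.id i h), <- INR_IZR_INZ. apply P.
  - rewrite <- (P (Z.to_nat (- i)) (z + IZR i * b)). f_equal. f_equal.
    rewrite INR_IZR_INZ, Z2Nat.id, opp_IZR by lia. ring. }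
(* [i] is an integer nearest to [x / b], so that [z] lies within [b / 2] of 0. *)
set (i := up (x / b - / 2)).
destruct (archimed (x / b - / 2)) as [A1 A2]. fold i in A1, A2.
set (z := x - IZR i * b).
assert (Ex : x = z + IZR i * b) by (unfold z; ring).
assert (Hz : - (b / 2) <= z <= b / 2).
{ assert (E : x = x / b * b) by (field; lra). unfold z. rewrite E. split; nra. }
assert (Ec : cos (2 * PI / b * x) = cos (2 * PI / b * z)).
{ rewrite Ex. replace (2 * PI / b * (z + IZR i * b)) with (2 * PI / b * z + 2 * IZR i * PI)
    by (field; lra). apply cos_period_Z. }
rewrite Ec. rewrite Ex, PZ.
destruct (Rle_dec 0 z) as [h|h]; [apply R; lra|].
rewrite <- (cn_even z), <- (cos_neg (2 * PI / b * z)), Ropp_mult_distr_r. apply R. lra.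
Qed.

End Jacobi.

(* The smooth form of [arctan (tan phi / sqrt (1 - d))]. *)
Lemma arctan_prim_derive d p : 0 <= d < 1 ->
  is_derive (fun p => / sqrt (1 - d) * (p + atan ((1 - sqrt (1 - d)) * (sin p * cos p)
    / (sqrt (1 - d) * cos p ^ 2 + sin p ^ 2)))) p (/ (1 - d * cos p ^ 2)).
Proof.
intros Hd.
assert (Hq : 0 < sqrt (1 - d)) by (apply sqrt_lt_R0; lra).
assert (Eq : sqrt (1 - d) * sqrt (1 - d) = 1 - d) by (apply sqrt_sqrt; lra).
set (q := sqrt (1 - d)) in *. clearbody q.
assert (Q1 : q <= 1) by nra.
assert (HS : sin p ^ 2 = 1 - cos p ^ 2).
{ pose proof (sin2_cos2 p) as E. unfold Rsqr in E. simpl. lra. }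
pose proof (sin_sqr_bound p) as HB.
assert (Hv : 0 < q * cos p ^ 2 + sin p ^ 2) by (rewrite HS in *; nra).
assert (Hw : 0 < 1 - d * cos p ^ 2) by (rewrite HS in *; nra).
assert (HD : is_derive (fun p => (1 - q) * (sin p * cos p) / (q * cos p ^ 2 + sin p ^ 2)) p
  ((1 - q) * (q * cos p ^ 2 - sin p ^ 2) / (q * cos p ^ 2 + sin p ^ 2) ^ 2)).
{ replace ((1 - q) * (q * cos p ^ 2 - sin p ^ 2) / (q * cos p ^ 2 + sin p ^ 2) ^ 2) with
    ((((1 - q) * (cos p * cos p - sin p * sin p)) * (q * cos p ^ 2 + sin p ^ 2)
      - ((1 - q) * (sin p * cos p)) * (q * (2 * - sin p * cos p) + 2 * cos p * sin p))
     / (q * cos p ^ 2 + sin p ^ 2) ^ 2).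
  - apply (is_derive_div (fun p => (1 - q) * (sin p * cos p)) (fun p => q * cos p ^ 2 + sin p ^ 2)).
    + auto_derive; auto; ring.
    + auto_derive; auto; ring.
    + lra.
  - f_equal.
    match goal with |- ?l = _ => replace l with
      ((1 - q) * ((cos p ^ 2 - sin p ^ 2) * (q * cos p ^ 2 + sin p ^ 2)
        - 2 * (1 - q) * (sin p ^ 2 * cos p ^ 2))) by ring end.
    rewrite HS. ring. }
assert (DA : is_derive (fun p => atan ((1 - q) * (sin p * cos p) / (q * cos p ^ 2 + sin p ^ 2))) p
  ((1 - q) * (q * cos p ^ 2 - sin p ^ 2) / (q * cos p ^ 2 + sin p ^ 2) ^ 2 *
   / (1 + ((1 - q) * (sin p * cos p) / (q * cos p ^ 2 + sin p ^ 2)) ^ 2))).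
{ apply (is_derive_comp atan); [|exact HD].
  apply is_derive_Reals. apply derivable_pt_lim_atan. }
replace (/ (1 - d * cos p ^ 2)) with (/ q * (1 + (1 - q) * (q * cos p ^ 2 - sin p ^ 2) / (q * cos p ^ 2 + sin p ^ 2) ^ 2 *
   / (1 + ((1 - q) * (sin p * cos p) / (q * cos p ^ 2 + sin p ^ 2)) ^ 2))).
{ apply is_derive_scal.
  apply (is_derive_plus (fun p => p)
    (fun p => atan ((1 - q) * (sin p * cos p) / (q * cos p ^ 2 + sin p ^ 2))) p 1);
    [apply (is_derive_id (K := R_AbsRing))|exact DA]. }
set (v := q * cos p ^ 2 + sin p ^ 2) in *.
assert (E : v ^ 2 + ((1 - q) * (sin p * cos p)) ^ 2 = 1 - d * cos p ^ 2).
{ replace (((1 - q) * (sin p * cos p)) ^ 2) with ((1 - q) ^ 2 * (sin p ^ 2 * cos p ^ 2)) by ring.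
  unfold v. rewrite HS. replace d with (1 - q * q) by lra. ring. }
assert (E2 : / (1 + ((1 - q) * (sin p * cos p) / v) ^ 2) = v ^ 2 / (1 - d * cos p ^ 2)).
{ rewrite <- E. field. split; [|lra]. rewrite E. lra. }
rewrite E2.
replace ((1 - q) * (q * cos p ^ 2 - sin p ^ 2) / v ^ 2 * (v ^ 2 / (1 - d * cos p ^ 2)))
  with ((1 - q) * (q * cos p ^ 2 - sin p ^ 2) / (1 - d * cos p ^ 2)) by (field; lra).
rewrite HS. replace d with (1 - q * q) in * by lra. field. split; [|lra].
simpl in Hw; simpl; lra.
Qed.

(** At multiples of [PI / 2] the product [sin * cos] vanishes and with it the arctangent correction;
    only the linear part of the primitive contributes. *)
Lemma RInt_inv_cos d n : 0 <= d < 1 ->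
  RInt (fun p => / (1 - d * cos p ^ 2)) 0 (INR n * (PI / 2)) = INR n * (PI / 2) / sqrt (1 - d).
Proof.
intros Hd.
assert (Hq : 0 < sqrt (1 - d)) by (apply sqrt_lt_R0; lra).
rewrite (RInt_FTC _ _ _ _ (fun p => arctan_prim_derive d p Hd)).
- assert (Z : sin (INR n * (PI / 2)) * cos (INR n * (PI / 2)) = 0).
  { assert (E : sin (2 * (INR n * (PI / 2))) = 0).
    { replace (2 * (INR n * (PI / 2))) with (IZR (Z.of_nat n) * PI) by (rewrite <- INR_IZR_INZ; field).
      apply sin_eq_0_1. now exists (Z.of_nat n). }
    rewrite sin_2a in E. lra. }
  rewrite Z, sin_0. unfold Rdiv. rewrite !Rmult_0_l, !Rmult_0_r, !Rmult_0_l, atan_0. rring.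
- pose proof cont_cos. apply cont_inv; [cts|].
  intros p. pose proof (sin_sqr_bound p). pose proof (sin2_cos2 p) as E. unfold Rsqr in E. simpl in *. nra.
Qed.

(** A primitive of [cos ^ 2 / (1 - d cos ^ 2) ^ 2], which is the nonconstant part of
    [wpot (d cos ^ 2)] up to the factor [8 d]. The derivative of [sin cos / (1 - d cos ^ 2)] plus
    [/ (1 - d cos ^ 2)] is [2 (1 - d)] times this function. *)
Definition cos_prim (d p : R) : R :=
  / (2 * (1 - d)) * (/ sqrt (1 - d) * (p + atan ((1 - sqrt (1 - d)) * (sin p * cos p)
    / (sqrt (1 - d) * cos p ^ 2 + sin p ^ 2))) + sin p * cos p / (1 - d * cos p ^ 2)).

Lemma one_minus_cos_pos d p : 0 <= d < 1 -> 0 < 1 - d * cos p ^ 2.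
Proof.
intros Hd. pose proof (sin_sqr_bound p). pose proof (sin2_cos2 p) as E. unfold Rsqr in E.
simpl in *. nra.
Qed.

Lemma cos_prim_derive d p : 0 <= d < 1 ->
  is_derive (cos_prim d) p (cos p ^ 2 / (1 - d * cos p ^ 2) ^ 2).
Proof.
intros Hd. pose proof (one_minus_cos_pos d p Hd) as Hw.
assert (HS : sin p ^ 2 = 1 - cos p ^ 2).
{ pose proof (sin2_cos2 p) as E. unfold Rsqr in E. simpl. lra. }
unfold cos_prim.
replace (cos p ^ 2 / (1 - d * cos p ^ 2) ^ 2) with
  (/ (2 * (1 - d)) * (/ (1 - d * cos p ^ 2) + ((2 - d) * cos p ^ 2 - 1) / (1 - d * cos p ^ 2) ^ 2)).
- apply is_derive_scal.
  apply (is_derive_plus (fun p => / sqrt (1 - d) * (p + atan ((1 - sqrt (1 - d)) * (sin p * cos p)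
    / (sqrt (1 - d) * cos p ^ 2 + sin p ^ 2)))) (fun p => sin p * cos p / (1 - d * cos p ^ 2))).
  + now apply arctan_prim_derive.
  + replace (((2 - d) * cos p ^ 2 - 1) / (1 - d * cos p ^ 2) ^ 2) with
      (((cos p * cos p - sin p * sin p) * (1 - d * cos p ^ 2)
        - (sin p * cos p) * (- (d * (2 * - sin p * cos p)))) / (1 - d * cos p ^ 2) ^ 2).
    * apply (is_derive_div (fun p => sin p * cos p) (fun p => 1 - d * cos p ^ 2)).
      -- auto_derive; auto; ring.
      -- auto_derive; auto; ring.
      -- lra.
    * f_equal.
      match goal with |- ?l = _ => replace l with
        ((cos p ^ 2 - sin p ^ 2) * (1 - d * cos p ^ 2) - 2 * d * (sin p ^ 2 * cos p ^ 2)) by ring end.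
      rewrite HS. ring.
- field. split; [simpl in *; lra|lra].
Qed.

Lemma cos_prim_PI d : 0 <= d < 1 ->
  cos_prim d PI - cos_prim d 0 = PI / 2 / ((1 - d) * sqrt (1 - d)).
Proof.
intros Hd. assert (Hq : 0 < sqrt (1 - d)) by (apply sqrt_lt_R0; lra).
unfold cos_prim. rewrite sin_PI, sin_0. unfold Rdiv.
rewrite !Rmult_0_l, !Rmult_0_r, !Rmult_0_l, atan_0. field. lra.
Qed.

(** Sized for the polynomial of [wpot_poly]: a constant term and five powers of [w]. *)
Definition comb6 (c0 c1 c2 c3 c4 c5 : R) (f : nat -> R -> R) (x : R) : R :=
  c0 * f 0%nat x + c1 * f 1%nat x + c2 * f 2%nat x + c3 * f 3%nat x + c4 * f 4%nat x + c5 * f 5%nat x.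

Lemma comb6_cont c0 c1 c2 c3 c4 c5 f : (forall i, cont (f i)) -> cont (comb6 c0 c1 c2 c3 c4 c5 f).
Proof.
intros Hf. assert (C : forall c i, cont (fun x => c * f i x)).
{ intros c i. apply cont_mult; [apply cont_const|apply Hf]. }
unfold comb6. pose proof (C c0 0%nat). pose proof (C c1 1%nat). pose proof (C c2 2%nat).
pose proof (C c3 3%nat). pose proof (C c4 4%nat). pose proof (C c5 5%nat).
apply (cont_plus (fun x => c0 * f 0%nat x + c1 * f 1%nat x + c2 * f 2%nat x + c3 * f 3%nat x
  + c4 * f 4%nat x)); [|assumption].
apply (cont_plus (fun x => c0 * f 0%nat x + c1 * f 1%nat x + c2 * f 2%nat x + c3 * f 3%nat x));
  [|assumption].
apply (cont_plus (fun x => c0 * f 0%nat x + c1 * f 1%nat x + c2 * f 2%nat x)); [|assumption].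
apply (cont_plus (fun x => c0 * f 0%nat x + c1 * f 1%nat x)); [|assumption].
now apply (cont_plus (fun x => c0 * f 0%nat x)).
Qed.

Lemma RInt_comb6 c0 c1 c2 c3 c4 c5 f a b : (forall i, cont (f i)) ->
  RInt (comb6 c0 c1 c2 c3 c4 c5 f) a b = c0 * RInt (f 0%nat) a b + c1 * RInt (f 1%nat) a b
    + c2 * RInt (f 2%nat) a b + c3 * RInt (f 3%nat) a b + c4 * RInt (f 4%nat) a b
    + c5 * RInt (f 5%nat) a b.
Proof.
intros Hf. assert (C : forall c i, cont (fun x => c * f i x)).
{ intros c i. apply cont_mult; [apply cont_const|apply Hf]. }
assert (S : forall g c i, cont g -> RInt (fun x => g x + c * f i x) a b = RInt g a b + c * RInt (f i) a b).
{ intros g c i Hg. rewrite RInt_cplus, RInt_cscal by auto. reflexivity. }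
pose proof (C c0 0%nat). unfold comb6.
assert (C1 := cont_plus _ _ (C c0 0%nat) (C c1 1%nat)).
assert (C2 := cont_plus _ _ C1 (C c2 2%nat)).
assert (C3 := cont_plus _ _ C2 (C c3 3%nat)).
assert (C4 := cont_plus _ _ C3 (C c4 4%nat)).
rewrite (S _ c5 5%nat C4), (S _ c4 4%nat C3), (S _ c3 3%nat C2), (S _ c2 2%nat C1), (S _ c1 1%nat (C c0 0%nat)).
now rewrite RInt_cscal.
Qed.

(** * Lower bounds for the potential energy *)

Section Potential.

Variables (H k kb al be t st : R) (F : R -> R -> R).
Hypothesis HH : 0 < H.
Hypothesis Hk : 0 < k < 1.
Hypothesis Hkb : 0 < kb < 1.
Hypothesis Hal : 0 < al.
Hypothesis Hbe : 0 < be.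
Hypothesis Ht : 0 < t < 1.
Hypothesis Hst : st ^ 2 = t.

Let a : R := 2 * ellK k / al.
Let b : R := 2 * ellK kb / be.
Let cx (x : R) : R := jacobi_cn k (al * x).
Let cy (y : R) : R := jacobi_cn kb (be * y).

Hypothesis HF : forall x y, tanh (F x y / 4) = st * cx x * cy y.

Lemma apos : 0 < a. Proof. now apply half_period_pos. Qed.
Lemma bpos : 0 < b. Proof. now apply half_period_pos. Qed.
Lemma cx_b x : 0 <= cx x ^ 2 <= 1. Proof. exact (cn_sqr_bounds k al x). Qed.
Lemma cy_b y : 0 <= cy y ^ 2 <= 1. Proof. exact (cn_sqr_bounds kb be y). Qed.
Lemma cx_cont : cont cx. Proof. exact (cn_cont k al Hk). Qed.
Lemma cy_cont : cont cy. Proof. exact (cn_cont kb be Hkb). Qed.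

Lemma F_eq x y : F x y = 2 * (ln (1 + st * cx x * cy y) - ln (1 - st * cx x * cy y)).
Proof. exact (ln_of_tanh _ _ (HF x y)). Qed.

Lemma F_arg_bound x y : -1 < st * cx x * cy y < 1.
Proof. destruct (exp_of_tanh _ _ (HF x y)) as [Hs E]. split; nra. Qed.

Lemma F_cont2 : cont2 F.
Proof.
replace F with (fun x y => 2 * (ln (1 + st * cx x * cy y) - ln (1 - st * cx x * cy y)))
  by (apply fun2_ext; intros; now rewrite F_eq).
pose proof (lift_x cx cx_cont). pose proof (lift_y cy cy_cont).
assert (C : cont2 (fun x y => st * cx x * cy y)) by cts2.
apply cont2_mult; [apply cont2_const|].
apply (cont2_minus (fun x y => ln (1 + st * cx x * cy y)) (fun x y => ln (1 - st * cx x * cy y)));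
  apply cont2_ln; try (intros; pose proof (F_arg_bound x y); lra).
- apply (cont2_plus (fun _ _ => 1)); [apply cont2_const|exact C].
- apply (cont2_minus (fun _ _ => 1)); [apply cont2_const|exact C].
Qed.

Lemma pot_eq x y : pot H F x y = 4 * H * wpot (t * cx x ^ 2 * cy y ^ 2).
Proof.
unfold pot. rewrite (cosh_of_tanh _ _ (HF x y)). unfold wpot.
replace ((st * cx x * cy y) ^ 2) with (t * cx x ^ 2 * cy y ^ 2) by (rewrite <- Hst; ring).
reflexivity.
Qed.

Lemma w_b x y : 0 <= t * cx x ^ 2 * cy y ^ 2 < 1.
Proof.
pose proof (cx_b x). pose proof (cy_b y).
assert (0 <= cx x ^ 2 * cy y ^ 2 <= 1) by nra. nra.
Qed.

Lemma pot_x x y : pot H F (x + a) y = pot H F x y.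
Proof.
rewrite !pot_eq. unfold cx, a. rewrite cn_shift by assumption.
do 3 f_equal. ring.
Qed.

Lemma pot_y x y : pot H F x (y + b) = pot H F x y.
Proof.
rewrite !pot_eq. unfold cy, b. rewrite cn_shift by assumption.
do 2 f_equal. ring.
Qed.

Lemma pot_yo x y : pot H F x (- y) = pot H F x y.
Proof. rewrite !pot_eq. unfold cy. now rewrite cn_even. Qed.

(** For fixed [y] the potential increases with [cx x ^ 2], so it inherits the sign pattern of
    [cn_sqr_corr]. *)
Lemma pot_corr x y : 0 <= cos (2 * PI / a * x) * (pot H F x y - pot H F (a / 4) y).
Proof.
rewrite !pot_eq. pose proof (cy_b y) as Hc.
assert (M : forall u v, cx u ^ 2 <= cx v ^ 2 ->
  wpot (t * cx u ^ 2 * cy y ^ 2) <= wpot (t * cx v ^ 2 * cy y ^ 2)).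
{ intros u v Huv. apply wpot_incr; [|apply w_b]. split; [apply w_b|].
  apply Rmult_le_compat_r; [lra|]. apply Rmult_le_compat_l; lra. }
destruct (cn_sqr_corr k al Hk Hal x) as [[C1 C2]|[C1 C2]]; fold a in C1, C2.
- apply Rmult_le_pos; [exact C1|]. pose proof (M (a / 4) x C2). nra.
- pose proof (M x (a / 4) C2).
  replace (cos (2 * PI / a * x) * (4 * H * wpot (t * cx x ^ 2 * cy y ^ 2)
    - 4 * H * wpot (t * cx (a / 4) ^ 2 * cy y ^ 2))) with
   ((- cos (2 * PI / a * x)) * (4 * H * (wpot (t * cx (a / 4) ^ 2 * cy y ^ 2)
     - wpot (t * cx x ^ 2 * cy y ^ 2)))) by ring.
  apply Rmult_le_pos; [lra|]. nra.
Qed.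

Let vi (g : R -> R) : R -> R := vint H b F g.

Lemma pot_cont2 : cont2 (pot H F).
Proof. apply pot_cont, F_cont2. Qed.

Lemma vi_cont g : cont g -> cont (vi g).
Proof. apply vint_cont, F_cont2. Qed.

Definition ymom (g : R -> R) (i : nat) : R := RInt (fun y => cy y ^ (2 * i) * g y ^ 2) 0 (2 * b).

Lemma ymom_pos g i : cont g -> 0 <= ymom g i.
Proof.
intros Hg. pose proof cy_cont. pose proof bpos. apply RInt_cge0; [lra|cts|].
intros y. rewrite pow_mult. apply Rmult_le_pos; [apply pow_le|]; apply pow2_ge_0.
Qed.

(** The series in [w] is truncated and the x-moments are replaced by Wallis integrals, while the
    y-moments stay exact because the closing condition will express them through [v]. *)
Lemma vint_poly g : cont g ->
  4 * H * (a * ymom g 0 + 8 / al * (t * wallis 1 * ymom g 1 + 2 * t ^ 2 * wallis 2 * ymom g 2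
    + 3 * t ^ 3 * wallis 3 * ymom g 3 + 4 * t ^ 4 * wallis 4 * ymom g 4
    + 5 * t ^ 5 * wallis 5 * ymom g 5)) <= RInt (vi g) 0 a.
Proof.
intros Hg. pose proof cy_cont as Cy. pose proof cx_cont as Cx. pose proof apos as Ha. pose proof bpos as Hb.
assert (Cv := vi_cont g Hg).
assert (Cm : forall i, cont (fun y => cy y ^ (2 * i) * g y ^ 2)) by (intros; cts).
set (P := comb6 (4 * H * ymom g 0) (32 * H * t * ymom g 1) (64 * H * t ^ 2 * ymom g 2)
  (96 * H * t ^ 3 * ymom g 3) (128 * H * t ^ 4 * ymom g 4) (160 * H * t ^ 5 * ymom g 5)
  (fun i x => cx x ^ (2 * i))).
assert (L : forall x, P x <= vi g x).
{ intros x. unfold vi, vint.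
  set (Qf := comb6 (4 * H) (32 * H * t * cx x ^ (2 * 1)) (64 * H * t ^ 2 * cx x ^ (2 * 2))
    (96 * H * t ^ 3 * cx x ^ (2 * 3)) (128 * H * t ^ 4 * cx x ^ (2 * 4))
    (160 * H * t ^ 5 * cx x ^ (2 * 5)) (fun i y => cy y ^ (2 * i) * g y ^ 2)).
  apply Rle_trans with (RInt Qf 0 (2 * b)).
  - right. unfold Qf. rewrite RInt_comb6 by exact Cm. fold (ymom g 0) (ymom g 1) (ymom g 2) (ymom g 3)
      (ymom g 4) (ymom g 5). unfold P, comb6. simpl (cx x ^ (2 * 0)). ring.
  - pose proof (cont2_slice _ x pot_cont2) as Cp.
    apply RInt_cle; [lra|now apply comb6_cont|cts|].
    intros y. rewrite pot_eq. pose proof (wpot_poly _ (w_b x y)) as W.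
    pose proof (pow2_ge_0 (g y)) as G2.
    apply Rle_trans with (4 * H * (1 + 8 * (t * cx x ^ 2 * cy y ^ 2 + 2 * (t * cx x ^ 2 * cy y ^ 2) ^ 2
      + 3 * (t * cx x ^ 2 * cy y ^ 2) ^ 3 + 4 * (t * cx x ^ 2 * cy y ^ 2) ^ 4
      + 5 * (t * cx x ^ 2 * cy y ^ 2) ^ 5)) * g y ^ 2).
    + right. unfold Qf, comb6. simpl Nat.mul. ring.
    + apply Rmult_le_compat_r; [exact G2|]. apply Rmult_le_compat_l; lra. }
assert (Cc : forall i, cont (fun x => cx x ^ (2 * i))) by (intros; cts).
assert (CP : cont P) by now apply comb6_cont.
apply Rle_trans with (RInt P 0 a); [|apply RInt_cle; auto; lra].
unfold P. rewrite RInt_comb6 by exact Cc.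
rewrite (RInt_cext (fun x => cx x ^ (2 * 0)) (fun _ => 1)), RInt_cconst by reflexivity.
assert (X : forall i, wallis i / al <= RInt (fun x => cx x ^ (2 * i)) 0 a).
{ intros i. pose proof (cn_moment_lower k al Hk Hal i) as E.
  apply (Rmult_le_reg_l al); [exact Hal|].
  replace (al * (wallis i / al)) with (wallis i) by (field; lra). exact E. }
assert (Y : forall c i, 0 <= c -> c * ymom g i * (wallis i / al) <=
   c * ymom g i * RInt (fun x => cx x ^ (2 * i)) 0 a).
{ intros c i Hc. apply Rmult_le_compat_l; [|apply X].
  apply Rmult_le_pos; [exact Hc|now apply ymom_pos]. }
assert (HT : forall i, 0 <= t ^ i) by (intros; apply pow_le; lra).
pose proof (Y (32 * H * t) 1%nat ltac:(nra)).
pose proof (Y (64 * H * t ^ 2) 2%nat ltac:(pose proof (HT 2%nat); nra)).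
pose proof (Y (96 * H * t ^ 3) 3%nat ltac:(pose proof (HT 3%nat); nra)).
pose proof (Y (128 * H * t ^ 4) 4%nat ltac:(pose proof (HT 4%nat); nra)).
pose proof (Y (160 * H * t ^ 5) 5%nat ltac:(pose proof (HT 5%nat); nra)).
match goal with |- ?l <= _ => replace l with (4 * H * ymom g 0 * ((a - 0) * 1)
  + 32 * H * t * ymom g 1 * (wallis 1 / al) + 64 * H * t ^ 2 * ymom g 2 * (wallis 2 / al)
  + 96 * H * t ^ 3 * ymom g 3 * (wallis 3 / al) + 128 * H * t ^ 4 * ymom g 4 * (wallis 4 / al)
  + 160 * H * t ^ 5 * ymom g 5 * (wallis 5 / al)) by (field; lra) end.
lra.
Qed.

(** No truncation here, so the singularity at [t = 1] survives. With [d = t * cx x ^ 2] the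
    y-integral yields [(PI / 2) sqrt (1 - d) / (1 - d) ^ 2]. Weakening [sqrt (1 - d)] to
    [sqrt (1 - t)] leaves a function of [x] that [cos_prim] integrates once more. *)
Lemma vint_full_x x : 4 * H * (2 * b + 8 * PI / be * sqrt (1 - t) *
   (t * (cx x ^ 2 / (1 - t * cx x ^ 2) ^ 2))) <= vi (fun _ => 1) x.
Proof.
pose proof bpos as Hb. pose proof cy_cont as Cy. pose proof PI_RGT_0 as Hpi.
set (d := t * cx x ^ 2). pose proof (cx_b x) as Hc.
assert (Hd : 0 <= d <= t) by (unfold d; nra).
assert (Hd1 : 0 <= d < 1) by lra.
set (f := fun p => cos p ^ 2 / (1 - d * cos p ^ 2) ^ 2).
assert (Cf : cont f).
{ pose proof cont_cos. unfold f, Rdiv. apply cont_mult; [cts|]. apply cont_inv; [cts|].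
  intros p. apply Rgt_not_eq, pow2_gt_0, Rgt_not_eq. now apply one_minus_cos_pos. }
assert (Cfa : cont (fun y => f (jacobi_am kb (be * y)))).
{ pose proof (cont_am kb Hkb). cts. }
assert (E := RInt_am_lower kb be Hkb Hbe f (cos_prim d) Cf).
fold b in E. rewrite cos_prim_PI in E by exact Hd1.
assert (E2 : PI / 2 / ((1 - d) * sqrt (1 - d)) <= be * RInt (fun y => f (jacobi_am kb (be * y))) 0 b).
{ apply E.
  - intros p. unfold f. apply Rmult_le_pos; [apply pow2_ge_0|].
    left. apply Rinv_0_lt_compat, pow2_gt_0, Rgt_not_eq. now apply one_minus_cos_pos.
  - intros p. now apply cos_prim_derive. }
assert (EP : RInt (fun y => f (jacobi_am kb (be * y))) 0 (2 * b) =
  2 * RInt (fun y => f (jacobi_am kb (be * y))) 0 b).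
{ replace 2 with (INR 2) by reflexivity. apply RInt_period_INR; auto.
  intros y. unfold f. pose proof (cn_shift kb be Hkb Hbe y) as S. unfold jacobi_cn in S.
  fold b in S. rewrite S. f_equal; [ring|]. f_equal. f_equal. ring. }
assert (EV : vi (fun _ => 1) x = 4 * H * (2 * b + 8 * d * (2 * RInt (fun y => f (jacobi_am kb (be * y))) 0 b))).
{ unfold vi, vint. rewrite <- EP.
  rewrite (RInt_cext _ (fun y => 4 * H + 32 * H * d * f (jacobi_am kb (be * y)))).
  - rewrite RInt_cplus, RInt_cconst, RInt_cscal by cts. rring.
  - intros y. rewrite pot_eq. unfold wpot, f. fold d. fold (jacobi_cn kb (be * y)). fold (cy y).
    field. pose proof (one_minus_cos_pos d (jacobi_am kb (be * y)) Hd1) as P.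
    fold (jacobi_cn kb (be * y)) in P. fold (cy y) in P. lra. }
rewrite EV. apply Rmult_le_compat_l; [lra|]. apply Rplus_le_compat_l.
set (J := RInt (fun y => f (jacobi_am kb (be * y))) 0 b) in *.
assert (Hq : 0 < sqrt (1 - d)) by (apply sqrt_lt_R0; lra).
assert (Hqt : sqrt (1 - t) <= sqrt (1 - d)) by (apply sqrt_le_1_alt; lra).
assert (Eq : sqrt (1 - d) * sqrt (1 - d) = 1 - d) by (apply sqrt_sqrt; lra).
assert (EJ : PI / 2 * sqrt (1 - t) / (1 - d) ^ 2 <= be * J).
{ eapply Rle_trans; [|exact E2].
  replace (PI / 2 / ((1 - d) * sqrt (1 - d))) with (PI / 2 * sqrt (1 - d) / (1 - d) ^ 2).
  - unfold Rdiv at 1 3. apply Rmult_le_compat_r; [left; apply Rinv_0_lt_compat; apply pow2_gt_0; lra|].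
    apply Rmult_le_compat_l; lra.
  - replace ((1 - d) ^ 2) with ((1 - d) * (sqrt (1 - d) * sqrt (1 - d))) by (rewrite Eq; ring).
    field. lra. }
replace (t * (cx x ^ 2 / (1 - d) ^ 2)) with (d / (1 - d) ^ 2) by (unfold d; field; fold d; lra).
apply Rle_trans with (16 * d * (PI / 2 * sqrt (1 - t) / (1 - d) ^ 2) / be).
- right. field. lra.
- replace (8 * d * (2 * J)) with (16 * d * (be * J) / be) by (field; lra).
  unfold Rdiv at 1 4. apply Rmult_le_compat_r; [left; now apply Rinv_0_lt_compat|].
  apply Rmult_le_compat_l; lra.
Qed.

(** The x-integral contributes [(1 - t) ^ (-3/2)], and the [sqrt (1 - t)] kept from the y-integral
    cancels its half power, leaving the rational term [t / (1 - t)]. *)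
Lemma vint_full : 4 * H * (a * (2 * b) * (1 + 2 * (PI / (al * a)) * (PI / (be * b)) * (t / (1 - t))))
  <= RInt (vi (fun _ => 1)) 0 a.
Proof.
pose proof apos as Ha. pose proof bpos as Hb. pose proof cx_cont as Cx.
assert (Cv := vi_cont _ (cont_const 1)).
assert (Hq : 0 < sqrt (1 - t)) by (apply sqrt_lt_R0; lra).
assert (Eq : sqrt (1 - t) * sqrt (1 - t) = 1 - t) by (apply sqrt_sqrt; lra).
assert (Ht' : 0 <= t < 1) by lra.
set (f := fun p => cos p ^ 2 / (1 - t * cos p ^ 2) ^ 2).
assert (Cf : cont f).
{ pose proof cont_cos. unfold f, Rdiv. apply cont_mult; [cts|]. apply cont_inv; [cts|].
  intros p. apply Rgt_not_eq, pow2_gt_0, Rgt_not_eq. now apply one_minus_cos_pos. }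
assert (E := RInt_am_lower k al Hk Hal f (cos_prim t) Cf).
fold a in E. rewrite cos_prim_PI in E by exact Ht'.
assert (E2 : PI / 2 / ((1 - t) * sqrt (1 - t)) <= al * RInt (fun x => f (jacobi_am k (al * x))) 0 a).
{ apply E.
  - intros p. unfold f. apply Rmult_le_pos; [apply pow2_ge_0|].
    left. apply Rinv_0_lt_compat, pow2_gt_0, Rgt_not_eq. now apply one_minus_cos_pos.
  - intros p. now apply cos_prim_derive. }
assert (Cfa : cont (fun x => f (jacobi_am k (al * x)))).
{ pose proof (cont_am k Hk). cts. }
set (J := RInt (fun x => f (jacobi_am k (al * x))) 0 a) in *.
apply Rle_trans with (RInt (fun x => 4 * H * (2 * b) +
  4 * H * (8 * PI / be * sqrt (1 - t) * t) * f (jacobi_am k (al * x))) 0 a).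
- rewrite RInt_cplus, RInt_cconst, RInt_cscal by cts. fold J.
  assert (EJ : PI / 2 / ((1 - t) * sqrt (1 - t)) / al <= J).
  { apply (Rmult_le_reg_l al); [exact Hal|].
    replace (al * (PI / 2 / ((1 - t) * sqrt (1 - t)) / al)) with (PI / 2 / ((1 - t) * sqrt (1 - t)))
      by (field; lra). exact E2. }
  apply Rle_trans with ((a - 0) * (4 * H * (2 * b)) +
    4 * H * (8 * PI / be * sqrt (1 - t) * t) * (PI / 2 / ((1 - t) * sqrt (1 - t)) / al)).
  + right. field. repeat split; lra.
  + apply Rplus_le_compat_l. apply Rmult_le_compat_l; [|exact EJ].
    assert (0 < 8 * PI / be) by (apply Rdiv_lt_0_compat; [pose proof PI_RGT_0|]; lra).
    apply Rmult_le_pos; [lra|]. apply Rmult_le_pos; [apply Rmult_le_pos; lra|lra].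
- apply RInt_cle; [lra|cts|cts|].
  intros x. pose proof (vint_full_x x) as V. unfold f.
  fold (jacobi_cn k (al * x)). fold (cx x). lra.
Qed.

(** Chebyshev's correlation inequality: [pot H F x] is an increasing function of [cy ^ 2], so the
    two have nonnegative covariance in [y]. The subtracted [V] is the potential at [cy ^ 2 = c1]; it
    makes the integrand pointwise nonnegative and costs nothing because [cy ^ 2 - c1] has mean
    zero. *)
Lemma cheb c1 : 0 <= c1 <= 1 -> ymom (fun _ => 1) 1 = c1 * ymom (fun _ => 1) 0 ->
  c1 * RInt (vi (fun _ => 1)) 0 a <= RInt (vi cy) 0 a.
Proof.
intros H1 Hc. pose proof apos as Ha. pose proof bpos as Hb.
assert (C1 := vi_cont _ (cont_const 1)). assert (C2 := vi_cont _ cy_cont).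
pose proof cy_cont as Cy.
rewrite <- RInt_cscal by assumption. apply RInt_cle; [lra|cts|assumption|].
intros x. pose proof (cont2_slice _ x pot_cont2) as Cp.
set (V := 4 * H * wpot (t * cx x ^ 2 * c1)).
enough (0 <= RInt (fun y => (pot H F x y - V) * (cy y ^ 2 - c1)) 0 (2 * b)) as E.
{ rewrite (RInt_cext _ (fun y => pot H F x y * cy y ^ 2 + (- c1) * (pot H F x y * 1 ^ 2)
    + ((- V) * (cy y ^ (2 * 1) * 1 ^ 2) + (V * c1) * (cy y ^ (2 * 0) * 1 ^ 2)))) in E
    by (intros; simpl; ring).
  rewrite !RInt_cplus, !RInt_cscal in E by cts.
  change (0 <= vi cy x + - c1 * vi (fun _ => 1) x + (- V * ymom (fun _ => 1) 1 + V * c1 * ymom (fun _ => 1) 0)) in E.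
  rewrite Hc in E. lra. }
apply RInt_cge0; [lra|cts|].
intros y. rewrite pot_eq. unfold V. pose proof (cx_b x) as Hx. pose proof (cy_b y) as Hy.
assert (M : forall u v, 0 <= u <= v -> v <= 1 -> wpot (t * cx x ^ 2 * u) <= wpot (t * cx x ^ 2 * v)).
{ intros u v Hu Hv. assert (0 <= t * cx x ^ 2 < 1) by nra. apply wpot_incr; [nra|nra]. }
destruct (Rle_dec c1 (cy y ^ 2)) as [h|h].
- pose proof (M c1 (cy y ^ 2) ltac:(lra) ltac:(lra)). apply Rmult_le_pos; nra.
- pose proof (M (cy y ^ 2) c1 ltac:(lra) ltac:(lra)).
  set (A := wpot (t * cx x ^ 2 * cy y ^ 2)) in *. set (B := wpot (t * cx x ^ 2 * c1)) in *.
  replace ((4 * H * A - 4 * H * B) * (cy y ^ 2 - c1)) with (4 * H * ((B - A) * (c1 - cy y ^ 2))) by ring.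
  apply Rmult_le_pos; [lra|]. apply Rmult_le_pos; lra.
Qed.

End Potential.

(** * The period conditions *)

Section Closing.

Variables (H k kb al be t st : R) (F : R -> R -> R) (X Nu : R3map).
Hypothesis HH : 0 < H.
Hypothesis Hk : 0 < k < 1.
Hypothesis Hkb : 0 < kb < 1.
Hypothesis Hal : 0 < al.
Hypothesis Hbe : 0 < be.
(** A consequence of the formulas for [alpha] and [alphab]. It gives [Dx F] on the nodal line the
    amplitude [4 * (kb * be)], for which the rotation angle below is elementary in [sn]. *)
Hypothesis Hrel : st * al * sqrt (1 - k ^ 2) = kb * be.
Hypothesis HF : forall x y,
  tanh (F x y / 4) = st * jacobi_cn k (al * x) * jacobi_cn kb (be * y).
Hypothesis HX : is_wente_immersion H F X Nu.

Let b : R := 2 * ellK kb / be.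
Let x0 : R := ellK k / al.

Hypothesis Hclose : forall j x y, X j x (y + 2 * b) = X j x y.

Lemma cn_x0 : jacobi_cn k (al * x0) = 0.
Proof.
unfold x0. replace (al * (ellK k / al)) with (ellK k) by (field; lra).
unfold jacobi_cn. now rewrite jacobi_am_K, cos_PI2.
Qed.

Lemma F_x0 y : F x0 y = 0.
Proof.
rewrite (ln_of_tanh _ _ (HF x0 y)), cn_x0.
rewrite Rmult_0_r, Rmult_0_l, Rplus_0_r, Rminus_0_r. ring.
Qed.

Lemma Dy_F_x0 y : Dy F x0 y = 0.
Proof.
unfold Dy. rewrite (Derive_ext _ (fun _ => 0)) by apply F_x0. apply Derive_const.
Qed.

Lemma Dx_F_x0 y : Dx F x0 y = - 4 * (kb * be) * jacobi_cn kb (be * y).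
Proof.
unfold Dx. apply is_derive_unique.
set (c := jacobi_cn kb (be * y)).
apply (is_derive_ext (fun x => 2 * (ln (1 + st * jacobi_cn k (al * x) * c)
  - ln (1 - st * jacobi_cn k (al * x) * c)))).
{ intros x. symmetry. exact (ln_of_tanh _ _ (HF x y)). }
assert (D : is_derive (fun x => jacobi_cn k (al * x)) x0 (- (al * sqrt (1 - k ^ 2)))).
{ pose proof (cn_d k al Hk x0) as D.
  replace (al * sqrt (1 - k ^ 2)) with (al * (jacobi_sn k (al * x0) * jacobi_dn k (al * x0))).
  - exact D.
  - unfold x0. replace (al * (ellK k / al)) with (ellK k) by (field; lra).
    unfold jacobi_dn, jacobi_sn. rewrite jacobi_am_K, sin_PI2 by assumption.
    rewrite pow1, Rmult_1_r. ring. }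
set (u := fun x => jacobi_cn k (al * x)) in *.
assert (U0 : u x0 = 0) by apply cn_x0.
change (is_derive u x0 (- (al * sqrt (1 - k ^ 2)))) in D.
change (is_derive (fun x => 2 * (ln (1 + st * u x * c) - ln (1 - st * u x * c))) x0
  (- 4 * (kb * be) * c)).
clearbody u.
auto_derive.
- rewrite U0. repeat split; try lra; eexists; exact D.
- rewrite U0. replace (Derive _ x0) with (- (al * sqrt (1 - k ^ 2))) by
    (symmetry; apply is_derive_unique; exact D).
  rewrite <- Hrel. field.
Qed.

(** [co] and [si] are cosine and sine of the angle [-2 arcsin (kb sn)], whose derivative is [ps]
    because [sqrt (1 - kb ^ 2 sn ^ 2) = dn]. *)
Let co (y : R) : R := 1 - 2 * kb ^ 2 * jacobi_sn kb (be * y) ^ 2.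
Let si (y : R) : R := - (2 * kb) * (jacobi_sn kb (be * y) * jacobi_dn kb (be * y)).
Let ps (y : R) : R := - 2 * (kb * be) * jacobi_cn kb (be * y).

Lemma co_derive y : is_derive co y (- (ps y * si y)).
Proof.
pose proof (sn_d kb be Hkb y) as D.
replace (- (ps y * si y)) with
  (0 - 2 * kb ^ 2 * (INR 2 * (be * (jacobi_cn kb (be * y) * jacobi_dn kb (be * y)))
    * jacobi_sn kb (be * y) ^ pred 2)) by (unfold ps, si; simpl; ring).
apply (is_derive_minus (fun _ => 1) (fun y => 2 * kb ^ 2 * jacobi_sn kb (be * y) ^ 2)).
- apply is_derive_Reals, derivable_pt_lim_const.
- apply is_derive_scal. apply (is_derive_pow (fun y => jacobi_sn kb (be * y)) 2). exact D.
Qed.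

Lemma si_derive y : is_derive si y (ps y * co y).
Proof.
pose proof (sn_d kb be Hkb y) as D. pose proof (dn_d kb be Hkb y) as D2.
replace (ps y * co y) with
 (- (2 * kb) * (be * (jacobi_cn kb (be * y) * jacobi_dn kb (be * y)) * jacobi_dn kb (be * y)
  + jacobi_sn kb (be * y) * - (be * (kb ^ 2 * jacobi_sn kb (be * y) * jacobi_cn kb (be * y))))).
- apply is_derive_scal.
  apply (is_derive_Rmult (fun y => jacobi_sn kb (be * y)) (fun y => jacobi_dn kb (be * y)));
    [exact D|exact D2].
- unfold ps, co. pose proof (jacobi_dn_sqr kb (be * y) Hkb) as E.
  match goal with |- ?l = _ => replace l with (- (2 * kb) * be * jacobi_cn kb (be * y) *
    (jacobi_dn kb (be * y) ^ 2 - kb ^ 2 * jacobi_sn kb (be * y) ^ 2)) by ring end.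
  rewrite E. ring.
Qed.

Lemma co_si y : co y ^ 2 + si y ^ 2 = 1.
Proof.
pose proof (jacobi_dn_sqr kb (be * y) Hkb) as E. unfold co, si.
match goal with |- ?l = _ => replace l with ((1 - 2 * kb ^ 2 * jacobi_sn kb (be * y) ^ 2) ^ 2
  + 4 * kb ^ 2 * jacobi_sn kb (be * y) ^ 2 * jacobi_dn kb (be * y) ^ 2) by ring end.
rewrite E. ring.
Qed.

(** Here [n] is a real abscissa, the place of a vertical line, and not an order of
    differentiation. *)
Lemma smooth_derive u n : smooth u -> smooth (Dx u) /\ smooth (Dy u) /\
  (forall x y, ex_derive (fun z => u x z) y) /\ cont (fun y => u n y).
Proof.
intros Hu. repeat split.
- intros i x y. apply (Hu (S i) x y).
- intros i x y. apply (Hu (S i) x y).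
- intros x y. apply (Hu 1%nat x y).
- apply cont2_slice. intros x y. apply (Hu 0%nat x y).
Qed.

(* Along the line [x = x0], where [F = 0], the tangent vector rotates with
   angular velocity [Dx F / 2 = ps] in a fixed plane. *)
Lemma tangent_rotates j y :
  DY X j x0 y = DY X j x0 0 * co y - DX X j x0 0 * si y.
Proof.
destruct (smooth_derive (X j) 0 (X_smooth _ _ _ _ HX j)) as [Sx [Sy _]].
destruct (smooth_derive _ 0 Sx) as [_ [_ [Ex _]]].
destruct (smooth_derive _ 0 Sy) as [_ [_ [Ey _]]].
set (T := fun y => DY X j x0 y). set (S := fun y => DX X j x0 y).
assert (DT : forall y, is_derive T y (- ps y * S y)).
{ intros z. replace (- ps z * S z) with (DY (DY X) j x0 z).
  - apply (Derive_correct (fun z => Dy (X j) x0 z)). apply Ey.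
  - rewrite (X_yy _ _ _ _ HX), Dy_F_x0, Dx_F_x0, F_x0, exp_0. unfold S, ps. lra. }
assert (DS : forall y, is_derive S y (ps y * T y)).
{ intros z. replace (ps z * T z) with (DY (DX X) j x0 z).
  - apply (Derive_correct (fun z => Dx (X j) x0 z)). apply Ex.
  - rewrite (X_xy _ _ _ _ HX), Dy_F_x0, Dx_F_x0. unfold T, ps. lra. }
assert (Z : forall f, (forall y, is_derive f y 0) -> forall y, f y = f 0).
{ intros f Hf z. pose proof (RInt_FTC f (fun _ => 0) 0 z Hf (cont_const 0)) as E.
  rewrite RInt_cconst in E. lra. }
assert (E1 := Z (fun y => T y * co y + S y * si y)).
assert (E2 := Z (fun y => S y * co y - T y * si y)).
assert (N0 : jacobi_sn kb (be * 0) = 0).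
{ unfold jacobi_sn. now rewrite Rmult_0_r, jacobi_am_0, sin_0. }
assert (C0 : co 0 = 1) by (unfold co; rewrite N0; ring).
assert (I0 : si 0 = 0) by (unfold si; rewrite N0; ring).
cbv beta in E1, E2. rewrite C0, I0 in E1, E2.
assert (A : T y * co y + S y * si y = T 0).
{ rewrite E1; [ring|]. intros z.
  replace 0 with ((- ps z * S z * co z + T z * - (ps z * si z))
    + (ps z * T z * si z + S z * (ps z * co z))) by ring.
  apply (is_derive_plus (fun y => T y * co y) (fun y => S y * si y)).
  - apply (is_derive_Rmult T co); [apply DT|apply co_derive].
  - apply (is_derive_Rmult S si); [apply DS|apply si_derive]. }
assert (B : S y * co y - T y * si y = S 0).
{ rewrite E2; [ring|]. intros z.
  replace 0 with ((ps z * T z * co z + S z * - (ps z * si z))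
    - (- ps z * S z * si z + T z * (ps z * co z))) by ring.
  apply (is_derive_minus (fun y => S y * co y) (fun y => T y * si y)).
  - apply (is_derive_Rmult S co); [apply DS|apply co_derive].
  - apply (is_derive_Rmult T si); [apply DT|apply si_derive]. }
change (T y = T 0 * co y - S 0 * si y).
rewrite <- A, <- B. pose proof (co_si y) as E.
replace ((T y * co y + S y * si y) * co y - (S y * co y - T y * si y) * si y)
  with (T y * (co y ^ 2 + si y ^ 2)) by ring.
rewrite E. ring.
Qed.

(** Integrating [DY X] over a period gives [DY X * C - DX X * S = 0] in R^3, with the vectors taken
    at [y = 0] and [C], [S] the integrals of [co], [si]. Pairing with [DY X], which is orthogonal to
    [DX X] and nonzero, leaves [C = 0]; writing [sn ^ 2] as [1 - cn ^ 2] turns this into moments. *)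
Lemma closing_moment : (1 - 2 * kb ^ 2) * moment kb be 0 + 2 * kb ^ 2 * moment kb be 1 = 0.
Proof.
assert (Cc : cont co) by (eapply cont_derive; apply co_derive).
assert (Cs : cont si) by (eapply cont_derive; apply si_derive).
assert (E : forall j, DY X j x0 0 * RInt co 0 (2 * b) - DX X j x0 0 * RInt si 0 (2 * b) = 0).
{ intros j. destruct (smooth_derive (X j) x0 (X_smooth _ _ _ _ HX j)) as [_ [Sy [E _]]].
  destruct (smooth_derive _ x0 Sy) as [_ [_ [_ C]]].
  assert (FT := RInt_FTC (fun y => X j x0 y) (fun y => Dy (X j) x0 y) 0 (2 * b)).
  assert (P : X j x0 (2 * b) = X j x0 0) by (rewrite <- (Rplus_0_l (2 * b)); apply Hclose).
  cbv beta in FT. rewrite P, Rminus_diag in FT.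
  transitivity (RInt (fun y => Dy (X j) x0 y) 0 (2 * b)); [|apply FT].
  - rewrite (RInt_cext (fun y => Dy (X j) x0 y) (fun y => DY X j x0 0 * co y - DX X j x0 0 * si y))
      by (apply tangent_rotates).
    rewrite RInt_cminus, !RInt_cscal by cts. reflexivity.
  - intros y. apply (Derive_correct (fun z => X j x0 z)). apply E.
  - exact C. }
pose proof (metric_yy _ _ _ _ HX x0 0) as M. pose proof (metric_xy _ _ _ _ HX x0 0) as M2.
rewrite F_x0, exp_0 in M. unfold dot in M, M2.
pose proof (E c1) as E1. pose proof (E c2) as E2. pose proof (E c3) as E3.
set (C := RInt co 0 (2 * b)) in *. set (S := RInt si 0 (2 * b)) in *.
assert (C0 : C = 0).
{ assert (Z : C * (DY X c1 x0 0 * DY X c1 x0 0 + DY X c2 x0 0 * DY X c2 x0 0 + DY X c3 x0 0 * DY X c3 x0 0)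
   - S * (DX X c1 x0 0 * DY X c1 x0 0 + DX X c2 x0 0 * DY X c2 x0 0 + DX X c3 x0 0 * DY X c3 x0 0) = 0).
  { transitivity ((DY X c1 x0 0 * C - DX X c1 x0 0 * S) * DY X c1 x0 0
      + (DY X c2 x0 0 * C - DX X c2 x0 0 * S) * DY X c2 x0 0
      + (DY X c3 x0 0 * C - DX X c3 x0 0 * S) * DY X c3 x0 0); [ring|].
    rewrite E1, E2, E3. ring. }
  rewrite M2, Rmult_0_r, Rminus_0_r in Z.
  apply Rmult_integral in Z. destruct Z as [Z|Z]; [exact Z|]. rewrite Z in M. lra. }
assert (Ci : forall i, cont (fun y => jacobi_cn kb (be * y) ^ (2 * i))).
{ intros i. apply cont_pow. exact (cn_cont kb be Hkb). }
rewrite <- C0. unfold C.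
rewrite (RInt_cext co (fun y => (1 - 2 * kb ^ 2) * jacobi_cn kb (be * y) ^ (2 * 0)
  + 2 * kb ^ 2 * jacobi_cn kb (be * y) ^ (2 * 1))).
- rewrite RInt_cplus by (apply cont_mult; [apply cont_const|apply Ci]).
  rewrite !RInt_cscal by apply Ci. reflexivity.
- intros y. unfold co. rewrite jacobi_sn_cn_sqr. simpl. ring.
Qed.

End Closing.

(** * Moments of cn^2 under the closing condition *)

Lemma RInt_csum (f : nat -> R -> R) (q : nat -> R) n u v : (forall i, cont (f i)) ->
  cont (fun y => sum_f_R0 (fun i => q i * f i y) n) /\
  RInt (fun y => sum_f_R0 (fun i => q i * f i y) n) u v = sum_f_R0 (fun i => q i * RInt (f i) u v) n.
Proof.
intros Hf.
assert (C : forall i, cont (fun y => q i * f i y)).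
{ intros i. apply cont_mult; [apply cont_const|apply Hf]. }
induction n as [|n [IC IH]].
- split; [apply (C 0%nat)|]. apply (RInt_cscal (q 0%nat) (f 0%nat)). apply Hf.
- split.
  + apply (cont_plus (fun y => sum_f_R0 (fun i => q i * f i y) n) (fun y => q (S n) * f (S n) y)); auto.
  + transitivity (RInt (fun y => sum_f_R0 (fun i => q i * f i y) n) u v
      + RInt (fun y => q (S n) * f (S n) y) u v).
    * apply (RInt_cplus (fun y => sum_f_R0 (fun i => q i * f i y) n)); auto.
    * rewrite IH, RInt_cscal by auto. reflexivity.
Qed.

Lemma moment_form_pos k be (q : nat -> R) n : 0 < k < 1 -> 0 < be ->
  (forall c, 0 <= c <= 1 -> 0 <= sum_f_R0 (fun i => q i * c ^ i) n) ->
  0 <= sum_f_R0 (fun i => q i * moment k be i) n.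
Proof.
intros Hk Hbe Hq.
destruct (RInt_csum (fun i y => jacobi_cn k (be * y) ^ (2 * i)) q n 0 (2 * (2 * ellK k / be))) as [C E].
- intros i. apply cont_pow. exact (cn_cont k be Hk).
- change (0 <= sum_f_R0 (fun i => q i * RInt (fun y => jacobi_cn k (be * y) ^ (2 * i)) 0 (2 * (2 * ellK k / be))) n).
  rewrite <- E. pose proof (half_period_pos k be Hk Hbe).
  apply RInt_cge0; [lra|exact C|]. intros y.
  pose proof (Hq _ (cn_sqr_bounds k be y)) as P.
  rewrite (sum_eq _ (fun i => q i * (jacobi_cn k (be * y) ^ 2) ^ i)); [exact P|].
  intros i _. now rewrite pow_mult.
Qed.

Section Moments.

Variables (kb be v : R).
Hypothesis Hkb : 0 < kb < 1.
Hypothesis Hbe : 0 < be.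
Hypothesis Hv : kb ^ 2 * (1 + v) = 1.
Hypothesis Hclose : (1 - 2 * kb ^ 2) * moment kb be 0 + 2 * kb ^ 2 * moment kb be 1 = 0.

Definition nmom (j : nat) : R := moment kb be j / moment kb be 0.

Lemma moment_0_pos : 0 < moment kb be 0.
Proof. rewrite moment_0. pose proof (half_period_pos kb be Hkb Hbe). lra. Qed.

Lemma v_pos : 0 < v.
Proof. assert (0 < kb ^ 2 < 1) by nra. nra. Qed.

Lemma nmom_0 : nmom 0 = 1.
Proof. unfold nmom. field. pose proof moment_0_pos. lra. Qed.

Lemma nmom_1 : nmom 1 = (1 - v) / 2.
Proof.
pose proof moment_0_pos as M. assert (K : 0 < kb ^ 2) by nra.
unfold nmom. apply (Rmult_eq_reg_r (2 * kb ^ 2 * moment kb be 0)); [|nra].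
replace (moment kb be 1 / moment kb be 0 * (2 * kb ^ 2 * moment kb be 0))
  with (2 * kb ^ 2 * moment kb be 1) by (field; lra).
replace ((1 - v) / 2 * (2 * kb ^ 2 * moment kb be 0))
  with ((2 * kb ^ 2 - kb ^ 2 * (1 + v)) * moment kb be 0) by field.
rewrite Hv. lra.
Qed.

Lemma nmom_rec j : nmom (S (S j)) =
  (INR (2 * j + 2) * (1 - v) * nmom (S j) + INR (2 * j + 1) * v * nmom j) / INR (2 * j + 3).
Proof.
pose proof moment_0_pos as M. assert (K : 0 < kb ^ 2) by nra.
assert (N : 0 < INR (2 * j + 3)) by (apply lt_0_INR; lia).
pose proof (moment_rec kb be Hkb Hbe j) as E. unfold nmom.
apply (Rmult_eq_reg_r (INR (2 * j + 3) * kb ^ 2 * moment kb be 0));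
  [|apply Rgt_not_eq, Rmult_lt_0_compat; [now apply Rmult_lt_0_compat|exact M]].
replace (moment kb be (S (S j)) / moment kb be 0 * (INR (2 * j + 3) * kb ^ 2 * moment kb be 0))
  with (INR (2 * j + 3) * kb ^ 2 * moment kb be (S (S j))) by (field; lra).
rewrite E.
replace (2 * kb ^ 2 - 1) with (2 * kb ^ 2 - kb ^ 2 * (1 + v)) by lra.
replace (1 - kb ^ 2) with (kb ^ 2 * (1 + v) - kb ^ 2) by lra.
field; repeat split; lra.
Qed.

Lemma nmom_form_pos (q : nat -> R) n :
  (forall c, 0 <= c <= 1 -> 0 <= sum_f_R0 (fun i => q i * c ^ i) n) ->
  0 <= sum_f_R0 (fun i => q i * nmom i) n.
Proof.
intros Hq. pose proof moment_0_pos as M.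
apply (Rmult_le_reg_r (moment kb be 0)); auto. rewrite Rmult_0_l, Rmult_comm, scal_sum.
rewrite (sum_eq _ (fun i => q i * moment kb be i)).
- now apply moment_form_pos.
- intros i _. unfold nmom. field. lra.
Qed.

Lemma nmom_values :
  nmom 2 = (2 * (1 - v) * nmom 1 + v) / 3 /\
  nmom 3 = (4 * (1 - v) * nmom 2 + 3 * v * nmom 1) / 5 /\
  nmom 4 = (6 * (1 - v) * nmom 3 + 5 * v * nmom 2) / 7 /\
  nmom 5 = (8 * (1 - v) * nmom 4 + 7 * v * nmom 3) / 9 /\
  nmom 6 = (10 * (1 - v) * nmom 5 + 9 * v * nmom 4) / 11 /\
  nmom 7 = (12 * (1 - v) * nmom 6 + 11 * v * nmom 5) / 13 /\
  nmom 8 = (14 * (1 - v) * nmom 7 + 13 * v * nmom 6) / 15.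
Proof.
pose proof (nmom_rec 0) as R0. pose proof (nmom_rec 1) as R1. pose proof (nmom_rec 2) as R2.
pose proof (nmom_rec 3) as R3. pose proof (nmom_rec 4) as R4. pose proof (nmom_rec 5) as R5.
pose proof (nmom_rec 6) as R6. rewrite nmom_0 in R0.
simpl Nat.mul in *. simpl Nat.add in *. rewrite !INR_IZR_INZ in *. simpl Z.of_nat in *.
repeat split; lra.
Qed.

Definition coef (l : list R) (i : nat) : R := List.nth i l 0.

(* Positivity of the mean of [c (1 - c) (0.06 - 0.47 c + c^2 - 0.61 c^3)^2], where [c = cn^2]. *)
Lemma v_upper : v < 2145 / 10000.
Proof.
destruct (Rlt_dec v (2145 / 10000)) as [h|h]; [exact h|exfalso].
assert (E := nmom_form_pos (coef (0 :: 9/2500 :: -3/50 :: 3973/10000 :: -13541/10000 :: 12933/5000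
  :: -13967/5000 :: 15921/10000 :: -3721/10000 :: nil)%list) 8).
unfold coef in E. simpl in E.
destruct nmom_values as [R2 [R3 [R4 [R5 [R6 [R7 R8]]]]]].
rewrite R8, R7, R6, R5, R4, R3, R2, nmom_1 in E.
assert (P : forall n, 0 <= v ^ n) by (intros; apply pow_le; lra).
(* The contradiction is a polynomial inequality in [v]; with the powers of [v] as independent
   unknowns, these comparisons of neighbours suffice for linear arithmetic. *)
assert (V : forall n, 2145 / 10000 * v ^ n <= v ^ S n) by (intros n; simpl; pose proof (P n); nra).
pose proof (V 0%nat). pose proof (V 1%nat). pose proof (V 2%nat). pose proof (V 3%nat).
pose proof (V 4%nat). pose proof (V 5%nat). pose proof (V 6%nat). pose proof (V 7%nat).
pose proof (P 8%nat).
match type of E with _ -> ?g => assert (E2 : g) end.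
{ apply E. intros c Hc.
  match goal with |- 0 <= ?l => replace l with
    (c * (1 - c) * (6/100 - 47/100 * c + c ^ 2 - 61/100 * c ^ 3) ^ 2) by field end.
  apply Rmult_le_pos; [apply Rmult_le_pos; lra|apply pow2_ge_0]. }
clear E P V. simpl pow in *. lra.
Qed.

(* Positivity of the mean of [(1 - c) (0.02 - 0.35 c + c^2 - 0.73 c^3)^2], where [c = cn^2]. *)
Lemma v_lower : 1 / 5 < v.
Proof.
destruct (Rlt_dec (1 / 5) v) as [h|h]; [exact h|exfalso].
assert (E := nmom_form_pos (coef (1/2500 :: -9/625 :: 353/2000 :: -8917/10000 :: 11201/5000
  :: -2971/1000 :: 19929/10000 :: -5329/10000 :: nil)%list) 7).
unfold coef in E. simpl in E.
destruct nmom_values as [R2 [R3 [R4 [R5 [R6 [R7 R8]]]]]].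
rewrite R7, R6, R5, R4, R3, R2, nmom_1, nmom_0 in E.
assert (Hv0 := v_pos).
assert (V2 : v ^ 2 <= / 5 * v) by nra.
assert (V3 : v ^ 3 <= / 5 * v ^ 2) by (simpl; nra).
assert (P : forall n, 0 <= v ^ n) by (intros; apply pow_le; lra).
assert (V : forall n, v ^ S n <= / 5 * v ^ n) by (intros n; simpl; pose proof (P n); nra).
pose proof (V 3%nat). pose proof (V 4%nat). pose proof (V 5%nat). pose proof (V 6%nat).
match type of E with _ -> ?g => assert (E2 : g) end.
{ apply E. intros c Hc.
  match goal with |- 0 <= ?l => replace l with
    ((1 - c) * (2/100 - 35/100 * c + c ^ 2 - 73/100 * c ^ 3) ^ 2) by field end.
  apply Rmult_le_pos; [lra|apply pow2_ge_0]. }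
clear E P V. simpl pow in *. lra.
Qed.

End Moments.

Section Ranges.

Variables (kb be v : R).
Hypothesis Hkb : 0 < kb < 1.
Hypothesis Hbe : 0 < be.
Hypothesis Hv : kb ^ 2 * (1 + v) = 1.
Hypothesis Hclose : (1 - 2 * kb ^ 2) * moment kb be 0 + 2 * kb ^ 2 * moment kb be 1 = 0.

Let C (j : nat) : R := nmom kb be j.

Lemma C_ranges :
  (3927/10000 <= C 1 <= 4/10 /\ 277/1000 <= C 2 /\ 2247/10000 <= C 3 /\ 1937/10000 <= C 4) /\
  (v - 1) * C 1 + 2 * C 2 <= 246/1000 /\
  v + (2 - v) * C 1 - 2 * C 2 <= 3615/10000 /\
  (4 * v - 1) * (C 1 - C 2) + 6 * (C 2 - C 3) <= 2984/10000 /\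
  (1155/10000 <= C 1 - C 2 /\ 524/10000 <= C 2 - C 3 /\ 309/10000 <= C 3 - C 4 /\
   209/10000 <= C 4 - C 5 /\ 153/10000 <= C 5 - C 6 /\ 119/10000 <= C 6 - C 7).
Proof.
pose proof (v_upper kb be v Hkb Hbe Hv Hclose) as U.
pose proof (v_lower kb be v Hkb Hbe Hv Hclose) as L.
pose proof (nmom_1 kb be v Hkb Hbe Hv Hclose) as R1.
destruct (nmom_values kb be v Hkb Hbe Hv) as [R2 [R3 [R4 [R5 [R6 [R7 _]]]]]].
fold (C 1) in *. fold (C 2) in *. fold (C 3) in *. fold (C 4) in *. fold (C 5) in *.
fold (C 6) in *. fold (C 7) in *.
set (c1 := C 1) in *. set (c2 := C 2) in *. set (c3 := C 3) in *. set (c4 := C 4) in *.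
set (c5 := C 5) in *. set (c6 := C 6) in *. set (c7 := C 7) in *.
clearbody c1 c2 c3 c4 c5 c6 c7. clear Hv Hclose C Hkb Hbe.
(* Recentred at the left end of its range, [v] becomes a small [s]; the moments are polynomials in
   [s] whose high powers can be estimated term by term. *)
set (s := v - 1/5). assert (Hs : 0 <= s <= 145/10000) by (unfold s; lra).
replace v with (1/5 + s) in * by (unfold s; ring). clearbody s. clear v U L.
assert (P : forall n, 0 <= s ^ n) by (intros; apply pow_le; lra).
assert (V : forall n, s ^ S n <= 145/10000 * s ^ n) by (intros n; simpl; pose proof (P n); nra).
pose proof (V 1%nat). pose proof (V 2%nat). pose proof (V 3%nat). pose proof (V 4%nat).
pose proof (V 5%nat). pose proof (V 6%nat).
pose proof (P 2%nat). pose proof (P 3%nat). pose proof (P 4%nat).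
pose proof (P 5%nat). pose proof (P 6%nat). pose proof (P 7%nat). clear P V.
(* A tangent line below [s ^ 2], touching at the right end of the range. *)
pose proof (pow2_ge_0 (s - 145/10000)).
assert (Q1 : c1 = 2/5 + (-1)/2 * s) by (rewrite R1; field).
assert (Q2 : c2 = 7/25 + (-1)/5 * s + 1/3 * s ^ 2) by (rewrite R2, Q1; field).
assert (Q3 : c3 = 142/625 + (-43)/250 * s + 11/150 * s ^ 2 + (-4)/15 * s ^ 3) by (rewrite R3, Q2, Q1; field).
assert (Q4 : c4 = 4283/21875 + (-618)/4375 * s + 269/2625 * s ^ 2 + (-4)/525 * s ^ 3 + 8/35 * s ^ 4) by (rewrite R4, Q3, Q2; field).
assert (Q5 : c5 = 19094/109375 + (-467)/3750 * s + 599/7875 * s ^ 2 + (-17)/210 * s ^ 3 + (-4)/105 * s ^ 4 + (-64)/315 * s ^ 5) by (rewrite R5, Q4, Q3; field).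
assert (Q6 : c6 = 191299/1203125 + (-80989)/721875 * s + 1208/17325 * s ^ 2 + (-787)/17325 * s ^ 3 + 89/1155 * s ^ 4 + 256/3465 * s ^ 5 + 128/693 * s ^ 6) by (rewrite R6, Q5, Q4; field).
assert (Q7 : c7 = 1641818/11171875 + (-878543)/8531250 * s + 3521963/56306250 * s ^ 2 + (-106409)/2252250 * s ^ 3 + 3587/150150 * s ^ 4 + (-18736)/225225 * s ^ 5 + (-4672)/45045 * s ^ 6 + (-512)/3003 * s ^ 7) by (rewrite R7, Q6, Q5; field).
clear R1 R2 R3 R4 R5 R6 R7.
repeat split; rewrite ?Q7, ?Q6, ?Q5, ?Q4, ?Q3, ?Q2, ?Q1; clear Q1 Q2 Q3 Q4 Q5 Q6 Q7; simpl pow in *; lra.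
Qed.

End Ranges.

Lemma sqr_le_cancel x y : 0 <= y -> x ^ 2 <= y ^ 2 -> x <= y.
Proof. intros. nra. Qed.

(** * Negative test functions *)

Section Arith.

Variables (v t D : R).
Hypothesis Hv : 1/5 <= v <= 2145/10000.
Hypothesis Ht : 0 < t < 1.
Hypothesis HD : D = (1 + v * t) * (1 - t).

Lemma D_lower : (1 + t / 5) * (1 - t) <= D /\ 1 - t <= D /\ 0 < D.
Proof.
rewrite HD. assert (0 <= (v - 1/5) * t * (1 - t)) by (repeat apply Rmult_le_pos; lra).
assert (0 < t * (1 - t)) by nra. repeat split; nra.
Qed.

(** Kinetic against potential energy of the modes constant in [y], where [s] stands for [j / n] and
    [kap], [rho] for [PI] over twice the complete integrals. As [(1 + v t ^ 2) / D < / (1 - t)] and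
    [s ^ 2 kap ^ 2 <= kap], all reduces to [kap / (1 - t) <= 1 + kap t / (1 - t)], that is
    [kap <= 1]. So even the top frequency is negative, for every [t]. *)
Lemma arith_one s kap rho : 0 <= s <= 1 -> 0 < kap <= 1 -> 1/2 <= rho ->
  s ^ 2 * kap ^ 2 * ((1 + v * t ^ 2) / D) < 1 + 2 * kap * rho * (t / (1 - t)).
Proof.
intros Hs Hk Hr. destruct D_lower as [_ [_ D0]].
assert (E : (1 + v * t ^ 2) / D < / (1 - t)).
{ apply (Rmult_lt_reg_r D); auto. unfold Rdiv. rewrite Rmult_assoc, Rinv_l by lra.
  rewrite HD. replace (/ (1 - t) * ((1 + v * t) * (1 - t))) with (1 + v * t) by (field; lra).
  assert (0 < v * t * (1 - t)) by (apply Rmult_lt_0_compat; nra). nra. }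
assert (S1 : 0 <= s ^ 2 * kap ^ 2 <= kap).
{ pose proof (pow2_ge_0 s). pose proof (pow2_ge_0 kap). assert (s ^ 2 <= 1) by nra.
  assert (kap ^ 2 <= kap) by nra. split; [now apply Rmult_le_pos|].
  apply Rle_trans with (1 * kap ^ 2); [now apply Rmult_le_compat_r|lra]. }
apply Rle_lt_trans with (kap * ((1 + v * t ^ 2) / D)).
- apply Rmult_le_compat_r; [|lra]. apply Rmult_le_pos; [nra|left; now apply Rinv_0_lt_compat].
- apply Rlt_le_trans with (kap * / (1 - t)); [apply Rmult_lt_compat_l; lra|].
  apply Rle_trans with (1 + kap * (t / (1 - t))).
  + apply (Rmult_le_reg_r (1 - t)); [lra|].
    replace (kap * / (1 - t) * (1 - t)) with kap by (field; lra).
    replace ((1 + kap * (t / (1 - t))) * (1 - t)) with (1 - t + kap * t) by (field; lra). nra.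
  + apply Rplus_le_compat_l. apply Rmult_le_compat_r; [|nra].
    apply Rmult_le_pos; [lra|left; apply Rinv_0_lt_compat; lra].
Qed.

(** The constant 116/100 lies below [2 * 907/1000 * 64/100], the product of the lower bounds.
    Multiplied by [1 - t], the claim follows from [4/9 c + 0.246 t < c (1 + 0.16 t)], which is
    linear in [t] and so holds up to [t = 1]. *)
Lemma arith_cnA s kap rho c N : s ^ 2 <= 4/9 -> 907/1000 <= kap <= 1 -> 64/100 <= rho ->
  3927/10000 <= c -> N <= 246/1000 ->
  s ^ 2 * kap ^ 2 * ((1 + v * t ^ 2) / D) * c + t * N / D
    < c * (1 + 2 * kap * rho * (t / (1 - t))).
Proof.
intros Hs Hk Hr Hc HN. destruct D_lower as [_ [D1 D0]].
assert (ID : / D <= / (1 - t)) by (apply Rinv_le_contravar; lra).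
assert (I0 : 0 < / (1 - t)) by (apply Rinv_0_lt_compat; lra).
assert (ID0 : 0 < / D) by now apply Rinv_0_lt_compat.
assert (E : (1 + v * t ^ 2) / D <= / (1 - t)).
{ apply (Rmult_le_reg_r D); auto. unfold Rdiv. rewrite Rmult_assoc, Rinv_l by lra.
  rewrite HD. replace (/ (1 - t) * ((1 + v * t) * (1 - t))) with (1 + v * t) by (field; lra).
  assert (0 < v * t * (1 - t)) by (apply Rmult_lt_0_compat; nra). nra. }
assert (E0 : 0 <= (1 + v * t ^ 2) / D) by (apply Rmult_le_pos; [nra|lra]).
pose proof (pow2_ge_0 s) as Ps. 
assert (K : 0 <= kap ^ 2 <= 1) by (split; [apply pow2_ge_0|nra]).
assert (S1 : s ^ 2 * kap ^ 2 <= 4/9) by nra.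
assert (A1 : s ^ 2 * kap ^ 2 * ((1 + v * t ^ 2) / D) * c <= 4/9 * / (1 - t) * c).
{ apply Rmult_le_compat_r; [lra|]. apply Rmult_le_compat; auto. apply Rmult_le_pos; lra. }
assert (A2 : t * N / D <= t * (246/1000) * / (1 - t)).
{ apply Rle_trans with (t * (246/1000) * / D).
  - unfold Rdiv. apply Rmult_le_compat_r; [lra|]. apply Rmult_le_compat_l; lra.
  - apply Rmult_le_compat_l; [nra|exact ID]. }
assert (A3 : c * (1 + 116/100 * (t / (1 - t))) <= c * (1 + 2 * kap * rho * (t / (1 - t)))).
{ apply Rmult_le_compat_l; [lra|]. apply Rplus_le_compat_l. apply Rmult_le_compat_r; [|nra].
  apply Rmult_le_pos; lra. }
eapply Rlt_le_trans; [|exact A3]. eapply Rle_lt_trans; [apply Rplus_le_compat; [exact A1|exact A2]|].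
apply (Rmult_lt_reg_r (1 - t)); [lra|].
replace ((4/9 * / (1 - t) * c + t * (246/1000) * / (1 - t)) * (1 - t)) with (4/9 * c + t * (246/1000)) by (field; lra).
replace (c * (1 + 116/100 * (t / (1 - t))) * (1 - t)) with (c * (1 + 16/100 * t)) by (field; lra).
nra.
Qed.

Lemma arith_reduce A B T : A < D * (B + T) -> A / D < B + T.
Proof.
intros E. destruct D_lower as [_ [_ D0]]. apply (Rmult_lt_reg_r D); auto.
unfold Rdiv. rewrite Rmult_assoc, Rinv_l by lra. lra.
Qed.

(** The coefficient of [t ^ j] is [8 j wallis j / PI]. *)
Definition wsum (y1 y2 y3 y4 y5 : R) : R :=
  4 * t * y1 + 6 * t ^ 2 * y2 + 15/2 * t ^ 3 * y3 + 35/4 * t ^ 4 * y4 + 315/32 * t ^ 5 * y5.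

Lemma wsum_lower a1 a2 a3 a4 a5 y1 y2 y3 y4 y5 :
  a1 <= y1 -> a2 <= y2 -> a3 <= y3 -> a4 <= y4 -> a5 <= y5 ->
  wsum a1 a2 a3 a4 a5 <= wsum y1 y2 y3 y4 y5.
Proof.
intros. unfold wsum.
assert (P : forall n, 0 < t ^ n) by (intros; apply pow_lt; lra).
pose proof (P 2%nat). pose proof (P 3%nat). pose proof (P 4%nat). pose proof (P 5%nat).
repeat apply Rplus_le_compat; (apply Rmult_le_compat_l; [lra|assumption]).
Qed.

(* All three criteria have the same shape: bound every coefficient and both
   factors of D by their worst values. *)
Lemma arith_poly s kap k0 i N y1 y2 y3 y4 y5 a1 a2 a3 a4 a5 :
  0 <= s <= 1 -> 0 < k0 <= kap -> kap <= 1 -> 0 <= i ->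
  0 <= a1 <= y1 -> 0 <= a2 <= y2 -> 0 <= a3 <= y3 -> 0 <= a4 <= y4 -> 0 <= a5 <= y5 ->
  s ^ 2 * (1 + v * t ^ 2) * i + t * N
    < D * i + (1 + t / 5) * (1 - t) * (k0 * wsum a1 a2 a3 a4 a5) ->
  s ^ 2 * kap ^ 2 * ((1 + v * t ^ 2) / D) * i + t * N / D < i + kap * wsum y1 y2 y3 y4 y5.
Proof.
intros Hs Hk0 Hk Hi H1 H2 H3 H4 H5 E. destruct D_lower as [D1 [_ D0]].
replace (s ^ 2 * kap ^ 2 * ((1 + v * t ^ 2) / D) * i + t * N / D) with
  ((kap ^ 2 * (s ^ 2 * (1 + v * t ^ 2) * i) + t * N) / D) by (field; lra).
apply arith_reduce.
pose proof (wsum_lower a1 a2 a3 a4 a5 y1 y2 y3 y4 y5) as W.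
assert (W0 : 0 <= wsum a1 a2 a3 a4 a5).
{ unfold wsum. assert (P : forall n, 0 < t ^ n) by (intros; apply pow_lt; lra).
  pose proof (P 2%nat). pose proof (P 3%nat). pose proof (P 4%nat). pose proof (P 5%nat).
  repeat apply Rplus_le_le_0_compat; (apply Rmult_le_pos; lra). }
specialize (W ltac:(lra) ltac:(lra) ltac:(lra) ltac:(lra) ltac:(lra)).
assert (K : kap ^ 2 <= 1) by nra.
assert (S0 : 0 <= s ^ 2 * (1 + v * t ^ 2) * i).
{ apply Rmult_le_pos; [apply Rmult_le_pos; [apply pow2_ge_0|nra]|lra]. }
assert (A1 : kap ^ 2 * (s ^ 2 * (1 + v * t ^ 2) * i) <= s ^ 2 * (1 + v * t ^ 2) * i) by nra.
assert (A2 : k0 * wsum a1 a2 a3 a4 a5 <= kap * wsum y1 y2 y3 y4 y5).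
{ apply Rmult_le_compat; lra. }
assert (A3 : (1 + t / 5) * (1 - t) * (k0 * wsum a1 a2 a3 a4 a5) <= D * (kap * wsum y1 y2 y3 y4 y5)).
{ apply Rmult_le_compat; [nra|apply Rmult_le_pos; lra|exact D1|exact A2]. }
lra.
Qed.

Lemma arith_cn1 s kap c N y1 y2 y3 y4 y5 : 0 <= s <= 1 -> t <= 3/4 -> 944/1000 <= kap <= 1 ->
  0 <= c <= 4/10 -> N <= 246/1000 ->
  277/1000 <= y1 -> 2247/10000 <= y2 -> 1937/10000 <= y3 -> 0 <= y4 -> 0 <= y5 ->
  s ^ 2 * kap ^ 2 * ((1 + v * t ^ 2) / D) * c + t * N / D < c + kap * wsum y1 y2 y3 y4 y5.
Proof.
intros. apply arith_poly with (944/1000) (277/1000) (2247/10000) (1937/10000) 0 0; try lra.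
assert (S1 : s ^ 2 * (1 + v * t ^ 2) * c <= (1 + v * t ^ 2) * c).
{ apply Rmult_le_compat_r; [lra|]. assert (s ^ 2 <= 1) by nra. assert (0 <= v * t ^ 2) by nra. nra. }
(* Since [1 + v t ^ 2 - D = t (1 - v + 2 v t)], moving [D * c] to the left leaves a factor [t] on
   both sides. *)
enough (X : t * (c * (1 - v + 2 * v * t) + N) <
  (1 + t / 5) * (1 - t) * (944/1000 * wsum (277/1000) (2247/10000) (1937/10000) 0 0)).
{ rewrite HD. nra. }
assert (B : c * (1 - v + 2 * v * t) + N <= 566/1000 + 172/1000 * t).
{ assert (0 <= 1 - v + 2 * v * t <= 8/10 + 429/1000 * t) by (split; nra). nra. }
replace (wsum (277/1000) (2247/10000) (1937/10000) 0 0) with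
  (t * (1108/1000 + 13482/10000 * t + 29055/20000 * t ^ 2)) by (unfold wsum; field).
apply Rle_lt_trans with (t * (566/1000 + 172/1000 * t)); [apply Rmult_le_compat_l; lra|].
replace ((1 + t / 5) * (1 - t) * (944 / 1000 * (t * (1108 / 1000 + 13482 / 10000 * t + 29055 / 20000 * t ^ 2))))
 with (t * ((1 + t / 5) * (1 - t) * (944 / 1000 * (1108 / 1000 + 13482 / 10000 * t + 29055 / 20000 * t ^ 2)))) by ring.
apply Rmult_lt_compat_l; [lra|].
nra.
Qed.

Lemma arith_sn43 s kap i N y1 y2 y3 y4 y5 : 0 <= s <= 1/3 -> t <= 516/1000 ->
  972/1000 <= kap <= 1 -> 6/10 <= i <= 6073/10000 -> N <= 3615/10000 ->
  1155/10000 <= y1 -> 524/10000 <= y2 -> 0 <= y3 -> 0 <= y4 -> 0 <= y5 ->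
  s ^ 2 * kap ^ 2 * ((1 + v * t ^ 2) / D) * i + t * N / D < i + kap * wsum y1 y2 y3 y4 y5.
Proof.
intros. destruct D_lower as [D1 _].
apply arith_poly with (972/1000) (1155/10000) (524/10000) 0 0 0; try lra.
assert (S1 : s ^ 2 * (1 + v * t ^ 2) * i <= 1/9 * (11/10) * (6073/10000)).
{ assert (0 <= s ^ 2 <= 1/9) by nra. assert (0 <= 1 + v * t ^ 2 <= 11/10) by (split; nra).
  apply Rmult_le_compat; try lra; [apply Rmult_le_pos; lra|apply Rmult_le_compat; lra]. }
assert (T1 : t * N <= t * (3615/10000)) by (apply Rmult_le_compat_l; lra).
assert (DD : (1 + t / 5) * (1 - t) * (6/10) <= D * i).
{ apply Rmult_le_compat; try lra. apply Rmult_le_pos; lra. }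
replace (wsum (1155/10000) (524/10000) 0 0 0) with (462/1000 * t + 3144/10000 * t ^ 2)
  by (unfold wsum; field).
enough (X : 1/9 * (11/10) * (6073/10000) + t * (3615/10000) <
  (1 + t / 5) * (1 - t) * (6/10) + (1 + t / 5) * (1 - t) * (972/1000 * (462/1000 * t + 3144/10000 * t ^ 2))) by lra.
(* The constant part of the potential already wins, so the contribution of [wsum] is only needed to
   be nonnegative. *)
assert (0 <= (1 + t / 5) * (1 - t) * (972/1000 * (462/1000 * t + 3144/10000 * t ^ 2))).
{ repeat apply Rmult_le_pos; try lra. nra. }
enough (1/9 * (11/10) * (6073/10000) + t * (3615/10000) < (1 + t / 5) * (1 - t) * (6/10)) by lra.
nra.
Qed.

Lemma arith_sn32 kap i N y1 y2 y3 y4 y5 : t <= 3/4 ->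
  944/1000 <= kap <= 1 -> 6/10 <= i -> N <= 3615/10000 ->
  1155/10000 <= y1 -> 524/10000 <= y2 -> 0 <= y3 -> 0 <= y4 -> 0 <= y5 ->
  0 ^ 2 * kap ^ 2 * ((1 + v * t ^ 2) / D) * i + t * N / D < i + kap * wsum y1 y2 y3 y4 y5.
Proof.
intros. destruct D_lower as [D1 _].
apply arith_poly with (944/1000) (1155/10000) (524/10000) 0 0 0; try lra.
assert (T1 : t * N <= t * (3615/10000)) by (apply Rmult_le_compat_l; lra).
assert (DD : (1 + t / 5) * (1 - t) * (6/10) <= D * i).
{ apply Rmult_le_compat; try lra. apply Rmult_le_pos; lra. }
replace (wsum (1155/10000) (524/10000) 0 0 0) with (462/1000 * t + 3144/10000 * t ^ 2)
  by (unfold wsum; field).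
enough (X : t * (3615/10000) <
  (1 + t / 5) * (1 - t) * (6/10 + 944/1000 * (462/1000 * t + 3144/10000 * t ^ 2))) by lra.
assert (0 <= t ^ 2 * (3/4 - t)) by (apply Rmult_le_pos; nra).
assert (0 <= t ^ 3 * (3/4 - t)) by (apply Rmult_le_pos; [apply pow_le|]; lra).
assert (0 <= t * (3/4 - t)) by nra.
nra.
Qed.

(** The margin is small: at [t = 516/1000] the two sides after the reduction are about 0.154 and
    0.162. This is why [t] has to be confined so sharply for 4/3. *)
Lemma arith_sncn kap i N y1 y2 y3 y4 y5 : t <= 516/1000 ->
  972/1000 <= kap <= 1 -> 1155/10000 <= i -> N <= 2984/10000 ->
  524/10000 <= y1 -> 309/10000 <= y2 -> 209/10000 <= y3 -> 153/10000 <= y4 -> 119/10000 <= y5 ->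
  0 ^ 2 * kap ^ 2 * ((1 + v * t ^ 2) / D) * i + t * N / D < i + kap * wsum y1 y2 y3 y4 y5.
Proof.
intros. destruct D_lower as [D1 _].
apply arith_poly with (972/1000) (524/10000) (309/10000) (209/10000) (153/10000) (119/10000); try lra.
assert (T1 : t * N <= t * (2984/10000)) by (apply Rmult_le_compat_l; lra).
assert (DD : (1 + t / 5) * (1 - t) * (1155/10000) <= D * i).
{ apply Rmult_le_compat; try lra. apply Rmult_le_pos; lra. }
unfold wsum.
enough (X : t * (2984/10000) <
  (1 + t / 5) * (1 - t) * (1155/10000 + 972/1000 * (4 * t * (524 / 10000) + 6 * t ^ 2 * (309 / 10000)
   + 15 / 2 * t ^ 3 * (209 / 10000) + 35 / 4 * t ^ 4 * (153 / 10000) + 315 / 32 * t ^ 5 * (119 / 10000)))) by lra.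
assert (P : forall n, 0 <= t ^ n) by (intros; apply pow_le; lra).
assert (V : forall n, t ^ S n <= 516/1000 * t ^ n) by (intros n; simpl; pose proof (P n); nra).
pose proof (V 0%nat). pose proof (V 1%nat). pose proof (V 2%nat). pose proof (V 3%nat).
pose proof (V 4%nat). pose proof (V 5%nat). pose proof (V 6%nat).
clear P V. simpl pow in *. lra.
Qed.

End Arith.

Lemma wallis_values : wallis 1 = PI / 2 /\ wallis 2 = 3 / 8 * PI /\ wallis 3 = 5 / 16 * PI /\
  wallis 4 = 35 / 128 * PI /\ wallis 5 = 63 / 256 * PI.
Proof.
pose proof wallis_0 as W0.
pose proof (wallis_rec 0) as W1. pose proof (wallis_rec 1) as W2. pose proof (wallis_rec 2) as W3.
pose proof (wallis_rec 3) as W4. pose proof (wallis_rec 4) as W5.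
simpl Nat.mul in *. simpl Nat.add in *. rewrite !INR_IZR_INZ in *. simpl Z.of_nat in *.
repeat split; lra.
Qed.

(** * Energy criteria for the four kinds of y-factor *)

Inductive ytype : Set := Yone | Ycn | Ysn | Ysc.

Definition yval (kb be : R) (q : ytype) (y : R) : R :=
  match q with
  | Yone => 1
  | Ycn => jacobi_cn kb (be * y)
  | Ysn => jacobi_sn kb (be * y)
  | Ysc => jacobi_sn kb (be * y) * jacobi_cn kb (be * y)
  end.

Definition yval2 (kb be : R) (q : ytype) (y : R) : R :=
  match q with
  | Yone => 0
  | Ycn => - be ^ 2 * (jacobi_cn kb (be * y) *
      (1 - 2 * kb ^ 2 + 2 * kb ^ 2 * jacobi_cn kb (be * y) ^ 2))
  | Ysn => - be ^ 2 * (jacobi_sn kb (be * y) *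
      (1 - kb ^ 2 + 2 * kb ^ 2 * jacobi_cn kb (be * y) ^ 2))
  | Ysc => - be ^ 2 * (jacobi_sn kb (be * y) * jacobi_cn kb (be * y) *
      (4 - 5 * kb ^ 2 + 6 * kb ^ 2 * jacobi_cn kb (be * y) ^ 2))
  end.

Definition ysg (q : ytype) : R := match q with Yone | Ycn => 1 | _ => -1 end.
(** True when the half-period shift in [y] changes the sign; as a boolean it can be compared with
    the parity of the x-index. *)
Definition ypar (q : ytype) : bool := match q with Yone | Ysc => false | _ => true end.
Definition ytu (q : ytype) : R := if ypar q then -1 else 1.

Lemma yval_yfun kb be q : 0 < kb < 1 -> 0 < be ->
  yfun (2 * ellK kb / be) (yval kb be q) (yval2 kb be q) (ysg q) (ytu q).
Proof.
intros Hkb Hbe. destruct q.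
- exact (yfun_one kb be).
- exact (yfun_cn kb be Hkb Hbe).
- exact (yfun_sn kb be Hkb Hbe).
- exact (yfun_sncn kb be Hkb Hbe).
Qed.

Section Wente.

Variables (H k kb al be t st v : R) (F : R -> R -> R).
Hypothesis HH : 0 < H.
Hypothesis Hk : 0 < k < 1.
Hypothesis Hkb : 0 < kb < 1.
Hypothesis Hal : 0 < al.
Hypothesis Hbe : 0 < be.
Hypothesis Ht : 0 < t < 1.
Hypothesis Hst : st ^ 2 = t.
Hypothesis HF : forall x y,
  tanh (F x y / 4) = st * jacobi_cn k (al * x) * jacobi_cn kb (be * y).
Hypothesis Hv : kb ^ 2 * (1 + v) = 1.
Hypothesis Hkv : (1 - k ^ 2) * (1 + v * t ^ 2) = 1.
Hypothesis Hclose : (1 - 2 * kb ^ 2) * moment kb be 0 + 2 * kb ^ 2 * moment kb be 1 = 0.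

Let D : R := (1 + v * t) * (1 - t).
Hypothesis Hal2 : al ^ 2 = 4 * H * ((1 + v * t ^ 2) / D).
Hypothesis Hbe2 : be ^ 2 = 4 * H * (t * (1 + v) / D).

Let a : R := 2 * ellK k / al.
Let b : R := 2 * ellK kb / be.
Let C (j : nat) : R := nmom kb be j.
Let kap : R := PI / (al * a).
Let rho : R := PI / (be * b).
Let cn (y : R) : R := jacobi_cn kb (be * y).

Lemma v_range : 1 / 5 <= v <= 2145 / 10000.
Proof.
pose proof (v_upper kb be v Hkb Hbe Hv Hclose).
pose proof (v_lower kb be v Hkb Hbe Hv Hclose). lra.
Qed.

Lemma a_pos : 0 < a. Proof. now apply half_period_pos. Qed.
Lemma b_pos : 0 < b. Proof. now apply half_period_pos. Qed.

Lemma kap_le_1 : 0 < kap <= 1.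
Proof.
pose proof (kappa_bounds k al Hk Hal) as [_ K]. fold a in K. pose proof a_pos. pose proof PI_RGT_0.
assert (0 < al * a) by now apply Rmult_lt_0_compat.
unfold kap. split; [now apply Rdiv_lt_0_compat|].
apply (Rmult_le_reg_r (al * a)); auto. unfold Rdiv. rewrite Rmult_assoc, Rinv_l by lra. lra.
Qed.

(** By [Hkv], [1 - k ^ 2] is the inverse of [1 + v t ^ 2], and its square root is a lower bound for
    [kap]. *)
Lemma kap_lower c : 0 <= c -> c ^ 2 * (1 + v * t ^ 2) <= 1 -> c <= kap.
Proof.
intros Hc E. pose proof (kappa_bounds k al Hk Hal) as [K _]. fold a in K. pose proof a_pos.
assert (0 < al * a) by now apply Rmult_lt_0_compat.
pose proof v_range. assert (P : 0 < 1 + v * t ^ 2) by nra.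
assert (L : c <= sqrt (1 - k ^ 2)).
{ rewrite <- (sqrt_pow2 c) by assumption. apply sqrt_le_1_alt.
  apply (Rmult_le_reg_r (1 + v * t ^ 2)); auto. lra. }
unfold kap. apply (Rmult_le_reg_r (al * a)); auto. unfold Rdiv.
rewrite Rmult_assoc, Rinv_l by lra. rewrite Rmult_1_r. eapply Rle_trans; [|exact K].
apply Rmult_le_compat_r; lra.
Qed.

(** As [dn] lies in [[l, 1]], [(1 - dn) (dn - l) >= 0], that is [dn ^ 2 + l <= (1 + l) dn]. Now take
    means: closing makes the mean of [dn ^ 2] exactly 1/2, and the mean of [dn] is [rho]. The bound
    408/1000 on [l] comes from [1 - kb ^ 2 >= 1/6], which is [v >= 1/5]. *)
Lemma rho_lower : 64 / 100 <= rho.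
Proof.
pose proof b_pos as Hb. pose proof v_range as Hvr.
set (l := sqrt (1 - kb ^ 2)).
assert (Hm : 1 / 6 <= 1 - kb ^ 2) by nra.
assert (Hl : 408 / 1000 <= l).
{ unfold l. rewrite <- (sqrt_pow2 (408 / 1000)) by lra. apply sqrt_le_1_alt. lra. }
assert (Hl1 : l <= 1).
{ apply Rle_trans with (sqrt 1); [apply sqrt_le_1_alt; nra|rewrite sqrt_1; lra]. }
pose proof (dn_cont kb be Hkb) as Cd. pose proof (cn_cont kb be Hkb) as Cc.
assert (E1 : RInt (fun y => jacobi_dn kb (be * y) ^ 2) 0 (2 * b) = b).
{ rewrite (RInt_cext _ (fun y => (1 - kb ^ 2) * jacobi_cn kb (be * y) ^ (2 * 0)
    + kb ^ 2 * jacobi_cn kb (be * y) ^ (2 * 1))).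
  - assert (Ci : forall i, cont (fun y => jacobi_cn kb (be * y) ^ (2 * i))) by (intros; now apply cont_pow).
    rewrite RInt_cplus by (apply cont_mult; [apply cont_const|apply Ci]).
    rewrite !RInt_cscal by apply Ci.
    change ((1 - kb ^ 2) * moment kb be 0 + kb ^ 2 * moment kb be 1 = b).
    pose proof (moment_0 kb be) as M. fold b in M. lra.
  - intros y. rewrite jacobi_dn_sqr, jacobi_sn_cn_sqr by assumption. simpl. ring. }
assert (E2 : RInt (fun y => be * jacobi_dn kb (be * y)) 0 (2 * b) = 2 * PI).
{ pose proof (RInt_dn kb be Hkb Hbe 2) as E. fold b in E. exact E. }
rewrite RInt_cscal in E2 by assumption.
assert (E3 : b + 2 * b * l <= (1 + l) * RInt (fun y => jacobi_dn kb (be * y)) 0 (2 * b)).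
{ rewrite <- E1 at 1.
  replace (2 * b * l) with ((2 * b - 0) * l) by ring.
  rewrite <- (RInt_cconst l), <- RInt_cplus, <- RInt_cscal by
    (try assumption; try apply cont_const; now apply cont_pow).
  apply RInt_cle; [lra| | |].
  - apply cont_plus; [now apply cont_pow|apply cont_const].
  - apply cont_mult; [apply cont_const|assumption].
  - intros y. pose proof (jacobi_dn_bounds kb (be * y) Hkb) as [B _]. fold l in B. nra. }
set (Id := RInt (fun y => jacobi_dn kb (be * y)) 0 (2 * b)) in *.
assert (E4 : (1 / 2 + l) * b <= (1 + l) * (PI / be)).
{ replace (PI / be) with (Id / 2); [lra|].
  apply (Rmult_eq_reg_l be); [|lra]. replace (be * (PI / be)) with PI by (field; lra). lra. }
assert (E5 : 64 / 100 * (1 + l) <= 1 / 2 + l) by lra.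
unfold rho. apply (Rmult_le_reg_r b); auto.
replace (PI / (be * b) * b) with (PI / be) by (field; lra).
assert (0 < PI / be) by (apply Rdiv_lt_0_compat; [apply PI_RGT_0|lra]).
nra.
Qed.

(** The inequality between kinetic and potential energy that [bil_neg] asks for. *)
Definition crit (n j : nat) (q : ytype) : Prop :=
  a * (freq a n j ^ 2 * RInt (fun y => yval kb be q y ^ 2) 0 (2 * b)
    + RInt (fun y => - (yval kb be q y * yval2 kb be q y)) 0 (2 * b))
  < RInt (vint H b F (yval kb be q)) 0 a.

Lemma cn_pow_ct i : cont (fun y => cn y ^ (2 * i)).
Proof. apply cont_pow. exact (cn_cont kb be Hkb). Qed.

Lemma M0_pos : 0 < moment kb be 0.
Proof. now apply moment_0_pos. Qed.

Lemma moment_C i : RInt (fun y => cn y ^ (2 * i)) 0 (2 * b) = moment kb be 0 * C i.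
Proof. unfold C, nmom. pose proof M0_pos. change (moment kb be i = moment kb be 0 * (moment kb be i / moment kb be 0)). field. lra. Qed.

Lemma RInt_cn_poly (f : R -> R) i p0 p1 p2 :
  (forall y, f y = cn y ^ (2 * i) * (p0 + p1 * cn y ^ 2 + p2 * cn y ^ 4)) ->
  RInt f 0 (2 * b) = moment kb be 0 * (p0 * C i + p1 * C (i + 1) + p2 * C (i + 2)).
Proof.
intros E.
rewrite (RInt_cext f (fun y => p0 * cn y ^ (2 * i) + p1 * cn y ^ (2 * (i + 1)) + p2 * cn y ^ (2 * (i + 2)))).
- assert (Cp : forall c j, cont (fun y => c * cn y ^ (2 * j))).
  { intros c j. apply cont_mult; [apply cont_const|apply cn_pow_ct]. }
  rewrite RInt_cplus; [|apply (cont_plus (fun y => p0 * cn y ^ (2 * i))); apply Cp|apply Cp].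
  rewrite RInt_cplus by apply Cp.
  rewrite !RInt_cscal by apply cn_pow_ct. rewrite !moment_C. rring.
- intros y. rewrite E.
  replace (2 * (i + 1))%nat with (2 * i + 2)%nat by lia.
  replace (2 * (i + 2))%nat with (2 * i + 4)%nat by lia.
  rewrite !pow_add. ring.
Qed.

Lemma C_0 : C 0 = 1.
Proof. now apply nmom_0. Qed.

Lemma sn_sqr y : jacobi_sn kb (be * y) ^ 2 = 1 - cn y ^ 2.
Proof. apply jacobi_sn_cn_sqr. Qed.

Definition ymass (q : ytype) (i : nat) : R :=
  match q with
  | Yone => C i
  | Ycn => C (i + 1)
  | Ysn => C i - C (i + 1)
  | Ysc => C (i + 1) - C (i + 2)
  end.

Lemma ymom_val q i : ymom kb be (yval kb be q) i = moment kb be 0 * ymass q i.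
Proof.
unfold ymom. fold b. destruct q; unfold yval, ymass.
- rewrite (RInt_cn_poly _ i 1 0 0) by (intros; unfold cn; simpl; ring). ring.
- rewrite (RInt_cn_poly _ i 0 1 0) by (intros; unfold cn; simpl; ring). ring.
- rewrite (RInt_cn_poly _ i 1 (-1) 0) by (intros; rewrite sn_sqr; unfold cn; simpl; ring). ring.
- rewrite (RInt_cn_poly _ i 0 1 (-1)).
  + ring.
  + intros y. rewrite Rpow_mult_distr, sn_sqr. unfold cn. simpl. ring.
Qed.

(** The y-part of the kinetic energy per unit of [4 H t / D]; [(1 + v) kb ^ 2 = 1] removes the
    modulus. *)
Definition ykin (q : ytype) : R :=
  match q with
  | Yone => 0
  | Ycn => (v - 1) * C 1 + 2 * C 2
  | Ysn => v + (2 - v) * C 1 - 2 * C 2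
  | Ysc => (4 * v - 1) * (C 1 - C 2) + 6 * (C 2 - C 3)
  end.

Lemma ykin_val q : RInt (fun y => - (yval kb be q y * yval2 kb be q y)) 0 (2 * b)
  = 4 * H * moment kb be 0 * (t * ykin q / D).
Proof.
pose proof v_range as Hvr.
assert (HD : 0 < D) by (unfold D; apply Rmult_lt_0_compat; nra).
assert (Hm : kb ^ 2 = / (1 + v)).
{ apply (Rmult_eq_reg_r (1 + v)); [|lra]. rewrite Rinv_l by lra. exact Hv. }
destruct q; unfold yval, yval2, ykin.
- rewrite (RInt_cext _ (fun _ => 0)) by (intros; ring). rewrite RInt_cconst. unfold Rdiv. rring.
- rewrite (RInt_cn_poly _ 0 0 (be ^ 2 * (1 - 2 * kb ^ 2)) (be ^ 2 * (2 * kb ^ 2))).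
  + rewrite Hbe2, Hm. simpl Nat.add. to_R. field. lra.
  + intros y. unfold cn. simpl. ring.
- rewrite (RInt_cn_poly _ 0 (be ^ 2 * (1 - kb ^ 2)) (be ^ 2 * (3 * kb ^ 2 - 1)) (be ^ 2 * (- (2 * kb ^ 2)))).
  + rewrite Hbe2, Hm. simpl Nat.add. rewrite C_0. to_R. field. lra.
  + intros y.
    match goal with |- ?l = _ => replace l with (be ^ 2 * (jacobi_sn kb (be * y) ^ 2 *
      (1 - kb ^ 2 + 2 * kb ^ 2 * jacobi_cn kb (be * y) ^ 2))) by ring end.
    rewrite sn_sqr. unfold cn. simpl. ring.
- rewrite (RInt_cn_poly _ 1 (be ^ 2 * (4 - 5 * kb ^ 2)) (be ^ 2 * (11 * kb ^ 2 - 4)) (be ^ 2 * (- (6 * kb ^ 2)))).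
  + rewrite Hbe2, Hm. simpl Nat.add. to_R. field. lra.
  + intros y.
    match goal with |- ?l = _ => replace l with (be ^ 2 * (jacobi_sn kb (be * y) ^ 2 * jacobi_cn kb (be * y) ^ 2 *
      (4 - 5 * kb ^ 2 + 6 * kb ^ 2 * jacobi_cn kb (be * y) ^ 2))) by ring end.
    rewrite sn_sqr. unfold cn. simpl. ring.
Qed.

Lemma freq_sqr n j : (0 < n)%nat ->
  freq a n j ^ 2 = 4 * H * ((INR j / INR n) ^ 2 * kap ^ 2 * ((1 + v * t ^ 2) / D)).
Proof.
intros Hn. assert (Hn' : 0 < INR n) by now apply lt_0_INR. pose proof a_pos.
transitivity ((INR j / INR n) ^ 2 * kap ^ 2 * al ^ 2); [|rewrite Hal2; ring].
unfold freq, kap. field. repeat split; lra.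
Qed.

Lemma kinetic n j q : (0 < n)%nat ->
  a * (freq a n j ^ 2 * RInt (fun y => yval kb be q y ^ 2) 0 (2 * b)
    + RInt (fun y => - (yval kb be q y * yval2 kb be q y)) 0 (2 * b))
  = 4 * H * a * moment kb be 0 *
    ((INR j / INR n) ^ 2 * kap ^ 2 * ((1 + v * t ^ 2) / D) * ymass q 0 + t * ykin q / D).
Proof.
intros Hn. rewrite ykin_val, freq_sqr by assumption.
rewrite (RInt_cext _ (fun y => jacobi_cn kb (be * y) ^ (2 * 0) * yval kb be q y ^ 2)) by (intros; simpl; ring).
change (RInt (fun y => jacobi_cn kb (be * y) ^ (2 * 0) * yval kb be q y ^ 2) 0 (2 * b))
  with (ymom kb be (yval kb be q) 0).
rewrite ymom_val. ring.
Qed.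

Lemma crit_scale n j q B : (0 < n)%nat ->
  4 * H * a * moment kb be 0 * B <= RInt (vint H b F (yval kb be q)) 0 a ->
  (INR j / INR n) ^ 2 * kap ^ 2 * ((1 + v * t ^ 2) / D) * ymass q 0 + t * ykin q / D < B ->
  crit n j q.
Proof.
intros Hn HB E. unfold crit. rewrite kinetic by assumption. eapply Rlt_le_trans; [|exact HB].
apply Rmult_lt_compat_l; [|exact E]. pose proof M0_pos. pose proof a_pos.
apply Rmult_lt_0_compat; [|assumption]. apply Rmult_lt_0_compat; lra.
Qed.

Lemma crit_poly n j q : (0 < n)%nat ->
  (INR j / INR n) ^ 2 * kap ^ 2 * ((1 + v * t ^ 2) / D) * ymass q 0 + t * ykin q / D
    < ymass q 0 + kap * wsum t (ymass q 1) (ymass q 2) (ymass q 3) (ymass q 4) (ymass q 5) ->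
  crit n j q.
Proof.
intros Hn. apply crit_scale; [assumption|].
pose proof (el1_cont _ (yf_el _ _ _ _ _ (yval_yfun kb be q Hkb Hbe))) as Cg.
pose proof (vint_poly H k kb al be t st F HH Hk Hkb Hal Hbe Ht Hst HF (yval kb be q) Cg) as E.
fold a b in E. eapply Rle_trans; [|exact E]. right.
rewrite !ymom_val. destruct wallis_values as [W1 [W2 [W3 [W4 W5]]]].
rewrite W1, W2, W3, W4, W5. unfold wsum, kap. pose proof a_pos. field. lra.
Qed.

Lemma full_lower : 4 * H * a * moment kb be 0 * (1 + 2 * kap * rho * (t / (1 - t)))
  <= RInt (vint H b F (fun _ => 1)) 0 a.
Proof.
pose proof (vint_full H k kb al be t st F HH Hk Hkb Hal Hbe Ht Hst HF) as E.
fold a b in E. fold kap rho in E. eapply Rle_trans; [|exact E]. right.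
rewrite moment_0. fold b. ring.
Qed.

Lemma crit_one n j : (0 < n)%nat -> (j <= n)%nat -> crit n j Yone.
Proof.
intros Hn Hj. apply crit_scale with (1 + 2 * kap * rho * (t / (1 - t))); [assumption|exact full_lower|].
unfold ymass, ykin. rewrite C_0, !Rmult_1_r, Rmult_0_r, Rdiv_0_l, Rplus_0_r.
apply arith_one; auto using v_range, kap_le_1.
- assert (0 < INR n) by now apply lt_0_INR. pose proof (pos_INR j). apply le_INR in Hj.
  split; [apply Rmult_le_pos; [lra|left; now apply Rinv_0_lt_compat]|].
  apply (Rmult_le_reg_r (INR n)); auto. unfold Rdiv. rewrite Rmult_assoc, Rinv_l by lra. lra.
- pose proof rho_lower. lra.
Qed.

(** Applying [cheb] with the mean [C 1] of cn^2 transfers the untruncated bound from 1 to cn, so the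
    criterion covers all [t] below 1. *)
Lemma crit_cnA n j : (0 < n)%nat -> (INR j / INR n) ^ 2 <= 4 / 9 -> crit n j Ycn.
Proof.
intros Hn Hj. destruct (C_ranges kb be v Hkb Hbe Hv Hclose) as [[C1 _] [N _]].
fold (C 1) in C1. fold (C 1) (C 2) in N.
apply crit_scale with (C 1 * (1 + 2 * kap * rho * (t / (1 - t)))); [assumption| |].
- assert (E := cheb H k kb al be t st F HH Hk Hkb Hal Hbe Ht Hst HF (C 1)). fold a b in E.
  change (RInt (vint H b F (yval kb be Ycn)) 0 a) with (RInt (vint H b F (fun y => jacobi_cn kb (be * y))) 0 a).
  eapply Rle_trans; [|apply E].
  + pose proof full_lower as L.
    apply Rle_trans with (C 1 * (4 * H * a * moment kb be 0 * (1 + 2 * kap * rho * (t / (1 - t))))).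
    * right. ring.
    * apply Rmult_le_compat_l; lra.
  + lra.
  + pose proof (ymom_val Yone 1) as Y1. pose proof (ymom_val Yone 0) as Y0.
    unfold ymass in Y1, Y0. rewrite C_0 in Y0.
    change (yval kb be Yone) with (fun _ : R => 1) in Y1, Y0. rewrite Y1, Y0. ring.
- unfold ymass, ykin. simpl Nat.add. apply arith_cnA; auto using v_range, rho_lower; try lra.
  split; [|apply kap_le_1]. apply kap_lower; [lra|]. pose proof v_range. assert (t ^ 2 <= 1) by nra.
  assert (v * t ^ 2 <= 2145 / 10000) by nra. lra.
Qed.

Lemma C_pos i : 0 <= C i.
Proof.
unfold C, nmom. pose proof M0_pos. apply Rmult_le_pos; [|left; now apply Rinv_0_lt_compat].
unfold moment. fold b. pose proof b_pos. apply RInt_cge0; [lra|apply cn_pow_ct|].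
intros y. rewrite pow_mult. apply pow_le, pow2_ge_0.
Qed.

Lemma kap_944 : t <= 3 / 4 -> 944 / 1000 <= kap <= 1.
Proof.
intros T. split; [|apply kap_le_1]. apply kap_lower; [lra|]. pose proof v_range.
assert (t ^ 2 <= 9 / 16) by nra. assert (v * t ^ 2 <= 2145 / 10000 * (9 / 16)) by nra. lra.
Qed.

Lemma kap_972 : t <= 516 / 1000 -> 972 / 1000 <= kap <= 1.
Proof.
intros T. split; [|apply kap_le_1]. apply kap_lower; [lra|]. pose proof v_range.
assert (t ^ 2 <= 266256 / 1000000) by nra.
assert (v * t ^ 2 <= 2145 / 10000 * (266256 / 1000000)) by nra. lra.
Qed.

Lemma crit_cn1 n j : (0 < n)%nat -> (j <= n)%nat -> t <= 3 / 4 -> crit n j Ycn.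
Proof.
intros Hn Hj T. destruct (C_ranges kb be v Hkb Hbe Hv Hclose) as [[C1 [C2 [C3 C4]]] [N _]].
apply crit_poly; auto. unfold ymass, ykin. simpl Nat.add.
apply arith_cn1; auto using v_range, kap_944, C_pos; unfold C; try lra.
assert (0 < INR n) by now apply lt_0_INR. pose proof (pos_INR j). apply le_INR in Hj.
split; [apply Rmult_le_pos; [lra|left; now apply Rinv_0_lt_compat]|].
apply (Rmult_le_reg_r (INR n)); auto. unfold Rdiv. rewrite Rmult_assoc, Rinv_l by lra. lra.
Qed.

Lemma crit_sn43 : t <= 516 / 1000 -> crit 3 1 Ysn.
Proof.
intros T. destruct (C_ranges kb be v Hkb Hbe Hv Hclose)
  as [[C1 _] [_ [N [_ [Y1 [Y2 [Y3 [Y4 [Y5 Y6]]]]]]]]].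
apply crit_poly; [lia|]. unfold ymass, ykin. simpl Nat.add. rewrite C_0. unfold C.
apply arith_sn43; auto using v_range, kap_972; try lra. simpl. lra.
Qed.

Lemma crit_sn32 : t <= 3 / 4 -> crit 2 0 Ysn.
Proof.
intros T. destruct (C_ranges kb be v Hkb Hbe Hv Hclose)
  as [[C1 _] [_ [N [_ [Y1 [Y2 [Y3 [Y4 [Y5 Y6]]]]]]]]].
apply crit_poly; [lia|]. unfold ymass, ykin. simpl Nat.add. rewrite C_0. unfold C.
replace (INR 0 / INR 2) with 0 by (simpl; lra).
apply arith_sn32; auto using v_range, kap_944; try lra.
Qed.

Lemma crit_sc43 : t <= 516 / 1000 -> crit 3 0 Ysc.
Proof.
intros T. destruct (C_ranges kb be v Hkb Hbe Hv Hclose)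
  as [[C1 _] [_ [_ [N [Y1 [Y2 [Y3 [Y4 [Y5 Y6]]]]]]]]].
apply crit_poly; [lia|]. unfold ymass, ykin. simpl Nat.add. unfold C.
replace (INR 0 / INR 3) with 0 by (simpl; lra).
apply arith_sncn; auto using v_range, kap_972; try lra.
Qed.

End Wente.

(* Dropping [1 / sqrt (1 - k^2 sin^2) >= 1] in the period equation. *)
Lemma x_closing_bound t k X : 0 < t < 1 -> 0 < k < 1 ->
  RInt (fun phi => (1 + t * cos phi ^ 2) / (1 - t * cos phi ^ 2)
    * / sqrt (1 - k ^ 2 * sin phi ^ 2)) 0 (PI / 2) = X * (PI / 2) ->
  2 - sqrt (1 - t) <= X * sqrt (1 - t).
Proof.
intros Ht Hk E. pose proof PI_RGT_0 as Hpi.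
assert (Ht' : 0 <= t < 1) by lra.
assert (P : forall p, 0 < 1 - t * cos p ^ 2) by (intros; now apply one_minus_cos_pos).
pose proof cont_cos as Cc. pose proof cont_sin as Cs.
assert (Ci : cont (fun p => / (1 - t * cos p ^ 2))).
{ apply cont_inv; [cts|]. intros p. apply Rgt_not_eq, P. }
assert (Cq : cont (fun p => / sqrt (1 - k ^ 2 * sin p ^ 2))).
{ intros p. now apply ellF_integrand_continuous. }
assert (L : RInt (fun p => 2 * / (1 - t * cos p ^ 2) - 1) 0 (PI / 2) <= X * (PI / 2)).
{ rewrite <- E. apply RInt_cle; [lra|cts| |].
  - unfold Rdiv. cts.
  - intros p. pose proof (ellF_integrand_ge1 k p Hk) as G. specialize (P p).
    pose proof (pow2_ge_0 (cos p)).
    replace (2 * / (1 - t * cos p ^ 2) - 1) with ((1 + t * cos p ^ 2) / (1 - t * cos p ^ 2)) by (field; lra).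
    assert (0 <= (1 + t * cos p ^ 2) / (1 - t * cos p ^ 2)).
    { apply Rmult_le_pos; [nra|left; now apply Rinv_0_lt_compat]. }
    nra. }
rewrite RInt_cminus, RInt_cscal, RInt_cconst in L by cts.
pose proof (RInt_inv_cos t 1 Ht') as E1. simpl INR in E1. rewrite !Rmult_1_l in E1. rewrite E1 in L.
assert (Hq : 0 < sqrt (1 - t)) by (apply sqrt_lt_R0; lra).
set (r := sqrt (1 - t)) in *.
apply (Rmult_le_reg_r (PI / 2 / r)); [apply Rdiv_lt_0_compat; lra|].
replace ((2 - r) * (PI / 2 / r)) with (2 * (PI / 2 / r) - (PI / 2 - 0) * 1) by (field; lra).
replace (X * r * (PI / 2 / r)) with (X * (PI / 2)) by (field; lra). exact L.
Qed.

(** * Upper bounds for t from the x-period equation *)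

Section TBound.

Variables (t v x : R).
Hypothesis Ht : 0 < t < 1.
Hypothesis Hv : 1 / 5 <= v.
Hypothesis Hx : 0 <= x.
Hypothesis HE : 2 - sqrt (1 - t) <=
  x * sqrt ((1 + v * t ^ 2) / ((1 + v * t) * (1 - t))) * sqrt (1 - t).

Lemma t_bound_sqr : (2 - sqrt (1 - t)) ^ 2 * (1 + v * t) <= x ^ 2 * (1 + v * t ^ 2).
Proof.
assert (Hq : 0 < sqrt (1 - t)) by (apply sqrt_lt_R0; lra).
assert (Eq : sqrt (1 - t) * sqrt (1 - t) = 1 - t) by (apply sqrt_sqrt; lra).
assert (P1 : 0 < 1 + v * t) by nra.
assert (P2 : 0 < 1 + v * t ^ 2) by (pose proof (pow2_ge_0 t); nra).
set (S := sqrt ((1 + v * t ^ 2) / ((1 + v * t) * (1 - t)))) in *.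
assert (ES : S * S = (1 + v * t ^ 2) / ((1 + v * t) * (1 - t))).
{ apply sqrt_sqrt. left. apply Rdiv_lt_0_compat; [lra|]. apply Rmult_lt_0_compat; lra. }
set (r := sqrt (1 - t)) in *.
assert (R1 : r < 1) by nra.
assert (Sq : (2 - r) ^ 2 <= (x * S * r) ^ 2) by (apply pow_incr; lra).
replace ((x * S * r) ^ 2) with (x ^ 2 * (S * S) * (r * r)) in Sq by ring.
rewrite ES, Eq in Sq.
replace (x ^ 2 * ((1 + v * t ^ 2) / ((1 + v * t) * (1 - t))) * (1 - t)) with
  (x ^ 2 * (1 + v * t ^ 2) / (1 + v * t)) in Sq by (field; lra).
apply (Rmult_le_compat_r (1 + v * t)) in Sq; [|lra].
replace (x ^ 2 * (1 + v * t ^ 2) / (1 + v * t) * (1 + v * t)) with (x ^ 2 * (1 + v * t ^ 2)) in Sq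
  by (field; lra). exact Sq.
Qed.

(** As [t ^ 2 <= t], the two factors containing [v] can be cancelled from the squared inequality. *)
Lemma t_bound_lower : 2 - x <= sqrt (1 - t).
Proof.
assert (Hq : 0 < sqrt (1 - t)) by (apply sqrt_lt_R0; lra).
pose proof t_bound_sqr as E. assert (V : 0 < v * t * (1 - t)) by (apply Rmult_lt_0_compat; nra).
assert (E2 : (2 - sqrt (1 - t)) ^ 2 * (1 + v * t) <= x ^ 2 * (1 + v * t)).
{ eapply Rle_trans; [exact E|]. apply Rmult_le_compat_l; [apply pow2_ge_0|nra]. }
apply Rmult_le_reg_r in E2; [|nra].
assert (X := sqr_le_cancel (2 - sqrt (1 - t)) x Hx E2). lra.
Qed.

Lemma t_bound_32 : x = 3 / 2 -> t <= 3 / 4.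
Proof.
intros E. pose proof t_bound_lower as L. rewrite E in L.
assert (Eq : sqrt (1 - t) * sqrt (1 - t) = 1 - t) by (apply sqrt_sqrt; lra). nra.
Qed.

(** [t_bound_lower] gives only 5/9, too weak for the sn cn mode with the constants of [arith_sncn].
    For [t] in the remaining gap, [sqrt (1 - t)] is below 0.6958, and the factors in [v] dropped
    before now make [t_bound_sqr] fail. *)
Lemma t_bound_43 : v <= 2145 / 10000 -> x = 4 / 3 -> t <= 516 / 1000.
Proof.
intros Hv2 E. pose proof t_bound_lower as L. pose proof t_bound_sqr as Q. rewrite E in L, Q.
assert (Eq : sqrt (1 - t) * sqrt (1 - t) = 1 - t) by (apply sqrt_sqrt; lra).
destruct (Rle_dec t (516 / 1000)) as [h|h]; [exact h|exfalso].
set (r := sqrt (1 - t)) in *.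
assert (R1 : r < 6958 / 10000) by nra.
assert (T : t <= 5 / 9) by nra.
assert (B : (2 - 6958 / 10000) ^ 2 <= (2 - r) ^ 2) by (apply pow_incr; lra).
assert (B2 : (2 - 6958 / 10000) ^ 2 * (1 + v * t) <= (4 / 3) ^ 2 * (1 + v * t ^ 2)).
{ eapply Rle_trans; [|exact Q]. apply Rmult_le_compat_r; [nra|exact B]. }
assert (TT : 246 / 1000 <= t * (1 - t)) by nra.
assert (VT : 1 / 5 * (246 / 1000) <= v * (t * (1 - t))) by (apply Rmult_le_compat; lra).
assert (VU : v * t <= 2145 / 10000 * (5 / 9)) by (apply Rmult_le_compat; lra).
nra.
Qed.

End TBound.

(** * The angles expressed through t and v *)

Lemma sin_range x : 0 < x < PI / 2 -> 0 < sin x < 1.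
Proof.
intros Hx. pose proof (sin_gt_0 x ltac:(lra) ltac:(lra)). pose proof (cos_gt_0 x ltac:(lra) ltac:(lra)).
pose proof (sin2_cos2 x) as E. unfold Rsqr in E. split; nra.
Qed.

Section Angles.

Variables (th tb : R).
Hypothesis Hth : 0 < th < PI / 2.
Hypothesis Htb : 0 < tb < PI / 2.
Hypothesis Hsum : th + tb < PI / 2.

Definition tprod : R := tan th * tan tb.
Definition vpar : R := (cos tb / sin tb) ^ 2.

Lemma trig_pos : 0 < sin th /\ 0 < cos th /\ 0 < sin tb /\ 0 < cos tb /\
  0 < cos th * cos tb - sin th * sin tb.
Proof.
rewrite <- cos_plus. repeat split; try (apply sin_gt_0; lra); apply cos_gt_0; lra.
Qed.

Lemma tprod_range : 0 < tprod < 1.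
Proof.
destruct trig_pos as [S1 [C1 [S2 [C2 P]]]]. unfold tprod, tan.
replace (sin th / cos th * (sin tb / cos tb)) with (sin th * sin tb / (cos th * cos tb)) by (field; lra).
assert (0 < cos th * cos tb) by nra. split.
- apply Rdiv_lt_0_compat; nra.
- apply (Rmult_lt_reg_r (cos th * cos tb)); auto. unfold Rdiv. rewrite Rmult_assoc, Rinv_l by lra. lra.
Qed.

Lemma vpar_eq : sin tb ^ 2 * (1 + vpar) = 1.
Proof.
destruct trig_pos as [_ [_ [S2 _]]]. pose proof (sin2_cos2 tb) as E. unfold Rsqr in E.
unfold vpar. replace (sin tb ^ 2 * (1 + (cos tb / sin tb) ^ 2)) with (sin tb * sin tb + cos tb * cos tb)
  by (field; lra). exact E.
Qed.

Lemma vt_sqr : 1 + vpar * tprod ^ 2 = / cos th ^ 2.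
Proof.
destruct trig_pos as [S1 [C1 [S2 [C2 _]]]]. pose proof (sin2_cos2 th) as E. unfold Rsqr in E.
unfold vpar, tprod, tan.
replace (1 + (cos tb / sin tb) ^ 2 * (sin th / cos th * (sin tb / cos tb)) ^ 2) with
  ((sin th * sin th + cos th * cos th) / cos th ^ 2) by (field; lra).
rewrite E. field. lra.
Qed.

Lemma k_eq : (1 - sin th ^ 2) * (1 + vpar * tprod ^ 2) = 1.
Proof.
destruct trig_pos as [S1 [C1 _]]. rewrite vt_sqr.
pose proof (sin2_cos2 th) as E. unfold Rsqr in E.
replace (1 - sin th ^ 2) with (cos th ^ 2) by (simpl; lra). field. lra.
Qed.

Lemma ratio_a : sin (2 * tb) / sin (2 * (th + tb)) =
  (1 + vpar * tprod ^ 2) / ((1 + vpar * tprod) * (1 - tprod)).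
Proof.
destruct trig_pos as [S1 [C1 [S2 [C2 P]]]]. rewrite vt_sqr.
rewrite !sin_2a, sin_plus, cos_plus. unfold vpar, tprod, tan.
assert (0 < sin th * cos tb + cos th * sin tb) by nra.
field. repeat split; lra.
Qed.

Lemma ratio_b : sin (2 * th) / sin (2 * (th + tb)) =
  tprod * (1 + vpar) / ((1 + vpar * tprod) * (1 - tprod)).
Proof.
destruct trig_pos as [S1 [C1 [S2 [C2 P]]]].
assert (E : 1 + vpar = / sin tb ^ 2).
{ pose proof vpar_eq as V. apply (Rmult_eq_reg_l (sin tb ^ 2)); [|apply Rgt_not_eq, pow2_gt_0; lra].
  rewrite V. field. lra. }
rewrite E. rewrite !sin_2a, sin_plus, cos_plus. unfold vpar, tprod, tan.
assert (0 < sin th * cos tb + cos th * sin tb) by nra.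
field. repeat split; lra.
Qed.

End Angles.

(** * Modes on the two lattices and the index bound *)

Lemma shift_Z (u : R -> R -> R) p q : (forall x y, u (x + p) (y + q) = u x y) ->
  forall (m : Z) x y, u (x + IZR m * p) (y + IZR m * q) = u x y.
Proof.
intros Hu m. induction m as [|m IH|m IH] using Z.peano_ind; intros x y.
- now rewrite !Rmult_0_l, !Rplus_0_r.
- rewrite succ_IZR. rewrite <- (IH x y), <- (Hu (x + IZR m * p)). f_equal; ring.
- unfold Z.pred. rewrite plus_IZR. rewrite <- (IH x y), <- Hu. f_equal; ring.
Qed.

Lemma periodic_basis v w (u : R -> R -> R) :
  (forall x y, u (x + fst v) (y + snd v) = u x y) ->
  (forall x y, u (x + fst w) (y + snd w) = u x y) -> periodic (v, w) u.
Proof.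
intros Hv Hw p [m1 [m2 [E1 E2]]] x y. simpl in E1, E2. rewrite E1, E2, <- !Rplus_assoc.
rewrite (shift_Z u _ _ Hw). apply (shift_Z u _ _ Hv).
Qed.

Lemma trig_shift_even s om x L m : om * L = 2 * INR m * PI -> trig s om (x + L) = trig s om x.
Proof.
intros E. unfold trig. rewrite Rmult_plus_distr_l, E.
destruct s; [apply cos_period|apply sin_period].
Qed.

Lemma trig_shift_odd s om x L m : om * L = 2 * INR m * PI + PI ->
  trig s om (x + L) = - trig s om x.
Proof.
intros E. unfold trig.
replace (om * (x + L)) with (om * x + PI + 2 * INR m * PI) by lra.
destruct s; [rewrite cos_period; apply neg_cos|rewrite sin_period; apply neg_sin].
Qed.

Lemma ytype_parity q q' : q <> q' -> ysg q * ysg q' = -1 \/ ytu q * ytu q' = -1.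
Proof. destruct q, q'; intros Hq; try congruence; unfold ytu; simpl; (left; lra) || (right; lra). Qed.

Definition mode : Set := (bool * nat * ytype)%type.

Section Assembly.

Variables (H k kb al be t st v : R) (F : R -> R -> R).
Hypothesis HH : 0 < H.
Hypothesis Hk : 0 < k < 1.
Hypothesis Hkb : 0 < kb < 1.
Hypothesis Hal : 0 < al.
Hypothesis Hbe : 0 < be.
Hypothesis Ht : 0 < t < 1.
Hypothesis Hst : st ^ 2 = t.
Hypothesis HF : forall x y,
  tanh (F x y / 4) = st * jacobi_cn k (al * x) * jacobi_cn kb (be * y).

Let a : R := 2 * ellK k / al.
Let b : R := 2 * ellK kb / be.

Variables (n N : nat) (e : R).
Hypothesis Hn : (0 < n)%nat.
Hypothesis HN : (N = (2 * n)%nat /\ e = 0) \/ (N = n /\ e = b).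

Let G : lattice := ((INR N * a, e), (0, 2 * b)).

Definition mode_fun (m : mode) : R -> R -> R :=
  let '(s, j, q) := m in fun x y => trig s (freq a n j) x * yval kb be q y.

(** A sine is excluded at [j = 0], where it vanishes, and at [j = n], where the correlation of the
    potential with [cos (2 * PI / a * x)] enters with the unfavourable sign. *)
Definition admissible (m : mode) : Prop :=
  let '(s, j, q) := m in
  (j <= n)%nat /\ (s = true \/ (0 < j < n)%nat) /\ (N = n -> Nat.odd j = ypar q) /\
  crit H k kb al be F n j q.

(** For equal y-factors orthogonality has to come from [x], and [j + j' < 2 n] keeps the sum of the
    frequencies below that of the potential. *)
Definition separated (m m' : mode) : Prop :=
  let '(s, j, q) := m in let '(s', j', q') := m' in
  q <> q' \/ (q = q' /\ (j + j' < 2 * n)%nat /\ (s <> s' \/ j <> j')).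

Lemma half_a_pos : 0 < a. Proof. now apply half_period_pos. Qed.
Lemma half_b_pos : 0 < b. Proof. now apply half_period_pos. Qed.

Lemma separated_sym m m' : separated m m' -> separated m' m.
Proof.
destruct m as [[s j] q], m' as [[s' j'] q']. simpl.
intros [Hq|[Hq [Hj Hs]]]; [left; congruence|right]. split; [congruence|]. split; [lia|].
destruct Hs; [left|right]; congruence.
Qed.

Lemma mode_el2 m : el2 (mode_fun m).
Proof.
destruct m as [[s j] q]. apply (el2_mult (fun x _ => trig s (freq a n j) x) (fun _ y => yval kb be q y)).
- apply el2_x, trig_el1.
- apply el2_y. exact (yf_el _ _ _ _ _ (yval_yfun kb be q Hkb Hbe)).
Qed.

Lemma mode_periodic m : admissible m -> periodic G (mode_fun m).
Proof.
destruct m as [[s j] q]. intros [_ [_ [Hpar _]]]. pose proof half_a_pos as Pa.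
assert (Hn' : 0 < INR n) by now apply lt_0_INR.
pose proof (yf_shift _ _ _ _ _ (yval_yfun kb be q Hkb Hbe)) as Sh. fold b in Sh.
apply periodic_basis; intros x y; simpl.
- destruct HN as [[E1 E2]|[E1 E2]]; rewrite E1, E2.
  + rewrite Rplus_0_r, (trig_shift_even s _ x _ j); [reflexivity|].
    unfold freq. rewrite mult_INR. simpl INR. field. lra.
  + rewrite Sh. specialize (Hpar E1). unfold ytu. rewrite <- Hpar.
    destruct (Nat.odd j) eqn:Oj.
    * apply Nat.odd_spec in Oj. destruct Oj as [m Hm].
      rewrite (trig_shift_odd s _ x _ m); [ring|].
      rewrite Hm. unfold freq. rewrite plus_INR, mult_INR. simpl INR. field. lra.
    * assert (Ej : Nat.Even j) by (apply Nat.even_spec; rewrite <- Nat.negb_odd, Oj; reflexivity).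
      destruct Ej as [m Hm].
      rewrite (trig_shift_even s _ x _ m); [ring|].
      rewrite Hm. unfold freq. rewrite mult_INR. simpl INR. field. lra.
- rewrite Rplus_0_r. replace (y + 2 * b) with (y + b + b) by ring. rewrite !Sh.
  pose proof (yf_tu _ _ _ _ _ (yval_yfun kb be q Hkb Hbe)) as T.
  replace (ytu q * (ytu q * yval kb be q y)) with (ytu q ^ 2 * yval kb be q y) by ring.
  rewrite T. ring.
Qed.

Lemma F_cont : cont2 F.
Proof. exact (F_cont2 k kb al be t st F Hk Hkb Ht Hst HF). Qed.

Lemma N_cases : N = (2 * n)%nat \/ N = n.
Proof. destruct HN as [[E _]|[E _]]; auto. Qed.

Lemma mode_neg m : admissible m -> bil G H F (mode_fun m) (mode_fun m) < 0.
Proof.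
destruct m as [[s j] q]. intros [Hj [Hs [_ Hc]]].
exact (bil_neg H a b e n N F half_a_pos half_b_pos Hn F_cont
  (pot_x H k kb al be t st F Hk Hal Hst HF) (pot_y H k kb al be t st F Hkb Hbe Hst HF) N_cases
  (pot_corr H k kb al be t st F HH Hk Hal Ht Hst HF) s j _ _ _ _ (yval_yfun kb be q Hkb Hbe) Hj Hs Hc).
Qed.

Lemma mode_orth m m' : admissible m -> admissible m' -> separated m m' ->
  bil G H F (mode_fun m) (mode_fun m') = 0.
Proof.
destruct m as [[s j] q], m' as [[s' j'] q']. intros [Hj [Hs [Hp _]]] [Hj' [Hs' [Hp' _]]].
intros [Hq|[Hq [Hjj Hd]]].
- exact (bil_orth_y H a b e n N F half_a_pos half_b_pos Hn F_cont
    (pot_y H k kb al be t st F Hkb Hbe Hst HF) (pot_yo H k kb al be t st F Hkb Hst HF) N_cases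
    s s' _ _ _ _ _ _ _ _ _ _ (yval_yfun kb be q Hkb Hbe) (yval_yfun kb be q' Hkb Hbe) (ytype_parity q q' Hq)).
- subst q'.
  apply (bil_orth_x H a b e n N F half_a_pos half_b_pos Hn F_cont
    (pot_x H k kb al be t st F Hk Hal Hst HF) (pot_y H k kb al be t st F Hkb Hbe Hst HF) N_cases
    s s' j j' _ _ _ _ (yval_yfun kb be q Hkb Hbe)); auto.
  + destruct Hs; [left|right]; auto; lia.
  + destruct Hs'; [left|right]; auto; lia.
  + intros E. apply Nat.even_spec. rewrite Nat.even_add, <- !Nat.negb_odd, Hp, Hp' by assumption.
    now destruct (ypar q).
Qed.

Lemma volume_pos : 0 < torus_int G (area_density H F).
Proof.
pose proof half_a_pos as Pa. pose proof half_b_pos as Pb.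
assert (C := area_density_cont H F F_cont).
assert (PN : 0 < INR N) by (apply lt_0_INR; destruct N_cases as [E|E]; rewrite E; lia).
assert (P : forall x y, 0 < area_density H F x y).
{ intros. apply Rdiv_lt_0_compat; [apply exp_pos|exact HH]. }
pose proof (torus_int_cont G _ C) as C2.
unfold torus_int. apply Rmult_lt_0_compat.
- apply Rabs_pos_lt. simpl. assert (0 < INR N * a * (2 * b)) by (apply Rmult_lt_0_compat; [now apply Rmult_lt_0_compat|lra]). lra.
- assert (P2 : forall s, 0 < RInt (fun t => area_density H F (s * fst (fst G) + t * fst (snd G))
      (s * snd (fst G) + t * snd (snd G))) 0 1).
  { intros s. apply RInt_gt_0; [lra|intros; apply P|].
    intros x _. exact (cont2_slice _ s C2 x). }
  apply RInt_gt_0; [lra|intros; apply P2|].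
  intros s _. refine (cont_RInt_param _ 0 1 C2 s).
Qed.

Lemma index_ge_modes (d : nat -> mode) M : d 0%nat = (true, 0%nat, Yone) ->
  (forall i, (i <= M)%nat -> admissible (d i)) ->
  (forall i j, (i < j <= M)%nat -> separated (d i) (d j)) ->
  Rbar_le (Finite (INR M)) (Ind G H F).
Proof.
intros E0 Hd Hs. apply (Ind_ge M G H F (fun i => mode_fun (d i)) F_cont).
- intros. apply mode_el2.
- intros. now apply mode_periodic, Hd.
- intros i j Hi Hj Hij. apply mode_orth; auto.
  destruct (Nat.lt_ge_cases i j); [apply Hs; lia|apply separated_sym, Hs; lia].
- intros. now apply mode_neg, Hd.
- rewrite (torus_int_ext _ _ (area_density H F)).
  + apply Rgt_not_eq, volume_pos.
  + intros x y. rewrite E0. simpl. unfold trig, freq. simpl INR.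
    replace (0 * PI / (INR n * a) * x) with 0 by (unfold Rdiv; ring). rewrite cos_0. ring.
Qed.

End Assembly.

(** * Choice of nine modes for each fraction *)

(** [crit_cnA] reaches [j <= 2 n / 3]. Odd [l] uses cn with [j = 1, 2], hence [n >= 3]; even [l]
    must use odd [j], here 1 and 3, hence [n >= 5]. Only 3/2 and 4/3 escape. *)
Lemma fraction_cases l n : (0 < n)%nat -> Nat.gcd l n = 1%nat -> 1 < INR l / INR n < 2 ->
  (Nat.odd l = true /\ (3 <= n)%nat) \/ (Nat.odd l = false /\ (5 <= n)%nat) \/
  (l = 3%nat /\ n = 2%nat) \/ (l = 4%nat /\ n = 3%nat).
Proof.
intros Hn Hg [H1 H2]. assert (Hn' : 0 < INR n) by now apply lt_0_INR.
assert (L1 : (n < l)%nat).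
{ apply INR_lt. apply (Rmult_lt_compat_r (INR n)) in H1; auto. unfold Rdiv in H1.
  rewrite Rmult_assoc, Rinv_l in H1 by lra. lra. }
assert (L2 : (l < 2 * n)%nat).
{ apply INR_lt. apply (Rmult_lt_compat_r (INR n)) in H2; auto. unfold Rdiv in H2.
  rewrite Rmult_assoc, Rinv_l in H2 by lra. rewrite mult_INR. simpl INR. lra. }
destruct (Nat.le_gt_cases 5 n) as [h|h].
- destruct (Nat.odd l); [left|right; left]; split; auto; lia.
- do 5 (destruct n as [|n]; [first [exfalso; lia|
    do 8 (destruct l as [|l]; [first [exfalso; lia|exfalso; vm_compute in Hg; discriminate|
      vm_compute; intuition lia]|]); exfalso; lia]|]). lia.
Qed.

(* For even [l] the lattice contains [(n a, b)], which forces the parity of [j] to match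
   the half-period antisymmetry of the y-factor. *)
Definition modes_odd : list mode :=
  [(true, 0, Yone); (true, 1, Yone); (false, 1, Yone); (true, 2, Yone); (false, 2, Yone);
   (true, 1, Ycn); (false, 1, Ycn); (true, 2, Ycn); (false, 2, Ycn)]%nat.

Definition modes_even : list mode :=
  [(true, 0, Yone); (true, 2, Yone); (false, 2, Yone); (true, 4, Yone); (false, 4, Yone);
   (true, 1, Ycn); (false, 1, Ycn); (true, 3, Ycn); (false, 3, Ycn)]%nat.

(** With [n = 2] the index 2 is the top one and admits only the cosine, so each of 1 and cn supplies
    four modes; sn at frequency 0 is the ninth. *)
Definition modes_3_2 : list mode :=
  [(true, 0, Yone); (true, 1, Yone); (false, 1, Yone); (true, 2, Yone);
   (true, 0, Ycn); (true, 1, Ycn); (false, 1, Ycn); (true, 2, Ycn); (true, 0, Ysn)]%nat.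

(** On this skew lattice 1 and sn cn take even [j], cn and sn odd [j]. With [n = 3], 1 and cn supply
    three modes each, sn two more at [j = 1], and sn cn the last at [j = 0]. *)
Definition modes_4_3 : list mode :=
  [(true, 0, Yone); (true, 2, Yone); (false, 2, Yone);
   (true, 1, Ycn); (false, 1, Ycn); (true, 3, Ycn);
   (true, 1, Ysn); (false, 1, Ysn); (true, 0, Ysc)]%nat.

Lemma ratio_sqr_bound n j : (0 < n)%nat -> (3 * j <= 2 * n)%nat -> (INR j / INR n) ^ 2 <= 4 / 9.
Proof.
intros Hn Hj. assert (Hn' : 0 < INR n) by now apply lt_0_INR.
apply le_INR in Hj. rewrite !mult_INR in Hj. simpl INR in Hj. pose proof (pos_INR j).
replace (4 / 9) with ((2 / 3) ^ 2) by (field; lra). apply pow_incr.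
split; [apply Rmult_le_pos; [lra|left; now apply Rinv_0_lt_compat]|].
apply (Rmult_le_reg_r (INR n)); auto. unfold Rdiv. rewrite Rmult_assoc, Rinv_l by lra. lra.
Qed.

Ltac each_index tac := intros i Hi; do 9 (destruct i as [|i]; [tac|]); exfalso; lia.
Ltac each_pair tac := intros i j Hij;
  do 9 (destruct i as [|i]; [do 9 (destruct j as [|j]; [tac|]); exfalso; lia|]); exfalso; lia.
Ltac separate := first [exfalso; lia | left; discriminate |
  right; split; [reflexivity|split; [lia|first [left; discriminate|right; discriminate]]]].

Section Families.

Variables (H k kb al be t st v : R) (F : R -> R -> R).
Hypothesis HH : 0 < H.
Hypothesis Hk : 0 < k < 1.
Hypothesis Hkb : 0 < kb < 1.
Hypothesis Hal : 0 < al.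
Hypothesis Hbe : 0 < be.
Hypothesis Ht : 0 < t < 1.
Hypothesis Hst : st ^ 2 = t.
Hypothesis HF : forall x y,
  tanh (F x y / 4) = st * jacobi_cn k (al * x) * jacobi_cn kb (be * y).
Hypothesis Hv : kb ^ 2 * (1 + v) = 1.
Hypothesis Hkv : (1 - k ^ 2) * (1 + v * t ^ 2) = 1.
Hypothesis Hclose : (1 - 2 * kb ^ 2) * moment kb be 0 + 2 * kb ^ 2 * moment kb be 1 = 0.
Hypothesis Hal2 : al ^ 2 = 4 * H * ((1 + v * t ^ 2) / ((1 + v * t) * (1 - t))).
Hypothesis Hbe2 : be ^ 2 = 4 * H * (t * (1 + v) / ((1 + v * t) * (1 - t))).

Let a : R := 2 * ellK k / al.
Let b : R := 2 * ellK kb / be.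

Lemma index_ge_8 l n : (0 < n)%nat -> Nat.gcd l n = 1%nat -> 1 < INR l / INR n < 2 ->
  (l = 3%nat -> n = 2%nat -> t <= 3 / 4) -> (l = 4%nat -> n = 3%nat -> t <= 516 / 1000) ->
  Rbar_le (Finite 8)
    (Ind ((if Nat.odd l then (INR (2 * n) * a, 0) else (INR n * a, b)), (0, 2 * b)) H F).
Proof.
intros Hn Hg Hr T32 T43.
replace 8 with (INR 8) by (simpl; lra).
assert (K1 : forall j, (j <= n)%nat -> crit H k kb al be F n j Yone).
{ intros j Hj. exact (crit_one H k kb al be t st v F HH Hk Hkb Hal Hbe Ht Hst HF Hv Hclose Hal2 Hbe2 n j Hn Hj). }
assert (K2 : forall j, (3 * j <= 2 * n)%nat -> crit H k kb al be F n j Ycn).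
{ intros j Hj. eapply crit_cnA; eauto using ratio_sqr_bound. }
destruct (fraction_cases l n Hn Hg Hr) as [[Ho Hn3]|[[Ho Hn5]|[[El En]|[El En]]]].
- rewrite Ho.
  apply (index_ge_modes H k kb al be t st F HH Hk Hkb Hal Hbe Ht Hst HF n (2 * n) 0 Hn
    (or_introl (conj eq_refl eq_refl)) (fun i => List.nth i modes_odd (true, 0%nat, Yone))).
  + reflexivity.
  + each_index ltac:(split; [lia|split; [first [left; reflexivity|right; lia]|
      split; [intros; exfalso; lia|first [apply K1; lia|apply K2; lia]]]]).
  + each_pair separate.
- rewrite Ho.
  apply (index_ge_modes H k kb al be t st F HH Hk Hkb Hal Hbe Ht Hst HF n n b Hn
    (or_intror (conj eq_refl eq_refl)) (fun i => List.nth i modes_even (true, 0%nat, Yone))).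
  + reflexivity.
  + each_index ltac:(split; [lia|split; [first [left; reflexivity|right; lia]|
      split; [intros; reflexivity|first [apply K1; lia|apply K2; lia]]]]).
  + each_pair separate.
- specialize (T32 El En). subst l n. change (Nat.odd 3) with true. cbv iota.
  assert (K3 : forall j, (j <= 2)%nat -> crit H k kb al be F 2 j Ycn).
  { intros j Hj. eapply crit_cn1; eauto. }
  assert (K4 : crit H k kb al be F 2 0 Ysn) by (eapply crit_sn32; eauto).
  apply (index_ge_modes H k kb al be t st F HH Hk Hkb Hal Hbe Ht Hst HF 2 (2 * 2) 0 Hn
    (or_introl (conj eq_refl eq_refl)) (fun i => List.nth i modes_3_2 (true, 0%nat, Yone))).
  + reflexivity.
  + each_index ltac:(split; [lia|split; [first [left; reflexivity|right; lia]|
      split; [intros; exfalso; lia|first [exact K4|apply K1; lia|apply K3; lia]]]]).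
  + each_pair separate.
- specialize (T43 El En). subst l n. change (Nat.odd 4) with false. cbv iota.
  assert (K3 : forall j, (j <= 3)%nat -> crit H k kb al be F 3 j Ycn).
  { intros j Hj. eapply crit_cn1; eauto. lra. }
  assert (K4 : crit H k kb al be F 3 1 Ysn) by (eapply crit_sn43; eauto).
  assert (K5 : crit H k kb al be F 3 0 Ysc) by (eapply crit_sc43; eauto).
  apply (index_ge_modes H k kb al be t st F HH Hk Hkb Hal Hbe Ht Hst HF 3 3 b Hn
    (or_intror (conj eq_refl eq_refl)) (fun i => List.nth i modes_4_3 (true, 0%nat, Yone))).
  + reflexivity.
  + each_index ltac:(split; [lia|split; [first [left; reflexivity|right; lia]|
      split; [intros; reflexivity|first [exact K4|exact K5|apply K1; lia|apply K3; lia]]]]).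
  + each_pair separate.
Qed.

End Families.

Theorem mainTheorem1 (H : R) (l n : nat) (theta thetab : R)
  (F : R -> R -> R) (X Nu : R3map)
  (H_pos : 0 < H)
  (l_pos : (0 < l)%nat) (n_pos : (0 < n)%nat)
  (l_n_coprime : Nat.gcd l n = 1%nat)
  (l_n_range : 1 < INR l / INR n < 2)
  (theta_range : 0 < theta < PI / 2)
  (thetab_range : 0 < thetab < PI / 2)
  (theta_sum : theta + thetab < PI / 2)
  (F_def : is_wente_F H theta thetab F)
  (X_immersion : is_wente_immersion H F X Nu)
  (y_closing : closes_in_y H theta thetab X)
  (x_closing : x_period_equation l n theta thetab) :
  Rbar_le (Finite 8) (Ind (wente_lattice l n H theta thetab) H F).
Proof.
pose proof (sin_range theta theta_range) as Hk.
pose proof (sin_range thetab thetab_range) as Hkb.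
pose proof (tprod_range theta thetab theta_range thetab_range theta_sum) as Ht.
pose proof (vpar_eq theta thetab theta_range thetab_range theta_sum) as Hv.
pose proof (k_eq theta thetab theta_range thetab_range theta_sum) as Hkv.
pose proof (ratio_a theta thetab theta_range thetab_range theta_sum) as Ra.
pose proof (ratio_b theta thetab theta_range thetab_range theta_sum) as Rb.
unfold is_wente_F in F_def. unfold closes_in_y, y_period in y_closing.
unfold x_period_equation in x_closing. unfold wente_lattice, x_period, y_period.
assert (Hst : (sqrt (tan theta) * sqrt (tan thetab)) ^ 2 = tprod theta thetab).
{ rewrite Rpow_mult_distr, !pow2_sqrt; [reflexivity| |]; left; apply tan_gt_0; lra. }
assert (Hst0 : 0 <= sqrt (tan theta) * sqrt (tan thetab)).
{ apply Rmult_le_pos; apply sqrt_pos. }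
rewrite Ra in x_closing. fold (tprod theta thetab) in x_closing.
unfold alpha, alphab in *. rewrite Ra, Rb in *.
(* From here on the angles survive only through [t], [v], the two moduli and the algebraic relations
   just recorded. *)
set (st := sqrt (tan theta) * sqrt (tan thetab)) in *.
set (t := tprod theta thetab) in *. set (v := vpar thetab) in *.
set (k := sin theta) in *. set (kb := sin thetab) in *. clearbody st t v k kb.
assert (Hv0 : 0 < v) by nra.
assert (HD : 0 < (1 + v * t) * (1 - t)) by (apply Rmult_lt_0_compat; nra).
assert (Ht2 : 0 < t ^ 2 < 1) by nra.
assert (Pa : 0 < 4 * H * ((1 + v * t ^ 2) / ((1 + v * t) * (1 - t)))).
{ apply Rmult_lt_0_compat; [lra|]. apply Rdiv_lt_0_compat; nra. }
assert (Pb : 0 < 4 * H * (t * (1 + v) / ((1 + v * t) * (1 - t)))).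
{ apply Rmult_lt_0_compat; [lra|]. apply Rdiv_lt_0_compat; nra. }
pose proof (sqrt_lt_R0 _ Pa) as Hal. pose proof (sqrt_lt_R0 _ Pb) as Hbe.
pose proof (pow2_sqrt _ (Rlt_le _ _ Pa)) as Hal2. pose proof (pow2_sqrt _ (Rlt_le _ _ Pb)) as Hbe2.
set (al := sqrt (4 * H * ((1 + v * t ^ 2) / ((1 + v * t) * (1 - t))))) in *.
set (be := sqrt (4 * H * (t * (1 + v) / ((1 + v * t) * (1 - t))))) in *. clearbody al be.
assert (Hk2 : 0 < 1 - k ^ 2) by nra.
assert (Hrel : st * al * sqrt (1 - k ^ 2) = kb * be).
(* Both sides are nonnegative and have the square [4 H t / ((1 + v t) (1 - t))]. *)
{ apply Rsqr_inj.
  - apply Rmult_le_pos; [apply Rmult_le_pos; lra|apply sqrt_pos].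
  - apply Rmult_le_pos; lra.
  - rewrite !Rsqr_pow2, !Rpow_mult_distr, pow2_sqrt, Hst, Hal2, Hbe2 by lra.
    replace (1 - k ^ 2) with (/ (1 + v * t ^ 2)).
    + replace (kb ^ 2) with (/ (1 + v)); [field; repeat split; nra|].
      apply (Rmult_eq_reg_r (1 + v)); [|lra]. rewrite Hv. field. lra.
    + apply (Rmult_eq_reg_r (1 + v * t ^ 2)); [|nra]. rewrite Hkv. field. nra. }
assert (Hclose : (1 - 2 * kb ^ 2) * moment kb be 0 + 2 * kb ^ 2 * moment kb be 1 = 0).
{ apply (closing_moment H k kb al be st F X Nu Hk Hkb Hal Hrel F_def X_immersion).
  intros j x y. rewrite <- (y_closing j x y). f_equal. field. lra. }
pose proof (v_range kb be v Hkb Hbe Hv Hclose) as [V1 V2].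
set (S := sqrt ((1 + v * t ^ 2) / ((1 + v * t) * (1 - t)))) in *.
assert (XB : 2 - sqrt (1 - t) <= INR l / INR n * S * sqrt (1 - t)).
{ apply (x_closing_bound t k _ Ht Hk). etransitivity; [exact x_closing|rring]. }
assert (E := index_ge_8 H k kb al be t st v F H_pos Hk Hkb Hal Hbe Ht Hst F_def Hv Hkv Hclose Hal2 Hbe2
  l n n_pos l_n_coprime l_n_range).
match type of E with _ -> _ -> Rbar_le _ (Ind ?G' _ _) =>
  match goal with |- Rbar_le _ (Ind ?G _ _) => replace G with G' end end.
- apply E; intros El En; rewrite El, En in XB.
  + apply (t_bound_32 t v (INR 3 / INR 2)); auto; simpl; lra.
  + apply (t_bound_43 t v (INR 4 / INR 3)); auto; simpl; lra.
(* [wente_lattice] is written in full periods [4 K / al], the index bound in half periods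
   [2 K / al]. *)
- replace (4 / al * ellK k) with (2 * (2 * ellK k / al)) by (field; lra).
  replace (4 / be * ellK kb) with (2 * (2 * ellK kb / be)) by (field; lra).
  rewrite mult_INR. simpl (INR 2).
  replace (INR n * (2 * (2 * ellK k / al)) / 2) with (INR n * (2 * ellK k / al)) by (field; lra).
  replace (2 * (2 * ellK kb / be) / 2) with (2 * ellK kb / be) by (field; lra).
  replace (INR n * (2 * (2 * ellK k / al))) with ((1 + 1) * INR n * (2 * ellK k / al)) by ring.
  reflexivity.
Qed.
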